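(* Let $p\ge 14$. For every $\varepsilon>0$ there exists a constant $C_p$, independent of $N$ (it may depend on $p$ and $\varepsilon$), such that for every positive integer $N$ $$A_{p,N}\le C_p\, N^{1-\frac{8}{p}+\varepsilon}.$$
   Context: Let $\mathbb T=\mathbb R/\mathbb Z$. For $p\ge 2$ put $p'=p/(p-1)$. For a positive integer $N$, $A_{p,N}$ denotes the best (smallest) constant such that $$\sum_{n=-N}^{N}\bigl|\widehat f(n,n^3)\bigr|^2\le A_{p,N}\,\|f\|_{L^{p'}(\mathbb T^2)}^2$$ for all (periodic) functions $f$ on $\mathbb T^2$, where $\widehat f(n_1,n_2)=\int_{\mathbb T^2} f(x,t)e^{-2\pi i(n_1x+n_2t)}\,dx\,dt$ is the Fourier transform on $\mathbb T^2$. *)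

(* Defs.v *)
From HB Require Import structures.
From mathcomp Require Import all_boot all_order all_algebra.
From mathcomp Require Import all_classical all_reals all_analysis.
From mathcomp.real_closed Require Import complex.

Set Implicit Arguments.
Unset Strict Implicit.
Unset Printing Implicit Defensive.

Import Order.TTheory GRing.Theory Num.Theory.
Import numFieldNormedType.Exports.

Local Open Scope classical_set_scope.
Local Open Scope ring_scope.
Local Open Scope complex_scope.

(* Functions on T^2 = (R/Z)^2 are represented by functions on R^2 that are
   1-periodic in each variable, and integrals over T^2 by Lebesgue integrals
   over the fundamental domain [0,1]^2. *)

Section torus.
Context {R : realType}.

Local Notation leb2 := (@lebesgue_measure R \x @lebesgue_measure R)%E.

Definition unit_square : set (R * R) := `[0, 1] `*` `[0, 1].

(* The library integrates only (extended) real-valued functions. *)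
Definition cintegral (g : R * R -> R[i]) : R[i] :=
  (\int[leb2]_(z in unit_square) complex.Re (g z))
  +i* (\int[leb2]_(z in unit_square) complex.Im (g z)).

(* e^(i theta) *)
Definition expi (theta : R) : R[i] := cos theta +i* sin theta.

Definition fourier (f : R * R -> R[i]) (n1 n2 : int) : R[i] :=
  cintegral
    (fun z => f z * expi (- (2 * pi * (n1%:~R * z.1 + n2%:~R * z.2)))).

Definition torus_norm (q : R) (f : R * R -> R[i]) : \bar R :=
  ((\int[leb2]_(z in unit_square) (Normc.normc (f z) `^ q)%:E) `^ q^-1)%E.

(* Membership in L^q(T^2), before identification of a.e. equal functions. *)
Definition torus_Lfun (q : R) (f : R * R -> R[i]) : Prop :=
  [/\ periodic f (1, 0), periodic f (0, 1),
      measurable_fun setT (fun z => complex.Re (f z)),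
      measurable_fun setT (fun z => complex.Im (f z)) &
      (torus_norm q f < +oo)%E].

(* The index k in [0, 2N] encodes the frequency n = k - N in [-N, N]. *)
Definition cubic_energy (N : nat) (f : R * R -> R[i]) : R :=
  \sum_(0 <= k < (2 * N).+1)
    let n := k%:Z - N%:Z in Normc.normc (fourier f n (n ^+ 3)) ^+ 2.

Definition restriction_bound (p : R) (N : nat) (A : R) : Prop :=
  forall f : R * R -> R[i], torus_Lfun (p / (p - 1)) f ->
    ((cubic_energy N f)%:E <= A%:E * torus_norm (p / (p - 1)) f ^+ 2)%E.

(* The infimum is taken in \bar R so that an empty set of admissible constants
   would give +oo rather than a junk value. *)
Definition best_constant (p : R) (N : nat) : \bar R :=
  ereal_inf [set A%:E | A in restriction_bound p N].

End torus.

(* Main.v *)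
Require Import Defs.
From HB Require Import structures.
From mathcomp Require Import all_boot all_order all_algebra.
From mathcomp Require Import all_classical all_reals all_analysis.
From mathcomp.real_closed Require Import complex.
From mathcomp Require Import measurable_realfun.
From mathcomp Require Import zify ring lra.

Set Implicit Arguments.
Unset Strict Implicit.
Unset Printing Implicit Defensive.

Import Order.TTheory GRing.Theory Num.Theory.
Import numFieldNormedType.Exports.

(** Let S(f) be the sum of |f^(n,n^3)|^2 over |n| <= N; below, N^o(1) stands for
    factors bounded by the logarithm or by the number of divisors of integers
    of size O(N^3).

    Reduction to a grid.  Since (n,n^3) is an integral point, a translation of
    f multiplies f^(n,n^3) by a number of modulus 1.  Averaging f over its
    translates by the points (i/M, j/T) therefore reduces the inequality on the
    torus to the same inequality on the finite group Z_M x Z_T, for whatever M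
    and T ([transference]).  All integrals disappear, and T may be taken
    divisible by every modulus that occurs, so that the rational points of the
    second axis lie on the grid.

    Restricted type.  Let |phi| <= 1_E on the grid, where E has density alpha.
    The heart of the proof ([grid_restricted_bound]) is that the normalised
    energy of phi is at most N^o(1) N^(1 - 8/p) alpha^(2 - 2/p).  The trivial
    bound 3 N alpha^2 is better than this for alpha <= N^(-4); for larger alpha
    the case p = 14, that is N^(3/7) alpha^(13/7), is the strongest one.  Two
    estimates give it.

    (1) Large alpha.  The identity s^3 - B = 3 (s - a)(s - b)(s - c), valid for
    s = a + b + c and B = a^3 + b^3 + c^3, shows that s and B determine a, b, c
    up to N^o(1) choices, except when two of the three are opposite.  Hence an
    L^6 estimate without loss of a power of N ([grid_sixth_moment]), whose dual
    is an energy bound N^o(1) alpha^(5/3); this suffices for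
    alpha >= N^(-9/4).

    (2) Small alpha.  For N^2 <= Q <= N^3 the energy is at most
    N^o(1) (alpha / Q + (N Q)^(1/4) alpha^2) ([grid_mixed_bound]), and the two
    terms balance at Q = N^(5/7) alpha^(-4/7).  This is a circle method in
    which positivity replaces the major arcs.  For each frequency the Fourier
    coefficient is a sum of some h over Z_T, and for a prime q dividing T the
    correlations of h at the shifts a T / q + u - u', with 0 <= a < q and u, u'
    in a short window, add up to at least a fixed multiple of q |sum of h|^2
    ([autocorrelation_ge]).  The shifts with a = 0 are controlled by Bessel's
    inequality.  At the others the kernel, which is the exponential sum of
    n x + n^3 t over |n| <= N, has t close to a / q, and Weyl's inequality
    bounds it by N^o(1) (N Q)^(1/4).  The inequality is added up over the
    primes q <= Q lying within a logarithmic factor of Q: the main term is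
    multiplied by about Q^2, while the neighbourhoods of the points a / q are
    disjoint, so that all the kernel terms together cost a single squared L^1
    norm ([grid_mixed_inequality]).

    Strong type.  Cutting |phi| at levels in geometric progression of ratio N^d
    leaves O(1/d) pieces to which the restricted bound applies, at the price of
    a factor N^(2 d); this price is absorbed by the factor N^eps
    ([grid_strong_bound]). *)

(** * Divisors and primes *)

Local Open Scope nat_scope.

Lemma size_divisors_mul m n : 0 < m -> 0 < n ->
  size (divisors (m * n)) <= size (divisors m) * size (divisors n).
Proof.
move=> m0 n0; rewrite -(size_allpairs muln).
apply: uniq_leq_size; first exact: divisors_uniq.
move=> d; rewrite -dvdn_divisors ?muln_gt0 ?m0// => dmn.
(* a divisor d of m n is the product of its gcd with m and a divisor of n *)
apply/allpairsP; exists (gcdn d m, d %/ gcdn d m) => /=.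
have g0 : 0 < gcdn d m by rewrite gcdn_gt0 m0 orbT.
split.
- by rewrite -dvdn_divisors// dvdn_gcdr.
- rewrite -dvdn_divisors//.
  rewrite -(@Gauss_dvdr _ (m %/ gcdn d m)).
    rewrite -(dvdn_pmul2r g0) divnK ?dvdn_gcdl//.
    by rewrite mulnAC divnK ?dvdn_gcdr.
  by rewrite /coprime -(eqn_pmul2r g0) muln_gcdl !divnK ?dvdn_gcdl ?dvdn_gcdr// mul1n.
- by rewrite mulnC divnK// dvdn_gcdl.
Qed.

Lemma size_divisors_primeX p a : prime p -> size (divisors (p ^ a)) <= a.+1.
Proof.
move=> pp; have <- : size (map (expn p) (iota 0 a.+1)) = a.+1.
  by rewrite size_map size_iota.
apply: uniq_leq_size; first exact: divisors_uniq.
move=> d; rewrite -dvdn_divisors ?expn_gt0 ?prime_gt0//.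
move=> /(dvdn_pfactor _ _ pp)[m ma ->].
by apply: map_f; rewrite mem_iota add0n ltnS.
Qed.

Lemma central_bin_ge n : 2 ^ n <= 'C(n.*2, n).
Proof.
elim: n => // n IH; rewrite expnS mul2n -addnn doubleS binS leq_add//.
  by rewrite binS; apply: leq_trans IH _; exact: leq_addl.
case: n IH => // n IH; rewrite binS.
by apply: leq_trans IH _; exact: leq_addr.
Qed.

(** The exponent of p in a binomial coefficient counts the k for which a carry
    occurs: each p^k <= 2 n contributes at most 1, and larger powers nothing. *)
Lemma logn_central_bin p n : prime p -> 0 < n ->
  p ^ logn p 'C(n.*2, n) <= n.*2.
Proof.
move=> pp n0; have n20 : 0 < n.*2 by rewrite double_gt0.
have cE : logn p 'C(n.*2, n) + (logn p n`!).*2 = logn p (n.*2)`!.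
  have := @bin_fact n.*2 n; rewrite -addnn leq_addr addnK => /(_ isT) <-.
  by rewrite !lognM ?muln_gt0 ?fact_gt0 ?bin_gt0 ?leq_addr// (addnn (logn p n`!)).
have ext : logn p n`! = \sum_(1 <= k < n.*2.+1) n %/ p ^ k.
  have n2 : n.+1 <= n.*2.+1 by rewrite ltnS -addnn leq_addr.
  rewrite logn_fact// [RHS](@big_cat_nat _ _ _ n.+1)//=.
  rewrite [X in _ = _ + X]big1_seq ?addn0// => k; rewrite mem_index_iota => /andP[_ /andP[nk _]].
  by rewrite divn_small// (leq_trans nk)// ltnW// ltn_expl// prime_gt1.
have : logn p 'C(n.*2, n) <= trunc_log p n.*2.
  rewrite -(leq_add2r (logn p n`!).*2) cE ext logn_fact//.
  set t := trunc_log p _.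
  have bnd m : \sum_(1 <= k < m.+1) (k <= t) <= t.
    suff -> : \sum_(1 <= k < m.+1) (k <= t) = minn m t by exact: geq_minr.
    elim: m => [|m IH]; first by rewrite big_geq// min0n.
    by rewrite big_nat_recr//= IH; case: leqP; lia.
  apply: leq_trans (_ : \sum_(1 <= k < n.*2.+1) ((k <= t) + (n %/ p ^ k).*2) <= _).
    apply: leq_sum => k _.
    have pk0 : 0 < p ^ k by rewrite expn_gt0 prime_gt0.
    case: (leqP k t) => kt.
      by rewrite -ltnS ltn_divLR// addSn mulSn -addSn mulnC; have := ltn_ceil n pk0; lia.
    rewrite divn_small// ltnNge; apply: contraTN kt => pk.
    by rewrite -leqNgt trunc_log_max// prime_gt1.
  rewrite big_split/= leq_add//.
  under [X in X <= _]eq_bigr do rewrite -addnn.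
  by rewrite big_split/= addnn.
move=> le; apply: leq_trans (leq_pexp2l (prime_gt0 pp) le) _.
by rewrite trunc_logP// prime_gt1.
Qed.

(** Chebyshev's lower bound for the number of primes: a central binomial
    coefficient is at least 2^n, and each prime contributes to it a factor at
    most 2 n. *)
Lemma expn2_primes_le n :
  2 ^ n <= n.*2.+1 ^ size [seq p <- iota 0 n.*2.+1 | prime p].
Proof.
case: (posnP n) => [->//|n0].
apply: leq_trans (central_bin_ge n) _.
have b0 : 0 < 'C(n.*2, n) by rewrite bin_gt0 -addnn leq_addr.
rewrite [X in X <= _]prod_prime_decomp// prime_decompE big_map /=.
apply: (@leq_trans (n.*2.+1 ^ size (primes 'C(n.*2, n)))).
  have : all prime (primes 'C(n.*2, n)) by exact: all_prime_primes.
  elim: (primes _) => [|p s IH]; first by rewrite big_nil.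
  rewrite big_cons /= expnS => /andP[pp sp]; rewrite leq_mul ?IH//.
  exact/leqW/logn_central_bin.
rewrite leq_pexp2l// uniq_leq_size ?primes_uniq// => p.
rewrite mem_primes mem_filter mem_iota/= => /and3P[pp _ pC].
rewrite pp /= prime_gt0//= add1n ltnS.
apply: leq_trans (logn_central_bin pp n0).
have l0 : 0 < logn p 'C(n.*2, n) by rewrite logn_gt0 mem_primes pp b0.
by apply: leq_trans (leq_pexp2l (prime_gt0 pp) l0); rewrite expn1.
Qed.

(** Primes q <= Q with Q < q * window_log Q are comparable to Q up to a
    logarithm; the factor 8 leaves room for those thrown away. *)
Definition window_log Q := 8 * (trunc_log 2 Q).+1.

Definition window_primes Q :=
  [seq q <- iota 0 Q.+1 | prime q && (Q < q * window_log Q)].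

(** The primes below Q / window_log Q are at most half of those that Chebyshev's
    bound supplies, so of the order of Q / log Q primes are left. *)
Lemma size_window_primes Q : 1 < Q ->
  Q <= window_log Q * size (window_primes Q).
Proof.
move=> Q1; pose l := (trunc_log 2 Q).+1; pose pi := [seq p <- iota 0 Q.+1 | prime p].
have Ql : Q < 2 ^ l by exact: trunc_log_ltn.
have h1 : Q./2 <= l * size pi.
  rewrite -(@leq_exp2l 2)// expnM.
  apply: leq_trans (expn2_primes_le Q./2) _.
  have Q2 : (Q./2).*2 <= Q by rewrite -[leqRHS]odd_double_half leq_addl.
  apply: leq_trans (_ : (Q./2).*2.+1 ^ size pi <= _).
    rewrite leq_pexp2l// uniq_leq_size ?filter_uniq ?iota_uniq// => p.
    by rewrite !mem_filter !mem_iota /= ?add0n !ltnS => /andP[-> /leq_trans->].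
  by case: (size pi) => // k; rewrite leq_exp2r// (leq_ltn_trans Q2).
have h2 : size pi <= size (window_primes Q) + Q %/ window_log Q.
  have <- : size (iota 1 (Q %/ window_log Q)) = Q %/ window_log Q by rewrite size_iota.
  rewrite -size_cat uniq_leq_size ?filter_uniq ?iota_uniq// => p.
  rewrite mem_cat !mem_filter !mem_iota/= ?add0n !ltnS => /andP[pp pQ].
  rewrite pp pQ andbT /=; case: ltnP => //= QB.
  by rewrite prime_gt0//= leq_divRL.
have h3 := leq_trunc_div Q (window_log Q).
have h4 := odd_double_half Q.
move: h1 h2 h3 h4; rewrite /window_log -/l.
set s := size pi; set w := size _; set d := _ %/ _.
move=> h1 h2 h3 h4.
have : (Q./2 <= l * w + l * d)%N by rewrite -mulnDr; apply: leq_trans h1 _; rewrite leq_mul2l h2 orbT.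
have : odd Q <= 1 by case: odd.
by move: h3 h4; rewrite -!mulnA (mulnC d) -mulnA; lia.
Qed.

Local Open Scope ring_scope.

Section DivisorBound.
Variable R : realType.
Implicit Types eps : R.

(** Each dyadic block of the harmonic series is at most 1. *)
Lemma harmonic_le q : \sum_(1 <= j < q.+1) (j%:R : R)^-1 <= (trunc_log 2 q).+1%:R.
Proof.
have main k : \sum_(1 <= j < (2 ^ k)%N) (j%:R : R)^-1 <= k%:R.
  elim: k => [|k IH]; first by rewrite big_geq.
  have k2 : (2 ^ k <= 2 ^ k.+1)%N by rewrite leq_exp2l.
  rewrite (@big_cat_nat _ _ _ (2 ^ k)%N)//= ?expn_gt0// -natr1 lerD//.
  apply: le_trans (_ : \sum_(2 ^ k <= j < 2 ^ k.+1) ((2 ^ k)%:R : R)^-1 <= _).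
    rewrite !big_seq; apply: ler_sum => j; rewrite mem_index_iota => /andP[kj _].
    rewrite lef_pV2 ?posrE ?ltr0n ?expn_gt0// ?ler_nat//.
    by apply: leq_trans kj; rewrite expn_gt0.
  rewrite sumr_const_nat expnS mul2n -addnn addnK -[X in X <= _]mulr_natr mulVf//.
apply: le_trans (main _).
have q2 : (q < 2 ^ (trunc_log 2 q).+1)%N by exact: trunc_log_ltn.
by rewrite [leRHS](@big_cat_nat _ _ _ q.+1)//= lerDl sumr_ge0.
Qed.

Lemma succn_le_geometric eps : 0 < eps ->
  exists2 K : R, 1 <= K & forall a : nat, a.+1%:R <= K * (2 `^ eps) ^+ a.
Proof.
move=> e0; pose c := eps * ln 2.
have c0 : 0 < c by rewrite mulr_gt0// ln_gt0// ltr1n.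
exists (Num.max 1 c^-1); first by rewrite le_max lexx.
move=> a; rewrite /powR gt_eqF// -/c -expRM_natl.
have h : 1 + a%:R * c <= expR (a%:R * c) by exact: expR_ge1Dx.
have M0 : 0 <= Num.max 1 c^-1 by rewrite le_max ler01.
apply: le_trans (ler_wpM2l M0 h).
rewrite mulrDr mulr1 -natr1 addrC lerD//; first by rewrite le_max lexx.
rewrite mulrCA -[leLHS]mulr1 ler_wpM2l//.
by rewrite -ler_pdivrMr// mul1r le_max lexx orbT.
Qed.

Lemma trunc_log_le_powR eps : 0 < eps ->
  exists C : R, forall n : nat, (0 < n)%N -> (trunc_log 2 n).+1%:R <= C * n%:R `^ eps.
Proof.
move=> e0; have [K K1 HK] := succn_le_geometric e0.
exists K => n n0; apply: le_trans (HK _) _.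
rewrite ler_wpM2l ?(le_trans ler01)//.
rewrite -powR_mulrn ?powR_ge0// -powRrM mulrC powRrM.
rewrite ge0_ler_powR ?nnegrE ?(ltW e0)//.
by rewrite powR_mulrn// -natrX ler_nat trunc_logP.
Qed.

(** The classical divisor bound.  Split off the smallest prime p of n with its
    exponent a: this multiplies the number of divisors by a + 1.  For p above a
    threshold P depending on eps, a + 1 <= p^(eps a); each of the at most P
    smaller primes costs at most a factor K.  The induction keeps track of a
    lower bound j for the primes of n, so that the constant is K^(P - j). *)
Lemma size_divisors_le_powR eps : 0 < eps ->
  exists C : R, forall n : nat, (0 < n)%N -> (size (divisors n))%:R <= C * n%:R `^ eps.
Proof.
move=> e0; have powRMX (u v w : nat) : (u * v ^ w)%:R `^ eps = u%:R `^ eps * (v%:R `^ eps) ^+ w.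
  by rewrite natrM powRM// natrX -!powR_mulrn ?powR_ge0 ?ler0n -?powRrM ?(mulrC eps).
have [K K1 HK] := succn_le_geometric e0.
have K0 : 0 <= K by exact: le_trans K1.
pose P := (Num.truncn (2 `^ eps^-1)).+1.
have big p : (P <= p)%N -> 2 <= p%:R `^ eps.
  move=> Pp; have : 2 `^ eps^-1 <= p%:R.
    by apply/ltW/(lt_le_trans (truncnS_gt _)); rewrite ler_nat.
  move=> /(ge0_ler_powR (ltW e0)); rewrite !nnegrE powR_ge0 ler0n => /(_ isT isT).
  by rewrite -powRrM mulVf ?gt_eqF// powRr1.
suff main n j : (0 < n)%N -> (forall p, prime p -> (p %| n)%N -> (j <= p)%N) ->
    (size (divisors n))%:R <= K ^+ (P - j) * n%:R `^ eps.
  by exists (K ^+ P) => n n0; have := main n 0%N n0; rewrite subn0; exact.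
have [m] := ubnP n; elim: m n j => // m IH n j nm n0 hj.
have [n1|n1] := leqP n 1.
  have -> : n = 1%N by lia.
  by rewrite powR1 mulr1 exprn_ege1.
pose p := pdiv n; have pp : prime p by exact: pdiv_prime.
have [k cop nE] := pfactor_coprime pp n0.
set a := logn p n in nE.
have a0 : (0 < a)%N by rewrite logn_gt0 mem_primes pp n0 pdiv_dvd.
have k0 : (0 < k)%N by move: n0; rewrite nE muln_gt0 => /andP[].
have pa1 : (1 < p ^ a)%N by rewrite -(exp1n a) ltn_exp2r// prime_gt1.
have jp : (j <= p)%N by apply: hj => //; exact: pdiv_dvd.
have kIH : (size (divisors k))%:R <= K ^+ (P - p.+1) * k%:R `^ eps.
  apply: IH => // [|r rp rk].
    apply: leq_trans (_ : n <= m)%N => //.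
    by rewrite nE -[X in (X < _)%N]muln1 ltn_pmul2l.
  rewrite ltn_neqAle pdiv_min_dvd ?prime_gt1//; last by rewrite nE dvdn_mulr.
  rewrite andbT; apply: contraTneq cop => ->.
  by rewrite prime_coprime// negbK.
rewrite {1}nE; apply: le_trans (_ : (size (divisors k))%:R * a.+1%:R <= _).
  rewrite -natrM ler_nat; apply: leq_trans (size_divisors_mul k0 (ltnW pa1)) _.
  by rewrite leq_mul2l size_divisors_primeX ?orbT.
rewrite {1}nE powRMX.
have p2 : 2 `^ eps <= p%:R `^ eps.
  by rewrite ge0_ler_powR ?nnegrE ?(ltW e0)// ler_nat prime_gt1.
have [Pp|pP] := leqP P p.
  have z : (P - p.+1 = 0)%N by apply/eqP; rewrite subn_eq0 leqW.
  move: kIH; rewrite z expr0 mul1r => kIH.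
  rewrite mulrCA ler_pM// -[leLHS]mul1r ler_pM// ?exprn_ege1//.
  apply: (@le_trans _ _ (2 ^+ a)).
    by rewrite -natrX ler_nat ltn_expl.
  by rewrite lerXn2r ?nnegrE ?powR_ge0//; exact: big.
apply: le_trans (_ : (K * (p%:R `^ eps) ^+ a) * (K ^+ (P - p.+1) * k%:R `^ eps) <= _).
  rewrite mulrC ler_pM//; apply: le_trans (HK a) _.
  by rewrite ler_wpM2l// lerXn2r ?nnegrE ?powR_ge0.
rewrite mulrACA -exprS -[X in _ * X]mulrC.
rewrite ler_wpM2r ?mulr_ge0 ?exprn_ge0 ?powR_ge0// ler_weXn2l//; lia.
Qed.
End DivisorBound.

(** * Finite sums *)

Section FiniteSums.
Variable R : realType.

Lemma eqW (x y : R) : x = y -> x <= y.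
Proof. by move=> ->. Qed.

(** Used to estimate a sum over a list of distinct points of a set by the sum over
    the whole set. *)
Lemma ler_sum_uniq (T : eqType) (s r : seq T) (f : T -> R) :
  uniq s -> {subset s <= r} -> (forall x, 0 <= f x) ->
  \sum_(x <- s) f x <= \sum_(x <- r) f x.
Proof.
move=> us sr f0; elim: s r us sr => [|x s IH] r /=.
  by move=> _ _; rewrite big_nil sumr_ge0.
move=> /andP[xs us] sr; have xr : x \in r by apply: sr; rewrite mem_head.
rewrite big_cons (perm_big _ (perm_to_rem xr)) big_cons lerD2l IH// => y ys.
have := sr y; rewrite in_cons ys orbT => /(_ isT).
rewrite (perm_mem (perm_to_rem xr)) in_cons => /orP[/eqP yx|//].
by rewrite -yx ys in xs.
Qed.

Lemma cauchy_schwarz_sum (T : Type) (r : seq T) (P : pred T) (a b : T -> R) :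
  (\sum_(i <- r | P i) a i * b i) ^+ 2 <=
  (\sum_(i <- r | P i) a i ^+ 2) * (\sum_(i <- r | P i) b i ^+ 2).
Proof.
set A := \sum_(i <- r | P i) a i ^+ 2; set D := \sum_(i <- r | P i) a i * b i.
set B := \sum_(i <- r | P i) b i ^+ 2.
have A0 : 0 <= A by apply: sumr_ge0 => i _; exact: sqr_ge0.
have B0 : 0 <= B by apply: sumr_ge0 => i _; exact: sqr_ge0.
have key x : 0 <= x ^+ 2 * A - 2 * x * D + B.
  have -> : x ^+ 2 * A - 2 * x * D + B = \sum_(i <- r | P i) (x * a i - b i) ^+ 2.
    under eq_bigr do rewrite sqrrB exprMn.
    rewrite big_split/= sumrB -mulr_sumr; congr (_ - _ + _).
    by rewrite /D mulr_sumr; apply: eq_bigr => i _; ring.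
  by apply: sumr_ge0 => i _; exact: sqr_ge0.
have [A1|A1] := eqVneq A 0.
  have D0 : D = 0.
    have := key ((B + 1) / (2 * D)); rewrite A1 mulr0 add0r.
    have [->//|D0] := eqVneq D 0.
    rewrite (_ : - _ + B = -1) ?ler0N1//; field; exact: D0.
  by rewrite D0 A1 mul0r expr0n.
have Ap : 0 < A by rewrite lt_neqAle eq_sym A1.
have := key (D / A); rewrite (_ : _ + B = (A * B - D ^+ 2) / A); last by field.
by rewrite pmulr_lge0 ?invr_gt0// subr_ge0.
Qed.

Lemma sqr_sum_le n (x : nat -> R) :
  (\sum_(0 <= h < n) x h) ^+ 2 <= n%:R * \sum_(0 <= h < n) x h ^+ 2.
Proof.
have := cauchy_schwarz_sum (index_iota 0 n) xpredT (fun=> 1) x.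
under eq_bigr do rewrite mul1r.
move=> /le_trans; apply; rewrite expr1n.
by rewrite sumr_const_nat subn0.
Qed.

End FiniteSums.

(** * The exponential t |-> e(t) = exp(2 pi i t) *)

Section Complex.
Variable R : realType.
Local Notation nc := (@Normc.normc R).
Local Notation cRe := (@complex.Re R).
Implicit Types z w : R[i].

Lemma normc_ge0 z : 0 <= nc z.
Proof. by case: z => a b; exact: sqrtr_ge0. Qed.

Lemma normcJE z : nc z^*%C = nc z.
Proof. by case: z => a b; rewrite /= sqrrN. Qed.

Lemma normc_sqr z : nc z ^+ 2 = cRe (z * z^*%C).
Proof.
case: z => a b /=; rewrite sqr_sqrtr ?addr_ge0 ?sqr_ge0//; ring.
Qed.

Lemma mulcJ z : z * z^*%C = (nc z ^+ 2)%:C%C.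
Proof.
rewrite normc_sqr; case: z => a b; apply/eqP; rewrite eq_complex /= eqxx /=.
by apply/eqP; ring.
Qed.

Lemma Re_le_normc z : cRe z <= nc z.
Proof.
case: z => a b /=; apply: le_trans (ler_norm _) _.
by rewrite -sqrtr_sqr ler_wsqrtr// lerDl sqr_ge0.
Qed.

Lemma normc_sum_le (T : Type) (r : seq T) (P : pred T) (F : T -> R[i]) :
  nc (\sum_(i <- r | P i) F i) <= \sum_(i <- r | P i) nc (F i).
Proof.
elim/big_rec2: _ => [|i y z _ h]; first by rewrite Normc.normc0.
by apply: le_trans (le_normcD _ _) _; rewrite lerD2l.
Qed.

Lemma Re_sum (T : Type) (r : seq T) (P : pred T) (F : T -> R[i]) :
  cRe (\sum_(i <- r | P i) F i) = \sum_(i <- r | P i) cRe (F i).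
Proof. exact: raddf_sum. Qed.

Lemma Re_mul_real (x : R) z : cRe (x%:C%C * z) = x * cRe z.
Proof. by case: z => a b /=; rewrite mul0r subr0. Qed.

Lemma normc_real (x : R) : 0 <= x -> nc x%:C%C = x.
Proof. by move=> x0; rewrite /= expr0n /= addr0 sqrtr_sqr ger0_norm. Qed.

Definition ec (t : R) : R[i] := expi (2 * pi * t).

Lemma ecD s t : ec (s + t) = ec s * ec t.
Proof.
rewrite /ec /expi mulrDr cosD sinD; apply/eqP; rewrite eq_complex /= eqxx /=.
by apply/eqP; ring.
Qed.

Lemma ec0 : ec 0 = 1.
Proof. by rewrite /ec /expi mulr0 cos0 sin0. Qed.

Lemma ec1 : ec 1 = 1.
Proof. by rewrite /ec /expi mulr1 mulr_natl cos2pi sin2pi. Qed.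

Lemma ecN t : ec (- t) = (ec t)^*%C.
Proof. by rewrite /ec /expi mulrN cosN sinN. Qed.

Lemma conjcM z w : (z * w)^*%C = z^*%C * w^*%C.
Proof. exact: rmorphM. Qed.

Lemma conjc_sum (T : Type) (r : seq T) (P : pred T) (F : T -> R[i]) :
  (\sum_(i <- r | P i) F i)^*%C = \sum_(i <- r | P i) (F i)^*%C.
Proof. exact: rmorph_sum. Qed.

Lemma normc_ec t : nc (ec t) = 1.
Proof. by rewrite /= cos2Dsin2 sqrtr1. Qed.

Lemma ecX t n : ec (n%:R * t) = ec t ^+ n.
Proof.
elim: n => [|n IH]; first by rewrite mul0r ec0.
by rewrite -natr1 mulrDl mul1r ecD IH exprSr.
Qed.

Lemma ec_nat n : ec n%:R = 1.
Proof. by rewrite -[n%:R]mulr1 ecX ec1 expr1n. Qed.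

Lemma ec_int (m : int) : ec m%:~R = 1.
Proof.
case: m => n; first by rewrite -pmulrn ec_nat.
by rewrite NegzE mulrNz ecN -pmulrn ec_nat conjc1.
Qed.

Lemma ecDint t (m : int) : ec (t + m%:~R) = ec t.
Proof. by rewrite ecD ec_int mulr1. Qed.

Lemma normc_1ec_sqr t : nc (1 - ec t) ^+ 2 = 2 - 2 * cos (2 * pi * t).
Proof.
rewrite /= sqr_sqrtr ?addr_ge0 ?sqr_ge0//.
have := cos2Dsin2 (2 * pi * t); set c := cos _; set s := sin _ => h.
by rewrite sub0r sqrrN; nra.
Qed.

Lemma cos_le0 (y : R) : pi / 2 <= y <= pi -> cos y <= 0.
Proof.
move=> /andP[h1 h2]; rewrite -(subrK (pi / 2) y) cosDpihalf oppr_le0 sin_ge0_pi//.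
by have := @pi_ge0 R; lra.
Qed.

(** Half of the sharp chord inequality, obtained without the concavity of the
    sine: for t in [1/4, 1/2] the cosine is nonpositive and the chord is at least
    sqrt 2; for smaller t, the factorisation 1 - e(2 t) = (1 - e(t)) (1 + e(t))
    with |1 + e(t)| <= 2 deduces the claim from the claim at 2 t. *)
Lemma normc_1ec_ge_half t : 0 <= t <= 2^-1 -> 2 * t <= nc (1 - ec t).
Proof.
move=> /andP[t0 t2]; have [->|tn0] := eqVneq t 0; first by rewrite mulr0 normc_ge0.
have tp : 0 < t by rewrite lt_neqAle eq_sym tn0.
(* k bounds the number of doublings needed to reach [1/4, 1/2] *)
have [k] : exists k : nat, (2 ^+ k)^-1 / 4 <= t.
  exists (Num.truncn (t^-1)).+1.
  have h : t^-1 < 2 ^+ (Num.truncn t^-1).+1.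
    apply: lt_trans (truncnS_gt _) _.
    by rewrite -natrX ltr_nat ltn_expl.
  rewrite -[leRHS]invrK -invfM lef_pV2 ?posrE ?invr_gt0// ?mulr_gt0 ?exprn_gt0//.
  by apply/ltW/(lt_le_trans h); rewrite ler_peMr// ?exprn_ge0//; lra.
elim: k t t0 t2 tp {tn0} => [|k IH] t t0 t2 tp.
  rewrite expr0 invr1 mul1r => t4.
  rewrite -(@ler_pXn2r _ 2)// ?nnegrE ?mulr_ge0// ?normc_ge0// normc_1ec_sqr.
  have := @pi_gt0 R => p0.
  have : cos (2 * pi * t) <= 0 by apply: cos_le0; nra.
  by nra.
move=> tk; have [t4|t4] := leP t (4^-1); last first.
  apply: (le_trans _ (_ : 2 * t <= _)) => //.
  rewrite -(@ler_pXn2r _ 2)// ?nnegrE ?mulr_ge0// ?normc_ge0// normc_1ec_sqr.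
  have := @pi_gt0 R => p0.
  have : cos (2 * pi * t) <= 0 by apply: cos_le0; nra.
  by nra.
have : 2 * (t * 2) <= nc (1 - ec (t * 2)).
  apply: IH; [lra|lra|lra|].
  rewrite -ler_pdivrMr// (le_trans _ tk)// exprS invfM.
  by rewrite (mulrC 2^-1) -!mulrA ler_wpM2l ?invr_ge0 ?exprn_ge0//; lra.
have -> : 1 - ec (t * 2) = (1 - ec t) * (1 + ec t).
  by rewrite mulr_natr mulr2n ecD -[1]mulr1 -subr_sqr !expr2 !mulr1.
rewrite Normc.normcM.
have h : nc (1 + ec t) <= 2.
  apply: le_trans (le_normcD _ _) _; rewrite Normc.normc1 normc_ec; lra.
have := ler_wpM2l (normc_ge0 (1 - ec t)) h; lra.
Qed.

Lemma normc_1ec_ge t : 0 <= t <= 1 -> 2 * Num.min t (1 - t) <= nc (1 - ec t).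
Proof.
move=> /andP[t0 t1]; have [h|h] := leP t (1 - t).
  by rewrite normc_1ec_ge_half//; lra.
have -> : nc (1 - ec t) = nc (1 - ec (1 - t)).
  have cE : (1 - ec t)^*%C = 1 - ec (1 - t).
    by rewrite ecD ec1 mul1r ecN rmorphB rmorph1.
  by rewrite -cE normcJE.
by rewrite normc_1ec_ge_half//; lra.
Qed.

Lemma ec_eq1 t : 0 < t < 1 -> ec t != 1.
Proof.
move=> /andP[t0 t1]; apply/eqP => h.
have := @normc_1ec_ge t; rewrite h subrr Normc.normc0 (ltW t0) (ltW t1) => /(_ isT).
by rewrite pmulr_rle0// ge_min; case/orP; lra.
Qed.

End Complex.

(** * Differencing of cubic exponential sums *)

Section Weyl.
Variable R : realType.
Local Notation nc := (@Normc.normc R).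
Local Notation ec := (@ec R).

(** A smooth majorant for a geometric sum of at most n terms of ratio e(t): up to
    constants it is min(n, 1 / |1 - e(t)|). *)
Definition geom_bound (n : nat) (t : R) : R := 3 * n%:R / (1 + n%:R * nc (1 - ec t)).

Lemma geom_bound_den_gt0 n t : 0 < 1 + n%:R * nc (1 - ec t).
Proof. by rewrite ltr_wpDr// mulr_ge0// normc_ge0. Qed.

Lemma geom_bound_ge0 n t : 0 <= geom_bound n t.
Proof. by rewrite divr_ge0 ?mulr_ge0// ltW// geom_bound_den_gt0. Qed.

Lemma geom_bound_le n t : geom_bound n t <= 3 * n%:R.
Proof.
rewrite ler_pdivrMr ?geom_bound_den_gt0// ler_peMr ?mulr_ge0//.
by rewrite lerDl mulr_ge0// normc_ge0.
Qed.

Lemma geom_bound_le_inv n t d : 0 < d -> d <= nc (1 - ec t) -> geom_bound n t <= 3 / d.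
Proof.
move=> d0 h; rewrite /geom_bound ler_pdivrMr ?geom_bound_den_gt0// mulrAC ler_pdivlMr//.
have : n%:R * d <= n%:R * nc (1 - ec t) by rewrite ler_wpM2l.
lra.
Qed.

Lemma geom_bound_ge n t (y : R) : y <= n%:R -> y * nc (1 - ec t) <= 2 -> y <= geom_bound n t.
Proof.
move=> yn h; rewrite ler_pdivlMr ?geom_bound_den_gt0// mulrDr mulr1 mulrCA.
have : n%:R * (y * nc (1 - ec t)) <= n%:R * 2 by rewrite ler_wpM2l.
lra.
Qed.

Lemma geom_bound_Dint n t (m : int) : geom_bound n (t + m%:~R) = geom_bound n t.
Proof. by rewrite /geom_bound ecDint. Qed.

Lemma geometric_le n t c m : (m <= n)%N ->
  nc (\sum_(0 <= k < m) ec (k%:R * t + c)) <= geom_bound n t.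
Proof.
move=> mn.
have -> : \sum_(0 <= k < m) ec (k%:R * t + c) = (\sum_(k < m) ec t ^+ k) * ec c.
  by rewrite big_mkord mulr_suml; apply: eq_bigr => k _; rewrite ecD ecX.
rewrite Normc.normcM normc_ec mulr1; apply: geom_bound_ge.
  apply: le_trans (normc_sum_le _ _ _) _.
  under eq_bigr do rewrite -ecX normc_ec.
  by rewrite sumr_const card_ord ler_nat.
rewrite -Normc.normcM mulrC -opprB mulNr -subrX1 opprB -ecX.
apply: le_trans (le_normcD _ _) _.
by rewrite Normc.normc1 normcN normc_ec.
Qed.

(** The diagonal of a square and its off-diagonal parts, grouped by the
    difference h + 1 of the two indices. *)
Lemma sum_square_diff (V : comPzRingType) (n : nat) (F : nat -> nat -> V) :
  \sum_(0 <= k < n) \sum_(0 <= l < n) F k l =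
  \sum_(0 <= k < n) F k k +
  \sum_(0 <= h < n) \sum_(0 <= k < n - h.+1) (F (k + h.+1)%N k + F k (k + h.+1)%N).
Proof.
elim: n => [|n IH]; first by rewrite !big_geq// addr0.
pose G h k := F (k + h.+1)%N k + F k (k + h.+1)%N.
have -> : \sum_(0 <= h < n.+1) \sum_(0 <= k < n.+1 - h.+1) G h k =
    \sum_(0 <= h < n) \sum_(0 <= k < n.+1 - h.+1) G h k.
  by rewrite big_nat_recr//= subnn [X in _ + X = _]big_geq// addr0.
rewrite big_nat_recr//=; under eq_bigr do rewrite big_nat_recr//=.
rewrite big_split/= IH !big_nat_recr//= /G.
have -> : \sum_(0 <= h < n) \sum_(0 <= k < n.+1 - h.+1)
      (F (k + h.+1)%N k + F k (k + h.+1)%N) =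
    \sum_(0 <= h < n) \sum_(0 <= k < n - h.+1)
      (F (k + h.+1)%N k + F k (k + h.+1)%N) +
    \sum_(0 <= l < n) (F n l + F l n).
  rewrite [X in _ = _ + X]big_nat_rev/= add0n -big_split/= !big_seq.
  apply: eq_bigr => h; rewrite mem_index_iota => /andP[_ hn].
  by rewrite subSn// big_nat_recr//= subnK.
rewrite !big_split/=; ring.
Qed.

(** Expanding the square of a sum groups the terms by the difference of the
    indices; this lowers by one the degree of a polynomial phase. *)
Lemma van_der_corput (n : nat) (u : nat -> R[i]) : (forall k, nc (u k) <= 1) ->
  nc (\sum_(0 <= k < n) u k) ^+ 2 <=
  n%:R + 2 * \sum_(0 <= h < n)
    nc (\sum_(0 <= k < n - h.+1) u (k + h.+1)%N * (u k)^*%C).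
Proof.
move=> u1; rewrite normc_sqr.
have -> : (\sum_(0 <= k < n) u k) * (\sum_(0 <= k < n) u k)^*%C =
    \sum_(0 <= k < n) \sum_(0 <= l < n) u k * (u l)^*%C.
  by rewrite rmorph_sum /= big_distrlr.
rewrite sum_square_diff raddfD /= !Re_sum lerD//.
  apply: (@le_trans _ _ (\sum_(0 <= k < n) 1)).
    apply: ler_sum => k _; rewrite -normc_sqr -[leRHS](expr1n _ 2).
    by rewrite lerXn2r ?nnegrE ?normc_ge0.
  by rewrite sumr_const_nat subn0.
rewrite mulr_sumr; apply: ler_sum => h _.
apply: le_trans (Re_le_normc _) _; rewrite big_split/=.
apply: le_trans (le_normcD _ _) _; rewrite mulr_natl mulr2n lerD//.
rewrite -normcJE rmorph_sum /=.
by under eq_bigr do rewrite rmorphM /= conjcK mulrC.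
Qed.

Lemma weyl_quadratic (n m : nat) (al be ga : R) : (m <= n)%N ->
  nc (\sum_(0 <= k < m) ec (al * k%:R ^+ 2 + be * k%:R + ga)) ^+ 2 <=
  n%:R + 2 * \sum_(0 <= h < n) geom_bound n (2 * al * h.+1%:R).
Proof.
move=> mn; apply: le_trans (van_der_corput _ _) _ => [k|].
  by rewrite normc_ec.
rewrite lerD ?ler_nat// ler_wpM2l//.
apply: (@le_trans _ _ (\sum_(0 <= h < m) geom_bound n (2 * al * h.+1%:R))); last first.
  by rewrite [leRHS](@big_cat_nat _ _ _ m)//= lerDl sumr_ge0// => h _; exact: geom_bound_ge0.
apply: ler_sum => h _.
rewrite (eq_bigr (fun k => ec (k%:R * (2 * al * h.+1%:R) +
    (al * h.+1%:R ^+ 2 + be * h.+1%:R)))); last first.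
  by move=> k _; rewrite -ecN -ecD natrD; congr ec; ring.
by apply: geometric_le; rewrite (leq_trans (leq_subr _ _)).
Qed.

(** Two differencing steps, separated by the Cauchy-Schwarz inequality, leave
    geometric sums of ratio e(6 h l t); the coefficients of lower degree only
    enter the starting points of these sums. *)
Lemma weyl_cubic (n : nat) (t b c d : R) :
  nc (\sum_(0 <= k < n) ec (t * k%:R ^+ 3 + b * k%:R ^+ 2 + c * k%:R + d)) ^+ 4 <=
  2 * n%:R ^+ 2 + 8 * n%:R ^+ 3 + 16 * n%:R *
    \sum_(0 <= h < n) \sum_(0 <= l < n) geom_bound n ((6 * h.+1 * l.+1)%:R * t).
Proof.
set S := nc _.
set X := fun h => nc (\sum_(0 <= k < n - h.+1) ec ((3 * t * h.+1%:R) * k%:R ^+ 2 +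
    (3 * h.+1%:R ^+ 2 * t + 2 * h.+1%:R * b) * k%:R +
    (t * h.+1%:R ^+ 3 + b * h.+1%:R ^+ 2 + c * h.+1%:R))).
have h1 : S ^+ 2 <= n%:R + 2 * \sum_(0 <= h < n) X h.
  apply: le_trans (van_der_corput _ _) _ => [k|]; first by rewrite normc_ec.
  rewrite lerD// ler_wpM2l//; apply: ler_sum => h _; apply: eqW; congr nc.
  by apply: eq_bigr => k _; rewrite -ecN -ecD natrD; congr ec; ring.
have h2 h : X h ^+ 2 <= n%:R + 2 * \sum_(0 <= l < n) geom_bound n ((6 * h.+1 * l.+1)%:R * t).
  apply: le_trans (weyl_quadratic _ _ _ (leq_subr _ _)) _.
  rewrite lerD// ler_wpM2l//; apply: ler_sum => l _; apply: eqW; congr geom_bound.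
  by rewrite !natrM; ring.
have h3 := sqr_sum_le n X.
have h4 : \sum_(0 <= h < n) X h ^+ 2 <= n%:R ^+ 2 +
    2 * \sum_(0 <= h < n) \sum_(0 <= l < n) geom_bound n ((6 * h.+1 * l.+1)%:R * t).
  apply: le_trans (ler_sum _ (fun h _ => h2 h)) _.
  by rewrite big_split/= sumr_const_nat subn0 -mulr_sumr -[n%:R *+ n]mulr_natr expr2.
have S0 : 0 <= S by exact: normc_ge0.
have h5 : S ^+ 4 <= (n%:R + 2 * \sum_(0 <= h < n) X h) ^+ 2.
  by rewrite (exprM _ 2 2) lerXn2r ?nnegrE ?exprn_ge0// (le_trans _ h1)// exprn_ge0.
move: h3 h4 h5; set Y := \sum_(0 <= h < n) X h; set Z := \sum_(0 <= h < n) X h ^+ 2.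
set W := \sum_(0 <= h < n) _; move=> h3 h4 h5.
have n0 : 0 <= n%:R :> R by [].
have h6 : n%:R * Z <= n%:R * (n%:R ^+ 2 + 2 * W) by rewrite ler_wpM2l.
have h7 : 0 <= (n%:R - 2 * Y) ^+ 2 by exact: sqr_ge0.
nra.
Qed.

End Weyl.

(** * Weyl's inequality near a fraction a / q *)

Section WeylInequality.
Variable R : realType.
Local Notation nc := (@Normc.normc R).
Local Notation ec := (@ec R).
Local Notation geom_bound := (@geom_bound R).

(** An integer is of the form 6 h l in at most as many ways as it has
    divisors. *)
Lemma sum_products_le_divisors (n H : nat) (om : R) (f : nat -> R) :
  (6 * n * n <= H)%N -> (forall m, 0 <= f m) -> 0 <= om ->
  (forall m, (0 < m <= H)%N -> (size (divisors m))%:R <= om) ->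
  \sum_(0 <= h < n) \sum_(0 <= l < n) f (6 * h.+1 * l.+1)%N <=
  om * \sum_(0 <= m < H.+1) f m.
Proof.
move=> nH f0 om0 dH.
apply: (@le_trans _ _ (\sum_(0 <= h < n) \sum_(1 <= m < H.+1 | (h.+1 %| m)%N) f m)).
  rewrite !big_seq; apply: ler_sum => h; rewrite mem_index_iota => /andP[_ hn].
  have -> : \sum_(0 <= l < n) f (6 * h.+1 * l.+1)%N =
      \sum_(m <- [seq (6 * h.+1 * l.+1)%N | l <- index_iota 0 n]) f m by rewrite big_map.
  rewrite -[leRHS]big_filter.
  apply: ler_sum_uniq => // [|m].
    by rewrite map_inj_uniq ?iota_uniq// => x y /eqP; rewrite eqn_pmul2l// => /eqP[].
  move=> /mapP[l]; rewrite mem_index_iota => /andP[_ ln] ->.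
  rewrite mem_filter mem_index_iota; apply/andP; split; first by rewrite mulnAC dvdn_mull.
  apply/andP; split; first by rewrite !muln_gt0.
  by rewrite ltnS (leq_trans _ nH)// -!mulnA leq_mul// leq_mul.
under eq_bigr do rewrite big_mkcond/=.
rewrite exchange_big/= mulr_sumr [leRHS]big_ltn//.
apply: (@le_trans _ _ (\sum_(1 <= m < H.+1) om * f m)); last first.
  by rewrite lerDr mulr_ge0.
rewrite !big_seq; apply: ler_sum => m; rewrite mem_index_iota ltnS => m0.
rewrite -big_mkcond/= big_const_seq iter_addr_0 -[leLHS]mulr_natl ler_wpM2r//.
apply: le_trans (dH m m0); rewrite ler_nat -size_filter.
have <- : size [seq h.+1 | h <- [seq i <- index_iota 0 n | (i.+1 %| m)%N]] =
    size [seq i <- index_iota 0 n | (i.+1 %| m)%N] by rewrite size_map.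
apply: uniq_leq_size => [|d].
  by rewrite map_inj_uniq ?filter_uniq ?iota_uniq// => x y [].
by move=> /mapP[h]; rewrite mem_filter => /andP[hm _] ->; rewrite -dvdn_divisors//; case/andP: m0.
Qed.

(** Multiplication by a unit permutes the residues modulo q. *)
Lemma sum_residues_le (q a c : nat) (g : nat -> R) : (0 < q)%N -> coprime q a ->
  (forall l, 0 <= g l) ->
  \sum_(0 <= r < q) g ((c + r * a) %% q)%N <= \sum_(0 <= l < q) g l.
Proof.
move=> q0 qa g0.
have -> : \sum_(0 <= r < q) g ((c + r * a) %% q)%N =
    \sum_(l <- [seq ((c + r * a) %% q)%N | r <- index_iota 0 q]) g l by rewrite big_map.
apply: ler_sum_uniq => // [|l]; last first.
  by move=> /mapP[r _ ->]; rewrite mem_index_iota/= ltn_mod.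
have inj x y : (x <= y)%N -> (y < q)%N ->
    ((c + x * a) %% q = (c + y * a) %% q)%N -> x = y.
  move=> xy yq /eqP; rewrite eqn_modDl eq_sym eqn_mod_dvd ?leq_mul2r ?xy ?orbT//.
  rewrite -mulnBl Gauss_dvdl// => qd; apply/eqP; rewrite eqn_leq xy/= -subn_eq0.
  by apply: contraTT qd; rewrite -lt0n => d0; rewrite gtnNdvd// (leq_ltn_trans (leq_subr _ _)).
rewrite map_inj_in_uniq ?iota_uniq// => x y; rewrite !mem_index_iota /= => xq yq h.
have [xy|/ltnW yx] := leqP x y; first exact: inj.
by apply/esym/inj => //; rewrite h.
Qed.

(** Bounds [geom_bound n] at a point lying about l / q away from an integer; l < 2
    is set apart because such a point may be arbitrarily close to the integer. *)
Definition gap_profile (n q l : nat) : R :=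
  3 * n%:R * (l < 2)%:R + 3 / 2 * q%:R * (l.-1)%:R^-1.

Lemma gap_profile_ge0 n q l : 0 <= gap_profile n q l.
Proof. by rewrite addr_ge0// !mulr_ge0. Qed.

Lemma sum_gap_profile n q : \sum_(0 <= l < q) gap_profile n q l <=
  6 * n%:R + 3 / 2 * q%:R * (trunc_log 2 q).+1%:R.
Proof.
have s2 : \sum_(0 <= l < q) (l < 2)%:R <= 2 :> R.
  case: q => [|[|q]]; first by rewrite big_geq.
    by rewrite big_nat1 /= ler1n.
  by rewrite big_ltn// big_ltn//= big_nat_cond big1 ?addr0// => -[|[]].
rewrite big_split/= -!mulr_sumr lerD//.
  by have := ler_wpM2l (ler0n R n) s2; lra.
rewrite ler_wpM2l ?mulr_ge0//.
apply: le_trans (harmonic_le _ q).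
case: q {s2} => [|q]; first by rewrite !big_geq.
rewrite big_nat_recl//= invr0 add0r.
case: q => [|q]; first by rewrite big_geq ?sumr_ge0.
rewrite big_nat_recl//= invr0 add0r.
rewrite big_add1/= !big_nat_recr//= -addrA lerDl addr_ge0//.
Qed.

(** The perturbation x is allowed to vary in an interval of length 3: one unit for
    the rounding of the starting point and one on each side for the drift caused
    by replacing a slope by a fraction. *)
Lemma geom_bound_le_profile n q l (x : R) : (l < q)%N -> -1 <= x <= 2 ->
  geom_bound n ((l%:R + x) / q%:R) <= gap_profile n q l + gap_profile n q (q - l.+1).
Proof.
move=> lq /andP[x1 x2]; have q0 : 0 < q%:R :> R by rewrite ltr0n (leq_ltn_trans _ lq).
have [l2|l2] := ltnP l 2.
  apply: le_trans (geom_bound_le _ _) _; rewrite {1}/gap_profile l2 mulr1 -addrA lerDl.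
  by rewrite addr_ge0 ?gap_profile_ge0// !mulr_ge0.
have [l3|l3] := ltnP (q - l.+1) 2.
  apply: le_trans (geom_bound_le _ _) _; rewrite addrC {1}/gap_profile l3 mulr1 -addrA lerDl.
  by rewrite addr_ge0 ?gap_profile_ge0// !mulr_ge0.
rewrite /gap_profile [(l < 2)%N]ltnNge [(q - l.+1 < 2)%N]ltnNge l2 l3/= !mulr0 !add0r -mulrDr.
set d1 := l.-1%:R; set d2 := (q - l.+1).-1%:R.
have d10 : 0 < d1 :> R by rewrite ltr0n; lia.
have d20 : 0 < d2 :> R by rewrite ltr0n; lia.
have lE : l%:R = d1 + 1 :> R by rewrite natr1; congr (_%:R); lia.
have qE : q%:R = l%:R + d2 + 2 :> R by rewrite -!natrD; congr (_%:R); lia.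
have t0 : d1 / q%:R <= (l%:R + x) / q%:R.
  by rewrite ler_wpM2r ?invr_ge0 ?(ltW q0)// lE; lra.
have t1 : d2 / q%:R <= 1 - (l%:R + x) / q%:R.
  by rewrite -[X in X - _](divff (lt0r_neq0 q0)) -mulrBl ler_wpM2r ?invr_ge0 ?(ltW q0)//; lra.
have d1q : 0 < d1 / q%:R by rewrite divr_gt0.
have d2q : 0 < d2 / q%:R by rewrite divr_gt0.
have := @normc_1ec_ge R ((l%:R + x) / q%:R).
have -> : 0 <= (l%:R + x) / q%:R <= 1 by apply/andP; split; lra.
move=> /(_ isT) H.
have [h|h] := leP ((l%:R + x) / q%:R) (1 - (l%:R + x) / q%:R).
  rewrite min_l// in H.
  apply: le_trans (@geom_bound_le_inv _ n _ (2 * (d1 / q%:R)) _ _) _; [lra|lra|].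
  have -> : 3 / (2 * (d1 / q%:R)) = 3 / 2 * q%:R * d1^-1 by field; rewrite !gt_eqF.
  rewrite mulrDr.
  by rewrite lerDl !mulr_ge0// ?invr_ge0 ltW.
rewrite (min_r (ltW h)) in H.
apply: le_trans (@geom_bound_le_inv _ n _ (2 * (d2 / q%:R)) _ _) _; [lra|lra|].
have -> : 3 / (2 * (d2 / q%:R)) = 3 / 2 * q%:R * d2^-1 by field; rewrite !gt_eqF.
  rewrite mulrDr.
by rewrite lerDr !mulr_ge0// ?invr_ge0 ltW.
Qed.

(** Over q consecutive multiples of a / q + be, with |be| <= 1 / q^2, the points
    run through the residues l / q up to a shift of O(1 / q); summing
    the profile gives n + q log q. *)
Lemma sum_geom_bound_block n q a (be th : R) : (0 < q)%N -> coprime q a ->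
  `|be| <= (q%:R ^+ 2)^-1 -> 0 <= th ->
  \sum_(0 <= r < q) geom_bound n (th + r%:R * (a%:R / q%:R + be)) <=
  12 * n%:R + 3 * q%:R * (trunc_log 2 q).+1%:R.
Proof.
move=> q0 qa beq th0.
have qR : 0 < q%:R :> R by rewrite ltr0n.
(* c / q is the starting point th rounded down to the grid of mesh 1 / q *)
pose c := Num.truncn (q%:R * th).
have /andP[c1 c2] : c%:R <= q%:R * th < c.+1%:R.
  by rewrite truncn_itv// mulr_ge0// ltW.
pose g l := gap_profile n q l + gap_profile n q (q - l.+1).
apply: (@le_trans _ _ (\sum_(0 <= r < q) g ((c + r * a) %% q)%N)).
  rewrite !big_seq; apply: ler_sum => r; rewrite mem_index_iota => /andP[_ rq].
  set l := ((c + r * a) %% q)%N.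
  have lq : (l < q)%N by rewrite ltn_mod.
  set x : R := q%:R * th - c%:R + q%:R * r%:R * be.
  have -> : th + r%:R * (a%:R / q%:R + be) =
      (l%:R + x) / q%:R + (((c + r * a) %/ q)%N%:Z)%:~R.
    have := divn_eq (c + r * a) q; rewrite -/l => /(congr1 (fun m => m%:R : R)).
    rewrite !natrD !natrM -pmulrn => h.
    have -> : l%:R = c%:R + r%:R * a%:R - ((c + r * a) %/ q)%:R * q%:R :> R by rewrite h; ring.
    by rewrite /x; field; rewrite gt_eqF.
  rewrite geom_bound_Dint; apply: geom_bound_le_profile => //.
  have : `|q%:R * r%:R * be| <= 1.
    rewrite !normrM !normr_nat.
    apply: (@le_trans _ _ (q%:R * q%:R * (q%:R ^+ 2)^-1)).
      apply: ler_pM => //.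
      by rewrite ler_wpM2l// ler_nat ltnW.
    by rewrite -expr2 divff// gt_eqF// exprn_gt0.
  rewrite ler_norml => /andP[h1 h2]; rewrite -natr1 in c2.
  by rewrite /x; apply/andP; split; lra.
apply: le_trans (sum_residues_le _ q0 qa _) _ => [l|]; first by rewrite addr_ge0 ?gap_profile_ge0.
rewrite big_split/=.
have -> : \sum_(0 <= l < q) gap_profile n q (q - l.+1) = \sum_(0 <= l < q) gap_profile n q l.
  by rewrite [RHS]big_nat_rev.
have := sum_gap_profile n q; lra.
Qed.

Lemma sum_nat_blocks (V : nmodType) (K q : nat) (f : nat -> V) :
  \sum_(0 <= m < K * q) f m = \sum_(0 <= k < K) \sum_(0 <= r < q) f (k * q + r)%N.
Proof.
elim: K => [|K IH]; first by rewrite !big_geq.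
rewrite big_nat_recr//= -IH (@big_cat_nat _ _ _ (K * q)%N)//=; last by rewrite leq_mul2r leqnSn orbT.
congr (_ + _); rewrite mulSn addnC -{1}[(K * q)%N]add0n big_addn addKn.
by apply: eq_bigr => i _; rewrite addnC.
Qed.

(** After differencing, the products 6 h l are collected with multiplicity at most
    om, and the integers up to 6 n^2 are cut into blocks of length q. *)
Lemma weyl_inequality (n q a : nat) (om be b c d : R) :
  (0 < q)%N -> coprime q a -> `|be| <= (q%:R ^+ 2)^-1 -> 0 <= a%:R / q%:R + be ->
  0 <= om -> (forall m, (0 < m <= 6 * n * n)%N -> (size (divisors m))%:R <= om) ->
  nc (\sum_(0 <= k < n) ec ((a%:R / q%:R + be) * k%:R ^+ 3 +
      b * k%:R ^+ 2 + c * k%:R + d)) ^+ 4 <=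
  2 * n%:R ^+ 2 + 8 * n%:R ^+ 3 + 16 * n%:R * om *
    ((6 * n * n) %/ q).+1%:R * (12 * n%:R + 3 * q%:R * (trunc_log 2 q).+1%:R).
Proof.
move=> q0 qa beq t0 om0 dom; set t := a%:R / q%:R + be.
apply: le_trans (weyl_cubic _ _ _ _ _) _.
set S := \sum_(0 <= h < n) _.
rewrite lerD2l -2!(mulrA (16 * n%:R)) -(mulrA om) ler_wpM2l ?mulr_ge0//.
pose f m := geom_bound n (m%:R * t).
apply: le_trans (@sum_products_le_divisors n _ om f (leqnn _) _ om0 dom) _.
  by move=> m; exact: geom_bound_ge0.
rewrite ler_wpM2l// /f.
set K := ((6 * n * n) %/ q).+1.
apply: (@le_trans _ _ (\sum_(0 <= m < K * q) geom_bound n (m%:R * t))).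
  rewrite [leRHS](@big_cat_nat _ _ _ (6 * n * n).+1)//= ?lerDl ?sumr_ge0//.
    by move=> m _; exact: geom_bound_ge0.
  by rewrite ltn_ceil.
rewrite sum_nat_blocks.
apply: (@le_trans _ _ (\sum_(0 <= k < K) (12 * n%:R + 3 * q%:R * (trunc_log 2 q).+1%:R))).
  apply: ler_sum => k _; under eq_bigr do rewrite natrD mulrDl.
  by apply: sum_geom_bound_block => //; rewrite mulr_ge0.
by rewrite sumr_const_nat subn0 -[leLHS]mulr_natl.
Qed.

End WeylInequality.

(** * Orthogonality on a grid *)

Section Orthogonality.
Variable R : realType.
Local Notation nc := (@Normc.normc R).
Local Notation cRe := (@complex.Re R).
Local Notation ec := (@ec R).

(** A geometric sum whose ratio is an M-th root of unity. *)
Lemma sum_ec_grid (M : nat) (m : int) : (0 < M)%N ->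
  \sum_(i < M) ec (m%:~R * (i%:R / M%:R)) = if (M%:Z %| m)%Z then M%:R else 0.
Proof.
move=> M0; have M0R : M%:R != 0 :> R by rewrite pnatr_eq0 -lt0n.
have -> : \sum_(i < M) ec (m%:~R * (i%:R / M%:R)) = \sum_(i < M) ec (m%:~R / M%:R) ^+ i.
  by apply: eq_bigr => i _; rewrite -ecX; congr ec; ring.
case: ifPn => [/dvdzP[k ->]|ndv].
  rewrite intrM -pmulrn mulfK// ec_int.
  by under eq_bigr do rewrite expr1n; rewrite sumr_const card_ord.
have zM : ec (m%:~R / M%:R) ^+ M = 1.
  by rewrite -ecX mulrC divfK// ec_int.
have := subrX1 (ec (m%:~R / M%:R)) M; rewrite zM subrr => /esym/eqP.
rewrite mulf_eq0 => /orP[|/eqP//]; rewrite subr_eq0 => /eqP h.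
exfalso; move: h; apply/eqP.
have -> : m%:~R / M%:R = ((m %% M)%Z)%:~R / M%:R + ((m %/ M)%Z)%:~R :> R.
  rewrite [in LHS](divz_eq m M) intrD intrM -pmulrn; field; exact: M0R.
rewrite ecDint; apply: ec_eq1.
have m0 : ((m %% M)%Z)%:~R != 0 :> R by rewrite intr_eq0; apply: contra ndv => /eqP/dvdz_mod0P.
have M0' : 0 < M%:R :> R by rewrite ltr0n.
have mg : 0 <= ((m %% M)%Z)%:~R :> R by rewrite ler0z modz_ge0// eqz_nat -lt0n.
have mp : 0 < ((m %% M)%Z)%:~R :> R by rewrite lt_neqAle eq_sym m0.
by rewrite divr_gt0//= ltr_pdivrMr// mul1r pmulrn ltr_int ltz_pmod.
Qed.

Definition freq (N k : nat) : int := k%:Z - N%:Z.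

(** The 2 N + 1 frequencies are distinct modulo M, so that Parseval's identity for
    all M frequencies gives the bound. *)
Lemma bessel_grid (N M : nat) (psi : 'I_M -> R[i]) : ((2 * N).+1 <= M)%N ->
  \sum_(k < (2 * N).+1)
     nc (\sum_(i < M) psi i * ec (- ((freq N k)%:~R * (i%:R / M%:R)))) ^+ 2 <=
  M%:R * \sum_(i < M) nc (psi i) ^+ 2.
Proof.
move=> NM; have M0 : (0 < M)%N by exact: leq_trans NM.
set F := fun k : nat => nc (\sum_(i < M) psi i * ec (- ((freq N k)%:~R * (i%:R / M%:R)))) ^+ 2.
apply: (@le_trans _ _ (\sum_(k < M) F k)).
  rewrite -!(big_mkord xpredT F) [leRHS](@big_cat_nat _ _ _ (2 * N).+1)//=.
  by rewrite lerDl sumr_ge0// => k _; rewrite sqr_ge0.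
have -> : \sum_(k < M) F k = cRe (\sum_(k < M) \sum_(i < M) \sum_(i' < M)
    (psi i * (psi i')^*%C) * ec (- ((freq N k)%:~R * (i%:R / M%:R)) + (freq N k)%:~R * (i'%:R / M%:R))).
  rewrite Re_sum; apply: eq_bigr => k _; rewrite /F normc_sqr rmorph_sum /=.
  rewrite big_distrlr /=; congr cRe; apply: eq_bigr => i _; apply: eq_bigr => i' _.
  by rewrite conjcM -ecN opprK mulrACA -ecD.
rewrite exchange_big /=; under eq_bigr do rewrite exchange_big /=.
rewrite Re_sum mulr_sumr; apply: ler_sum => i _.
rewrite (bigD1 i)//= [X in _ + X]big1 ?addr0; last first.
  move=> i' ii'; rewrite -mulr_sumr.
  rewrite (eq_bigr (fun k : 'I_M => ec ((i'%:Z - i%:Z)%:~R * (k%:R / M%:R)) *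
     ec (- N%:R * ((i'%:Z - i%:Z)%:~R / M%:R)))); last first.
    move=> k _; rewrite -ecD; congr ec; rewrite /freq !intrB -!pmulrn; ring.
  rewrite -mulr_suml sum_ec_grid// ifF ?mul0r ?mulr0//.
  apply/negP => /dvdzP[c hc]; move/negP: ii'; apply; apply/eqP/val_inj => /=.
  have := ltn_ord i; have := ltn_ord i'.
  move: hc; move: (nat_of_ord i) (nat_of_ord i') => x y; clear; move=> hc xM yM.
  have [c0|c0] := eqVneq c 0; first by rewrite c0 mul0r in hc; lia.
  exfalso; have : `|c * M%:Z| >= M%:Z.
    by rewrite normrM ler_peMl// -gtz0_ge1 normr_gt0.
  by rewrite -hc; lia.
rewrite -mulr_sumr; under eq_bigr do rewrite addNr ec0.
by rewrite sumr_const card_ord mulcJ Re_mul_real raddfMn /= mulrC.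
Qed.

End Orthogonality.

(** * Correlations of a function on a cyclic group *)

Section Autocorrelation.
Variable R : realType.
Local Notation nc := (@Normc.normc R).
Local Notation cRe := (@complex.Re R).
Variable T' : nat.
Local Notation T := T'.+1.
Local Notation iota_T := (@inZp T').

Lemma inZpD x y : iota_T (x + y)%N = iota_T x + iota_T y.
Proof. by apply/val_inj; rewrite /= modnDm. Qed.

Lemma normc_sum_sqr_le (h : 'I_T -> R[i]) :
  nc (\sum_j h j) ^+ 2 <= T%:R * \sum_j nc (h j) ^+ 2.
Proof.
apply: (@le_trans _ _ ((\sum_j nc (h j)) ^+ 2)).
  by rewrite lerXn2r ?nnegrE ?normc_ge0 ?sumr_ge0 ?normc_sum_le// => j _; exact: normc_ge0.
have := cauchy_schwarz_sum (index_enum 'I_T) xpredT (fun=> 1) (fun j => nc (h j)).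
under eq_bigr do rewrite mul1r.
by move=> /le_trans; apply; rewrite expr1n sumr_const card_ord.
Qed.

(** Let H be the sum of h over a window of length L and G the sum of the q
    translates of H by the multiples of D.  The right-hand side is the scalar
    product of G and H; as G has period D, this is 1 / q times the squared norm
    of G, which is bounded below by the Cauchy-Schwarz inequality because the sum
    of G is q L times the sum of h.  This positivity, valid for
    every h, stands in for an analysis of the major arcs. *)
Lemma autocorrelation_ge (q D L : nat) (h : 'I_T -> R[i]) : (0 < q)%N -> (q * D = T)%N ->
  q%:R * L%:R ^+ 2 / T%:R * nc (\sum_j h j) ^+ 2 <=
  cRe (\sum_(a < q) \sum_(u < L) \sum_(u' < L)
        \sum_j h (j + iota_T (a * D + u)) * (h (j + iota_T u'))^*%C).
Proof.
move=> q0 qD.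
pose H j := \sum_(u < L) h (j + iota_T u).
pose G j := \sum_(a < q) H (j + iota_T (a * D)).
have -> : \sum_(a < q) \sum_(u < L) \sum_(u' < L)
    \sum_j h (j + iota_T (a * D + u)) * (h (j + iota_T u'))^*%C =
    \sum_j G j * (H j)^*%C.
  under [RHS]eq_bigr do rewrite mulr_suml.
  rewrite [RHS]exchange_big; apply: eq_bigr => a _ /=.
  under eq_bigr do rewrite exchange_big /=.
  rewrite exchange_big /=; apply: eq_bigr => j _.
  rewrite /H rmorph_sum /= big_distrlr /=; apply: eq_bigr => u _; apply: eq_bigr => u' _.
  by rewrite inZpD addrA.
have Gper j : G (j + iota_T D) = G j.
  rewrite /G; case: q q0 qD {G} => // q _ qD.
  rewrite big_ord_recr [RHS]big_ord_recl /= mul0n addrC; congr (_ + _).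
    by rewrite -addrA -inZpD -mulSn qD; congr H; congr (_ + _); apply/val_inj; rewrite /= modnn mod0n.
  by apply: eq_bigr => a _; rewrite -addrA -inZpD.
have Gper' a j : G (j + iota_T (a * D)) = G j.
  elim: a => [|a IH].
    by rewrite mul0n; congr G; rewrite -[RHS]addr0; congr (_ + _); apply/val_inj; rewrite /= mod0n.
  by rewrite mulSn addnC inZpD addrA Gper.
have GG : \sum_j G j * (G j)^*%C = q%:R * \sum_j G j * (H j)^*%C.
  under eq_bigr do rewrite {2}/G rmorph_sum mulr_sumr /=.
  rewrite exchange_big /=.
  rewrite (eq_bigr (fun=> \sum_j G j * (H j)^*%C)); last first.
    move=> a _; rewrite (reindex_inj (addIr (- iota_T (a * D)))) /=.
    by apply: eq_bigr => j _; rewrite -(Gper' a (j - _)) subrK.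
  by rewrite sumr_const card_ord mulr_natl.
have sumG : \sum_j G j = (q * L)%:R * \sum_j h j.
  rewrite /G exchange_big /= (eq_bigr (fun=> L%:R * \sum_j h j)).
    by rewrite sumr_const card_ord natrM -mulrA [RHS]mulr_natl.
  move=> a _; rewrite /H exchange_big /= (eq_bigr (fun=> \sum_j h j)).
    by rewrite sumr_const card_ord mulr_natl.
  move=> u _; rewrite [RHS](reindex_inj (addIr (iota_T (a * D) + iota_T u))) /=.
  by apply: eq_bigr => j _; rewrite addrA.
have key : T%:R * (q%:R * cRe (\sum_j G j * (H j)^*%C)) >= q%:R ^+ 2 * L%:R ^+ 2 * nc (\sum_j h j) ^+ 2.
  have := normc_sum_sqr_le G; rewrite sumG Normc.normcM exprMn.
  have -> : nc (q * L)%:R = q%:R * L%:R.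
    by rewrite -(rmorph_nat (real_complex R)) normc_real// natrM.
  rewrite exprMn => /le_trans; apply; rewrite ler_wpM2l//.
  under eq_bigr do rewrite normc_sqr.
  by rewrite -Re_sum GG -(rmorph_nat (real_complex R)) Re_mul_real.
have qR : 0 < q%:R :> R by rewrite ltr0n.
have TR : 0 < T%:R :> R by rewrite ltr0n.
rewrite -(ler_pM2l TR) -(ler_pM2l qR); move: key.
set A := nc _ ^+ 2; set B := cRe _ => keyAB.
have -> : q%:R * (T%:R * (q%:R * L%:R ^+ 2 / T%:R * A)) = q%:R ^+ 2 * L%:R ^+ 2 * A.
  by field; rewrite gt_eqF.
by rewrite [leRHS]mulrCA.
Qed.

End Autocorrelation.

(** * The mixed inequality: positivity and disjoint arcs *)

Section MixedInequality.
Variable R : realType.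
Local Notation nc := (@Normc.normc R).
Local Notation cRe := (@complex.Re R).
Local Notation ec := (@ec R).

(** Unnormalised: a factor T M separates it from a Fourier coefficient. *)
Definition grid_coef (N T M : nat) (phi : 'I_T -> 'I_M -> R[i]) (k : nat) : R[i] :=
  \sum_(j < T) \sum_(i < M) phi j i *
    ec (- ((freq N k)%:~R * (i%:R / M%:R) + (freq N k ^+ 3)%:~R * (j%:R / T%:R))).

Definition grid_energy N T M (phi : 'I_T -> 'I_M -> R[i]) : R :=
  \sum_(k < (2 * N).+1) nc (grid_coef N phi k) ^+ 2.

Variable T' : nat.
Local Notation T := T'.+1.
Local Notation iota_T := (@inZp T').

(** The arcs of length L to the right of the points a T / q are disjoint: two
    different fractions with denominators at most Q are at least 1 / Q^2 apart,
    which is 4 L in units of 1 / T. *)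
Lemma sum_arcs_le (Q L : nat) (P : seq nat) (G : 'I_T -> R) (s0 : 'I_T) :
  (0 < L)%N -> (4 * Q ^ 2 * L = T)%N -> uniq P ->
  (forall q, q \in P -> [/\ prime q, (q <= Q)%N & (q %| T)%N]) ->
  (forall s, 0 <= G s) ->
  \sum_(q <- P) \sum_(1 <= a < q) \sum_(0 <= u < L)
     G (iota_T (a * (T %/ q) + u) - s0) <= \sum_s G s.
Proof.
move=> L0 QL uP hP G0.
pose Lam := [seq (q, a) | q <- P, a <- index_iota 1 q].
pose pt (p : nat * nat) u := iota_T (p.2 * (T %/ p.1) + u) - s0.
have -> : \sum_(q <- P) \sum_(1 <= a < q) \sum_(0 <= u < L)
     G (iota_T (a * (T %/ q) + u) - s0) =
   \sum_(s <- [seq pt p u | p <- Lam, u <- index_iota 0 L]) G s.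
  rewrite big_allpairs_dep /= big_allpairs_dep /=.
  by apply: eq_bigr => q _; apply: eq_bigr => a _; apply: eq_bigr.
apply: ler_sum_uniq => //; last by move=> s _; rewrite mem_index_enum.
have Lamin p : p \in Lam -> [/\ prime p.1, (p.1 <= Q)%N, (p.1 * (T %/ p.1) = T)%N & (0 < p.2 < p.1)%N].
  move=> /allpairsPdep[q [a [qP]]]; rewrite mem_index_iota => aq ->/=.
  by have [pq qQ /divnK] := hP _ qP; rewrite mulnC.
apply: allpairs_uniq; rewrite ?iota_uniq//.
  apply: allpairs_uniq_dep => // [q qP|]; first exact: iota_uniq.
  by move=> [q a] [q' a'] _ _ /= [-> ->].
move=> [p u] [p' u'] /allpairsPdep[p1 [u1 [pL uL [-> ->]]]].
move=> /allpairsPdep[p2 [u2 [pL' uL' [-> ->]]]] /= h.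
move: uL uL'; rewrite !mem_index_iota/= => uL uL'.
have [pr1 q1Q D1 /andP[a1 a1']] := Lamin _ pL.
have [pr2 q2Q D2 /andP[a2 a2']] := Lamin _ pL'.
move: h => /addIr /(congr1 val) /=.
have lt1 (q D a v : nat) : prime q -> (q <= Q)%N -> (q * D = T)%N -> (a < q)%N -> (v < L)%N -> (a * D + v < T)%N.
  move=> pq qQ qD aq vL.
  have LD : (L <= D)%N.
    rewrite -(leq_pmul2l (prime_gt0 pq)) qD -QL leq_mul2r (leq_trans qQ) ?orbT//.
    by rewrite expnS expn1 -[leqLHS]mul1n mulnA leq_mul// muln_gt0/= (leq_trans (prime_gt0 pq)).
  apply: (@leq_trans (a.+1 * D)); first by rewrite mulSn addnC ltn_add2r (leq_trans vL).
  by rewrite -qD leq_mul2r aq orbT.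
rewrite (modn_small (lt1 _ _ _ _ pr1 q1Q D1 a1' uL)) (modn_small (lt1 _ _ _ _ pr2 q2Q D2 a2' uL')).
case: p1 p2 {pL pL'} pr1 q1Q D1 a1 a1' pr2 q2Q D2 a2 a2' => [q a] [q' a'] /=.
move: (T %/ q)%N (T %/ q')%N => D D' pr1 q1Q D1 a1 a1' pr2 q2Q D2 a2 a2' h.
have Qp : (0 < Q)%N by rewrite (leq_trans (prime_gt0 pr1)).
(* both remainders are less than T, so the quotients a q' and a' q agree *)
have key : (a * q' * T + u1 * (q * q') = a' * q * T + u2 * (q * q'))%N.
  rewrite -{1}D1 -D2.
  have := congr1 (fun x => (x * (q * q'))%N) h; rewrite /= !mulnDl => h'.
  suff -> : (a * q' * (q * D) = a * D * (q * q'))%N.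
    by rewrite h'; congr (_ + _)%N; ring.
  by ring.
have small v : (v < L)%N -> (v * (q * q') < T)%N.
  move=> vL; rewrite -QL mulnC; apply: leq_ltn_trans (_ : Q ^ 2 * v < _)%N.
    by rewrite leq_mul2r expnS expn1 leq_mul ?orbT.
  have Q2 : (0 < Q ^ 2)%N by rewrite expn_gt0 Qp.
  apply: leq_trans (_ : Q ^ 2 * L <= _)%N; first by rewrite ltn_pmul2l.
  by rewrite leq_mul2r leq_pmull ?orbT.
have aq : (a * q' = a' * q)%N.
  have s1 := small _ uL; have s2 := small _ uL'.
  have T0 : (0 < T)%N by [].
  move: key s1 s2 T0; move: (u1 * _)%N (u2 * _)%N (a * q')%N (a' * q)%N T => x y b b' t key s1 s2 T0.
  have := congr1 (fun z => z %/ t)%N key; rewrite !divnMDl//.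
  by rewrite (divn_small s1) (divn_small s2) !addn0.
have qq : q = q'.
  have : (q %| a * q')%N by rewrite aq dvdn_mull.
  rewrite Euclid_dvdM// gtnNdvd//= dvdn_prime2// => /eqP//.
move: aq key; rewrite -{}qq => /eqP; rewrite eqn_pmul2r ?prime_gt0// => /eqP->.
move=> /addnI/eqP; rewrite eqn_pmul2r; last by rewrite muln_gt0 !prime_gt0.
by move=> /eqP->.
Qed.

(** For fixed q, apply [autocorrelation_ge] to the functions of j that sum to the
    Fourier coefficients, and sum over the frequencies.  In the terms with a = 0
    the sum over i is estimated by Bessel's inequality; in the others the sum
    over frequencies is done first and produces the kernel.  The autocorrelation
    of the marginal of |phi|, whose total mass is the square of the L^1 norm, is
    then summed over the arcs, which are disjoint as q and a vary. *)
Lemma grid_mixed_inequality (N M Q L : nat) (P : seq nat) (M0 : R)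
    (phi : 'I_T -> 'I_M -> R[i]) :
  ((2 * N).+1 <= M)%N -> (0 < L)%N -> (4 * Q ^ 2 * L = T)%N -> uniq P -> 0 <= M0 ->
  (forall q, q \in P -> [/\ prime q, (q <= Q)%N & (q %| T)%N]) ->
  (forall (q a u u' : nat) (x : R), q \in P -> (0 < a < q)%N -> (u < L)%N -> (u' < L)%N ->
     nc (\sum_(k < (2 * N).+1) ec ((freq N k)%:~R * x +
       (freq N k ^+ 3)%:~R * (((a * (T %/ q) + u)%:R - u'%:R) / T%:R))) <= M0) ->
  (\sum_(q <- P) q%:R) * L%:R ^+ 2 / T%:R * grid_energy N phi <=
  (size P)%:R * L%:R ^+ 2 * M%:R * (\sum_j \sum_i nc (phi j i) ^+ 2) +
  M0 * L%:R * (\sum_j \sum_i nc (phi j i)) ^+ 2.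
Proof.
move=> NM L0 QL uP M00 hP hK.
set Phi2 := \sum_j \sum_i nc (phi j i) ^+ 2.
pose sp k j := \sum_(i < M) phi j i * ec (- ((freq N k)%:~R * (i%:R / M%:R))).
(* the Fourier coefficient of phi at frequency k is the sum over j of h k j *)
pose wt k (x : R) := ec (- ((freq N k ^+ 3)%:~R * (x / T%:R))).
pose h k (j : 'I_T) := wt k j%:R * sp k j.
pose g j := \sum_(i < M) nc (phi j i).
(* autocorrelation of the marginal g of |phi| *)
pose Gc s := \sum_j g (j + s) * g j.
have g0 j : 0 <= g j by apply: sumr_ge0 => i _; exact: normc_ge0.
have Gc0 s : 0 <= Gc s by apply: sumr_ge0 => j _; rewrite mulr_ge0.
have hE k : \sum_j h k j = grid_coef N phi k.
  apply: eq_bigr => j _; rewrite /h mulr_sumr; apply: eq_bigr => i _.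
  by rewrite mulrCA -ecD; congr (_ * ec _); ring.
have nh k j : nc (h k j) = nc (sp k j) by rewrite Normc.normcM normc_ec mul1r.
have wtD k (j : 'I_T) x : wt k (j + iota_T x)%R%:R = wt k (j%:R + x%:R).
  have -> : (j + iota_T x)%R%:R = j%:R + x%:R - ((j + x) %/ T)%:R * T%:R :> R.
    have := divn_eq (j + x) T => /(congr1 (fun m => m%:R : R)); rewrite natrD natrD natrM => ->.
    by rewrite /= modnDmr [X in _ = X - _]addrC addrK.
  rewrite /wt (_ : - _ = - ((freq N k ^+ 3)%:~R * ((j%:R + x%:R) / T%:R)) +
     (freq N k ^+ 3 * ((j + x) %/ T)%:Z)%:~R) ?ecDint//.
  by rewrite intrM -pmulrn; field; rewrite ?natr1 ?nat1r pnatr_eq0.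
pose W D a u u' := \sum_(k < (2 * N).+1) \sum_j
   h k (j + iota_T (a * D + u)) * (h k (j + iota_T u'))^*%C.
(* the diagonal shifts: Bessel's inequality in the variable i *)
have W0 D u u' : cRe (W D 0%N u u') <= M%:R * Phi2.
  have s2 s : \sum_(k < (2 * N).+1) \sum_j nc (h k (j + s)) ^+ 2 <= M%:R * Phi2.
    rewrite exchange_big /=; under eq_bigr do under eq_bigr do rewrite nh.
    rewrite (reindex_inj (addIr (- s))) mulr_sumr /=; apply: ler_sum => j _.
    by rewrite subrK; exact: bessel_grid.
  have := s2 (iota_T (0 * D + u)); have := s2 (iota_T u').
  set A := \sum_(k < _) _; set B := \sum_(k < _) _ => hA hB.
  suff : 2 * cRe (W D 0%N u u') <= A + B by lra.
  rewrite /W Re_sum mulr_sumr -big_split/=; apply: ler_sum => k _.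
  rewrite Re_sum mulr_sumr -big_split/=; apply: ler_sum => j _.
  apply: (@le_trans _ _ (2 * (nc (h k (j + iota_T (0 * D + u))) * nc (h k (j + iota_T u'))))).
    rewrite ler_wpM2l// -[X in _ <= _ * X]normcJE -Normc.normcM; exact: Re_le_normc.
  by set x := nc _; set y := nc _; have := sqr_ge0 (x - y); nra.
(* the shifts near a / q: the kernel is uniformly small *)
have Wa q a u u' : q \in P -> (0 < a < q)%N -> (u < L)%N -> (u' < L)%N ->
    cRe (W (T %/ q)%N a u u') <= M0 * Gc (iota_T (a * (T %/ q) + u) - iota_T u').
  move=> qP aq uL uL'; set s := (a * (T %/ q) + u)%N.
  apply: le_trans (Re_le_normc _) _.
  have -> : Gc (iota_T s - iota_T u') = \sum_j g (j + iota_T s) * g (j + iota_T u').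
    rewrite /Gc [RHS](reindex_inj (addIr (- iota_T u'))) /=; apply: eq_bigr => j _.
    by rewrite subrK addrAC addrA.
  rewrite /W exchange_big /= mulr_sumr.
  apply: le_trans (normc_sum_le _ _ _) _; apply: ler_sum => j _.
  have -> : \sum_(k < (2 * N).+1) h k (j + iota_T s) * (h k (j + iota_T u'))^*%C =
     \sum_(i < M) \sum_(i' < M) (phi (j + iota_T s) i * (phi (j + iota_T u') i')^*%C) *
       (\sum_(k < (2 * N).+1) ec (- ((freq N k)%:~R * ((i%:R - i'%:R) / M%:R) +
       (freq N k ^+ 3)%:~R * ((s%:R - u'%:R) / T%:R)))).
    under [RHS]eq_bigr do under eq_bigr do rewrite mulr_sumr.
    under [RHS]eq_bigr do rewrite exchange_big /=.
    rewrite [RHS]exchange_big /=; apply: eq_bigr => k _.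
    rewrite /h conjcM mulrACA !wtD /wt -ecN -ecD /sp rmorph_sum /= big_distrlr mulr_sumr /=.
    apply: eq_bigr => i _; rewrite mulr_sumr; apply: eq_bigr => i' _.
    rewrite !conjcM -!ecN [X in _ * X = _]mulrACA [LHS]mulrCA -!ecD; congr (_ * ec _).
    ring.
  rewrite /g big_distrlr mulr_sumr /=.
  apply: le_trans (normc_sum_le _ _ _) _; apply: ler_sum => i _; rewrite mulr_sumr.
  apply: le_trans (normc_sum_le _ _ _) _; apply: ler_sum => i' _.
  rewrite !Normc.normcM normcJE mulrC ler_wpM2r ?mulr_ge0 ?normc_ge0//.
  rewrite -normcJE conjc_sum; under eq_bigr do rewrite -ecN opprK.
  exact: hK.
have Gcs : \sum_s Gc s = (\sum_j \sum_i nc (phi j i)) ^+ 2.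
  rewrite /Gc exchange_big /= expr2 mulr_suml; apply: eq_bigr => j _.
  rewrite -mulr_suml mulrC; congr (_ * _).
  rewrite [RHS](reindex_inj (addrI j)) //=.
have qbnd q : q \in P -> q%:R * L%:R ^+ 2 / T%:R * grid_energy N phi <=
    L%:R ^+ 2 * M%:R * Phi2 + M0 * \sum_(0 <= u' < L) \sum_(1 <= a < q) \sum_(0 <= u < L)
      Gc (iota_T (a * (T %/ q) + u) - iota_T u').
  move=> qP; have [pq qQ qT] := hP _ qP.
  have qD : (q * (T %/ q) = T)%N by rewrite mulnC divnK.
  apply: (@le_trans _ _ (cRe (\sum_(a < q) \sum_(u < L) \sum_(u' < L) W (T %/ q)%N a u u'))).
    rewrite /grid_energy mulr_sumr.
    apply: (@le_trans _ _ (\sum_(k < (2 * N).+1) cRe (\sum_(a < q) \sum_(u < L)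
        \sum_(u' < L) \sum_j
        h k (j + iota_T (a * (T %/ q) + u)) * (h k (j + iota_T u'))^*%C))).
      apply: ler_sum => k _; rewrite -hE.
      exact: (autocorrelation_ge L (h k) (prime_gt0 pq) qD).
    rewrite -Re_sum exchange_big /=; apply: eqW; congr cRe.
    apply: eq_bigr => a _; rewrite exchange_big; apply: eq_bigr => u _ /=.
    by rewrite exchange_big; apply: eq_bigr.
  rewrite -(big_mkord xpredT (fun a => \sum_(u < L) \sum_(u' < L) W (T %/ q)%N a u u')).
  rewrite big_ltn ?prime_gt0// raddfD /= lerD//.
    rewrite Re_sum; apply: (@le_trans _ _ (\sum_(u < L) \sum_(u' < L) M%:R * Phi2)).
      by apply: ler_sum => u _; rewrite Re_sum; apply: ler_sum => u' _; exact: W0.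
    rewrite !sumr_const !card_ord -[X in X *+ L]mulr_natl -[leLHS]mulr_natl.
    by rewrite !mulrA -expr2.
  rewrite Re_sum mulr_sumr big_seq.
  under [leRHS]eq_bigr do rewrite mulr_sumr.
  rewrite [leRHS]exchange_big [leRHS]big_seq /=; apply: ler_sum => a.
  rewrite mem_index_iota => aq; rewrite Re_sum.
  under [leRHS]eq_bigr do rewrite mulr_sumr.
  rewrite [leRHS]exchange_big big_mkord; apply: ler_sum => u _.
  by rewrite Re_sum big_mkord; apply: ler_sum => u' _; exact: Wa.
rewrite !mulr_suml; apply: le_trans.
  rewrite big_seq; apply: ler_sum => q qP; exact: qbnd.
rewrite -big_seq big_split/= lerD//.
  by rewrite big_const_seq count_predT iter_addr_0 -[leLHS]mulr_natl !mulrA.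
rewrite -mulr_sumr -mulrA ler_wpM2l// exchange_big/=.
apply: (@le_trans _ _ (\sum_(0 <= u' < L) \sum_s Gc s)).
  by apply: ler_sum => u' _; exact: (sum_arcs_le _ L0 QL uP hP Gc0).
by rewrite sumr_const_nat subn0 Gcs mulr_natl.
Qed.

End MixedInequality.

(** * The sixth moment *)

Section SixthMoment.
Variable R : realType.
Local Notation nc := (@Normc.normc R).
Local Notation cRe := (@complex.Re R).
Local Notation ec := (@ec R).

Lemma sum_triples_split (I : finType) (G : I * I * I -> R) :
  \sum_v G v = \sum_x \sum_y \sum_z G (x, y, z).
Proof. by rewrite pair_big pair_big /=; apply: eq_bigr => -[[a b] c]. Qed.

Lemma sum_triples (S : comPzSemiRingType) (I : finType) (f g h : I -> S) :
  \sum_(v : I * I * I) f v.1.1 * g v.1.2 * h v.2 =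
  (\sum_i f i) * (\sum_i g i) * (\sum_i h i).
Proof.
rewrite [in RHS]big_distrlr /= pair_big /= big_distrlr /= pair_big /=.
by apply: eq_bigr => -[[a b] c].
Qed.

(** Schur's test in the form b b' <= (b^2 + b'^2) / 2. *)
Lemma schur_sum_le (I : finType) (r : rel I) (b : I -> R) : symmetric r ->
  \sum_v \sum_(w | r v w) b v * b w <= \sum_v b v ^+ 2 * #|[pred w | r v w]|%:R.
Proof.
move=> sr; set X := leLHS; set Y := leRHS.
have e1 : \sum_v \sum_(w | r v w) b v ^+ 2 = Y.
  by apply: eq_bigr => v _; rewrite sumr_const mulr_natr.
have e2 : \sum_v \sum_(w | r v w) b w ^+ 2 = Y.
  rewrite -e1; under eq_bigr do rewrite big_mkcond /=.
  rewrite exchange_big /=; apply: eq_bigr => v _; rewrite [RHS]big_mkcond /=.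
  by apply: eq_bigr => w _; rewrite sr.
suff : 2 * X <= Y + Y by lra.
rewrite -{1}e1 -e2 -big_split /X mulr_sumr /=; apply: ler_sum => v _.
rewrite -big_split mulr_sumr /=; apply: ler_sum => w _.
by have := sqr_ge0 (b v - b w); nra.
Qed.

Variable N : nat.
Local Notation K := (2 * N).+1.
Local Notation fr := (freq N).
Implicit Type v : 'I_K * 'I_K * 'I_K.

Definition sum1 v : int := fr v.1.1 + fr v.1.2 + fr v.2.
Definition sum3 v : int := fr v.1.1 ^+ 3 + fr v.1.2 ^+ 3 + fr v.2 ^+ 3.
(** By [sum1_cube], some entry of the triple equals the sum of all three, that is,
    the two others are opposite. *)
Definition degenerate v := sum3 v == sum1 v ^+ 3.
Definition same_sums v w := (sum1 v == sum1 w) && (sum3 v == sum3 w).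

Lemma sum1_cube v : sum1 v ^+ 3 - sum3 v =
  3 * ((sum1 v - fr v.1.1) * (sum1 v - fr v.1.2) * (sum1 v - fr v.2)).
Proof. by rewrite /sum1 /sum3; ring. Qed.

Lemma freq_inj : injective (fun k : 'I_K => fr k).
Proof. by move=> x y; rewrite /freq => /addIr [] /val_inj. Qed.

Lemma freq_rev (k : 'I_K) : fr (rev_ord k) = - fr k.
Proof. by rewrite /freq /=; have := ltn_ord k; lia. Qed.

(** A difference A - n that divides D is determined by its sign and by a divisor of
    |D|. *)
Lemma card_divisor_freq (A D : int) : D != 0 ->
  (#|[pred k : 'I_K | ((A - fr k) %| D)%Z]| <= 2 * size (divisors `|D|))%N.
Proof.
move=> D0; pose S := [seq (A - fr k < 0, `|A - fr k|%N) | k : 'I_K <- enum [pred k : 'I_K | ((A - fr k) %| D)%Z]].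
have -> : #|[pred k : 'I_K | ((A - fr k) %| D)%Z]| = size S by rewrite size_map cardE.
have -> : (2 * size (divisors `|D|) = size [seq (b, d) | b <- [:: true; false], d <- divisors `|D|])%N.
  by rewrite size_allpairs.
apply: uniq_leq_size.
  rewrite map_inj_uniq ?enum_uniq// => x y [h1 h2]; apply: freq_inj.
  by move: h1 h2; case: ltP; case: ltP; lia.
move=> [b d] /mapP[k]; rewrite mem_enum inE => kD [-> ->].
apply/allpairsP; eexists (_, _); split => /=; last by [].
  by case: (_ < _).
by rewrite -dvdn_divisors ?absz_gt0.
Qed.

(** A triple w with the same sums as v satisfies (s - a)(s - b)(s - c) = D, where D is
    the nonzero integer attached to v: two of its entries are
    determined up to the divisors of D, and the third by the sum. *)
Lemma card_same_sums v : ~~ degenerate v -> exists2 m : nat, (0 < m <= 8 * N ^ 3)%N &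
  (#|[pred w | same_sums v w]| <= (2 * size (divisors m)) ^ 2)%N.
Proof.
move=> nd; pose D := (sum1 v - fr v.1.1) * (sum1 v - fr v.1.2) * (sum1 v - fr v.2).
have DE : 3 * D = sum1 v ^+ 3 - sum3 v by rewrite sum1_cube.
have D0 : D != 0.
  by apply: contra nd => /eqP D0; rewrite /degenerate eq_sym -subr_eq0 -DE D0 mulr0.
have frb (k : 'I_K) : `|fr k| <= N%:Z by rewrite /freq; have := ltn_ord k; lia.
exists `|D|%N.
  rewrite absz_gt0 D0 /=.
  have b1 : (`|sum1 v - fr v.1.1| <= 2 * N)%N.
    by rewrite /sum1; have := frb v.1.2; have := frb v.2; lia.
  have b2 : (`|sum1 v - fr v.1.2| <= 2 * N)%N.
    by rewrite /sum1; have := frb v.1.1; have := frb v.2; lia.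
  have b3 : (`|(sum1 v - fr v.2)%R| <= 2 * N)%N.
    by rewrite /sum1; have := frb v.1.1; have := frb v.1.2; lia.
  rewrite /D !abszM (_ : 8 * N ^ 3 = (2 * N) * (2 * N) * (2 * N))%N; last by ring.
  by rewrite !leq_mul.
pose S := [pred k : 'I_K | ((sum1 v - fr k) %| D)%Z].
apply: (@leq_trans (#|S| ^ 2)); last by rewrite leq_exp2r// card_divisor_freq.
have -> : (#|S| ^ 2 = #|[predX S & S]|)%N by rewrite cardX expnS expn1.
have inj : {in [pred w | same_sums v w] &, injective (fun w : 'I_K * 'I_K * 'I_K => (w.1.2, w.2))}.
  move=> [[x1 x2] x3] [[y1 y2] y3]; rewrite !inE /same_sums => /andP[/eqP h1 _] /andP[/eqP h2 _] /= [e2 e3].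
  congr (_, _, _) => //; apply: freq_inj; move: h1 h2; rewrite /sum1 /= e2 e3; lia.
rewrite -(card_in_imset inj); apply: subset_leq_card; apply/fintype.subsetP => _ /imsetP[w + ->].
rewrite !inE => /andP[/eqP h1 /eqP h3] /=.
have Dw : D = (sum1 v - fr w.1.1) * (sum1 v - fr w.1.2) * (sum1 v - fr w.2).
  have : 3 * D = 3 * ((sum1 v - fr w.1.1) * (sum1 v - fr w.1.2) * (sum1 v - fr w.2)).
    by rewrite DE h1 h3 -sum1_cube.
  by move=> /mulfI; apply.
by apply/andP; split; rewrite Dw; [rewrite mulrAC dvdz_mull|rewrite dvdz_mull].
Qed.

(** In a degenerate triple of sum n one entry is n and the other two are opposite;
    the three cases for the position of n give the factor 3. *)
Lemma degenerate_sum_le (b : 'I_K -> R) (k : 'I_K) : (forall i, 0 <= b i) ->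
  \sum_(v | degenerate v && (sum1 v == fr k)) b v.1.1 * b v.1.2 * b v.2 <=
  3 * b k * \sum_i b i ^+ 2.
Proof.
move=> b0; set Z := \sum_i b i ^+ 2.
have Zr : \sum_i b i * b (rev_ord i) <= Z.
  have h2 : \sum_i b (rev_ord i) ^+ 2 = Z by rewrite [RHS](reindex_inj rev_ord_inj).
  suff : 2 * \sum_i b i * b (rev_ord i) <= Z + Z by lra.
  rewrite -{2}h2 /Z -big_split mulr_sumr /=; apply: ler_sum => i _.
  by have := sqr_ge0 (b i - b (rev_ord i)); nra.
pose d (x y : 'I_K) : R := (x == y)%:R.
apply: (@le_trans _ _ (\sum_v (d v.1.1 k * d v.1.2 (rev_ord v.2) + d v.1.2 k * d v.1.1 (rev_ord v.2) +
   d v.2 k * d v.1.1 (rev_ord v.1.2)) * (b v.1.1 * b v.1.2 * b v.2))).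
  rewrite big_mkcond /=; apply: ler_sum => v _.
  have bb : 0 <= b v.1.1 * b v.1.2 * b v.2 by rewrite !mulr_ge0.
  have dd x y : 0 <= d x y by rewrite /d.
  case: ifPn => [/andP[dv /eqP sk]|_]; last by rewrite mulr_ge0// !addr_ge0 ?mulr_ge0.
  rewrite -[leLHS]mul1r ler_wpM2r//.
  have : (sum1 v - fr v.1.1) * (sum1 v - fr v.1.2) * (sum1 v - fr v.2) = 0.
    by have := sum1_cube v; rewrite (eqP dv) subrr; lia.
  move/eqP; rewrite !mulf_eq0 !subr_eq0 -orbA => /or3P[]/eqP h.
  - have -> : d v.1.1 k = 1 by rewrite /d (_ : v.1.1 = k) ?eqxx//; apply: freq_inj; rewrite -h.
    have -> : d v.1.2 (rev_ord v.2) = 1.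
      rewrite /d (_ : v.1.2 = rev_ord v.2) ?eqxx//; apply: freq_inj; rewrite freq_rev.
      by move: h; rewrite /sum1; lia.
    by rewrite mulr1 -addrA lerDl addr_ge0 ?mulr_ge0.
  - have -> : d v.1.2 k = 1 by rewrite /d (_ : v.1.2 = k) ?eqxx//; apply: freq_inj; rewrite -h.
    have -> : d v.1.1 (rev_ord v.2) = 1.
      rewrite /d (_ : v.1.1 = rev_ord v.2) ?eqxx//; apply: freq_inj; rewrite freq_rev.
      by move: h; rewrite /sum1; lia.
    by rewrite mulr1 addrAC lerDr addr_ge0 ?mulr_ge0.
  - have -> : d v.2 k = 1 by rewrite /d (_ : v.2 = k) ?eqxx//; apply: freq_inj; rewrite -h.
    have -> : d v.1.1 (rev_ord v.1.2) = 1.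
      rewrite /d (_ : v.1.1 = rev_ord v.1.2) ?eqxx//; apply: freq_inj; rewrite freq_rev.
      by move: h; rewrite /sum1; lia.
    by rewrite mulr1 lerDr addr_ge0 ?mulr_ge0.
have dk (g : 'I_K -> R) x : \sum_y d y x * g y = g x.
  rewrite (bigD1 x)//= /d eqxx mul1r big1 ?addr0// => y /negPf->; exact: mul0r.
have ZbZ : 0 <= \sum_i b i * b (rev_ord i) by rewrite sumr_ge0// => i _; rewrite mulr_ge0.
have bZ : b k * (\sum_i b i * b (rev_ord i)) <= b k * Z by rewrite ler_wpM2l.
under eq_bigr do rewrite !mulrDl.
rewrite !big_split /= !sum_triples_split /=.
have -> : \sum_x \sum_y \sum_z d x k * d y (rev_ord z) * (b x * b y * b z) =
    b k * (\sum_i b i * b (rev_ord i)).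
  rewrite (eq_bigr (fun x => d x k * (b x * \sum_z b z * b (rev_ord z)))) ?dk// => x _.
  rewrite exchange_big !mulr_sumr /=; apply: eq_bigr => z _.
  rewrite (eq_bigr (fun y => d y (rev_ord z) * (d x k * (b x * (b z * b y))))) ?dk//.
  by move=> y _; ring.
have -> : \sum_x \sum_y \sum_z d y k * d x (rev_ord z) * (b x * b y * b z) =
    b k * (\sum_i b i * b (rev_ord i)).
  rewrite exchange_big.
  rewrite (eq_bigr (fun y => d y k * (b y * \sum_z b z * b (rev_ord z)))) ?dk// => y _.
  rewrite exchange_big !mulr_sumr /=; apply: eq_bigr => z _.
  rewrite (eq_bigr (fun x => d x (rev_ord z) * (d y k * (b y * (b z * b x))))) ?dk//.
  by move=> x _; ring.
have -> : \sum_x \sum_y \sum_z d z k * d x (rev_ord y) * (b x * b y * b z) =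
    b k * (\sum_i b i * b (rev_ord i)).
  rewrite exchange_big mulr_sumr /=; apply: eq_bigr => y _.
  rewrite (eq_bigr (fun x => d x (rev_ord y) * (b k * (b y * b x)))) ?dk// => x _.
  rewrite (eq_bigr (fun z => d z k * (d x (rev_ord y) * (b z * (b y * b x))))) ?dk//.
  by move=> z _; ring.
lra.
Qed.

(** Pairs of triples with the same sums are both degenerate or both not.  For the
    latter each triple is related to few others and Schur's test applies;
    degenerate triples are grouped by their sum, which is one of the
    frequencies. *)
Lemma sum_same_sums_le (b : 'I_K -> R) (om : R) : (forall i, 0 <= b i) -> 0 <= om ->
  (forall m, (0 < m <= 8 * N ^ 3)%N -> (size (divisors m))%:R <= om) ->
  \sum_v \sum_(w | same_sums v w)
    (b v.1.1 * b v.1.2 * b v.2) * (b w.1.1 * b w.1.2 * b w.2) <=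
  (4 * om ^+ 2 + 9) * (\sum_i b i ^+ 2) ^+ 3.
Proof.
move=> b0 om0 dom; set Z := \sum_i b i ^+ 2.
have Z0 : 0 <= Z by apply: sumr_ge0 => i _; rewrite sqr_ge0.
pose be v := b v.1.1 * b v.1.2 * b v.2.
have be0 v : 0 <= be v by rewrite !mulr_ge0.
have bZ : \sum_v be v ^+ 2 = Z ^+ 3.
  rewrite (_ : Z ^+ 3 = Z * Z * Z); last by ring.
  by rewrite /Z -sum_triples; apply: eq_bigr => v _; rewrite /be !exprMn.
have ssd v w : same_sums v w -> degenerate v = degenerate w.
  by rewrite /same_sums /degenerate => /andP[/eqP-> /eqP->].
have ssC : symmetric same_sums by move=> v w; rewrite /same_sums (eq_sym (sum1 v)) (eq_sym (sum3 v)).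
rewrite (bigID degenerate) /= addrC mulrDl lerD//.
  pose r v w := ~~ degenerate v && same_sums v w.
  have rC : symmetric r.
    move=> v w; rewrite /r ssC; apply: andb_id2r => h; by rewrite (ssd _ _ h).
  apply: (@le_trans _ _ (\sum_v \sum_(w | r v w) be v * be w)).
    rewrite big_mkcond /=; apply: ler_sum => v _; rewrite /r; case: ifPn => dv //=.
    by rewrite sumr_ge0// => w _; rewrite mulr_ge0.
  apply: le_trans (schur_sum_le be rC) _.
  rewrite -bZ mulr_sumr; apply: ler_sum => v _; rewrite mulrC ler_wpM2r ?sqr_ge0//.
  rewrite /r; case: (boolP (degenerate v)) => dv /=.
    rewrite eq_card0; last by [].
    by rewrite mulr_ge0// sqr_ge0.
  have [m mb cm] := card_same_sums dv.
  apply: (@le_trans _ _ ((2 * size (divisors m)) ^ 2)%N%:R); first by rewrite ler_nat.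
  rewrite natrX natrM exprMn -natrX ler_wpM2l// lerXn2r ?nnegrE ?dom//.
pose c (k : 'I_K) := \sum_(v | degenerate v && (sum1 v == fr k)) be v.
have c0 k : 0 <= c k by apply: sumr_ge0 => v _.
apply: (@le_trans _ _ (\sum_k c k ^+ 2)).
  rewrite (eq_bigr (fun k : 'I_K => \sum_v \sum_w
     ((degenerate v && (sum1 v == fr k)) && (degenerate w && (sum1 w == fr k)))%:R * (be v * be w))); last first.
    move=> k _; rewrite expr2 /c big_distrlr /= big_mkcond /=; apply: eq_bigr => v _.
    case: ifPn => hv /=; last by rewrite big1// => w _; rewrite mul0r.
    by rewrite big_mkcond /=; apply: eq_bigr => w _; case: ifPn; rewrite ?mul1r ?mul0r.
  rewrite exchange_big big_mkcond /=; apply: ler_sum => v _.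
  case: ifPn => dv; last by apply: sumr_ge0 => k _; apply: sumr_ge0 => w _; rewrite !mulr_ge0.
  rewrite exchange_big big_mkcond /=; apply: ler_sum => w _.
  case: ifPn => [vw|_]; last by rewrite sumr_ge0// => k _; rewrite !mulr_ge0.
  have [k kE] : exists k : 'I_K, sum1 v = fr k.
    have : (sum1 v - fr v.1.1) * (sum1 v - fr v.1.2) * (sum1 v - fr v.2) = 0.
      by have := sum1_cube v; rewrite (eqP dv) subrr; lia.
    by move/eqP; rewrite !mulf_eq0 !subr_eq0 -orbA => /or3P[]/eqP ->; eexists.
  rewrite (bigD1 k)//= -(ssd _ _ vw) dv kE eqxx /=.
  have /andP[/eqP <- _] := vw; rewrite kE eqxx mul1r lerDl sumr_ge0// => k' _; by rewrite !mulr_ge0.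
apply: (@le_trans _ _ (\sum_k (3 * b k * Z) ^+ 2)).
  apply: ler_sum => k _; rewrite lerXn2r ?nnegrE//; first by rewrite !mulr_ge0.
  exact: degenerate_sum_le.
apply: eqW.
rewrite (_ : Z ^+ 3 = Z * Z ^+ 2); last by ring.
rewrite mulrA {2}/Z mulr_sumr mulr_suml; apply: eq_bigr => k _; ring.
Qed.

(** Expand the cube of F: its frequencies are the pairs of sums of triples.  M and T
    are so large that frequencies congruent modulo M and T are equal, and
    orthogonality turns the sixth moment into the sum over pairs of triples with
    the same sums. *)
Lemma grid_sixth_moment (T M : nat) (c : 'I_K -> R[i]) (om : R) :
  (6 * N < M)%N -> (6 * N ^ 3 < T)%N -> 0 <= om ->
  (forall m, (0 < m <= 8 * N ^ 3)%N -> (size (divisors m))%:R <= om) ->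
  \sum_(j < T) \sum_(i < M) nc (\sum_k c k *
     ec ((fr k)%:~R * (i%:R / M%:R) + (fr k ^+ 3)%:~R * (j%:R / T%:R))) ^+ 6 <=
  T%:R * M%:R * ((4 * om ^+ 2 + 9) * (\sum_k nc (c k) ^+ 2) ^+ 3).
Proof.
move=> NM NT om0 dom.
have frb (k : 'I_K) : `|fr k| <= N%:Z by rewrite /freq; have := ltn_ord k; lia.
pose F (j : 'I_T) (i : 'I_M) := \sum_k c k * ec ((fr k)%:~R * (i%:R / M%:R) + (fr k ^+ 3)%:~R * (j%:R / T%:R)).
pose B v := c v.1.1 * c v.1.2 * c v.2.
pose th v (j : 'I_T) (i : 'I_M) := (sum1 v)%:~R * (i%:R / M%:R) + (sum3 v)%:~R * (j%:R / T%:R) : R.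
have F3 j i : F j i ^+ 3 = \sum_v B v * ec (th v j i).
  rewrite (_ : F j i ^+ 3 = F j i * F j i * F j i); last by ring.
  rewrite /F -sum_triples; apply: eq_bigr => v _.
  rewrite [X in X * _]mulrACA [LHS]mulrACA -!ecD; congr (_ * ec _); rewrite /th /sum1 /sum3 !intrD; ring.
have orth v w : \sum_(j < T) \sum_(i < M) ec (th v j i) * ec (- th w j i) =
    if same_sums v w then (T%:R * M%:R) else 0.
  have -> : \sum_(j < T) \sum_(i < M) ec (th v j i) * ec (- th w j i) =
     (\sum_(j < T) ec ((sum3 v - sum3 w)%:~R * (j%:R / T%:R))) *
     (\sum_(i < M) ec ((sum1 v - sum1 w)%:~R * (i%:R / M%:R))).
    rewrite big_distrlr /=; apply: eq_bigr => j _; apply: eq_bigr => i _.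
    by rewrite -!ecD; congr ec; rewrite /th !intrB; ring.
  rewrite !sum_ec_grid; [|lia|lia].
  have s1 v' : `|sum1 v'| <= 3 * N%:Z.
    rewrite /sum1; have := frb v'.1.1; have := frb v'.1.2; have := frb v'.2; lia.
  have s3 v' : `|sum3 v'| <= 3 * (N ^ 3)%:Z.
    have f3 (k : 'I_K) : `|fr k ^+ 3| <= (N ^ 3)%:Z.
      have -> : (N ^ 3)%:Z = N%:Z ^+ 3 by rewrite -!natz natrX.
      by rewrite normrX lerXn2r ?nnegrE.
    rewrite /sum3; have := f3 v'.1.1; have := f3 v'.1.2; have := f3 v'.2; lia.
  have dv0 (m x : int) : `|x| < m -> (m %| x)%Z = (x == 0).
    move=> xm; apply/idP/eqP => [/dvdzP[q qE]|->]; last exact: dvdz0.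
    have [q0|q0] := eqVneq q 0; first by rewrite qE q0 mul0r.
    exfalso; have m0 : 0 <= m by lia.
    by move: xm; rewrite qE normrM ltNge (ger0_norm m0) ler_peMl//; lia.
  rewrite !dv0; last 2 first.
  - by have := s1 v; have := s1 w; lia.
  - by have := s3 v; have := s3 w; lia.
  rewrite !subr_eq0 /same_sums; case: ifP; case: ifP => //= _ _; rewrite ?mul0r ?mulr0//.
have -> : \sum_(j < T) \sum_(i < M) nc (F j i) ^+ 6 =
    cRe (\sum_v \sum_(w | same_sums v w) (B v * (B w)^*%C) * (T%:R * M%:R)).
  rewrite (eq_bigr (fun j => cRe (\sum_i F j i ^+ 3 * (F j i ^+ 3)^*%C))); last first.
    move=> j _; rewrite Re_sum; apply: eq_bigr => i _.
    by rewrite -normc_sqr (exprM _ 3 2) !exprS !Normc.normcM !expr0 Normc.normc1.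
  rewrite -Re_sum; congr cRe.
  transitivity (\sum_(j < T) \sum_(i < M) \sum_v \sum_w (B v * (B w)^*%C) * (ec (th v j i) * ec (- th w j i))).
    apply: eq_bigr => j _; apply: eq_bigr => i _; rewrite F3 conjc_sum big_distrlr /=.
    apply: eq_bigr => v _; apply: eq_bigr => w _.
    by rewrite conjcM -ecN mulrACA.
  under eq_bigr do rewrite exchange_big /=.
  rewrite exchange_big; apply: eq_bigr => v _ /=.
  under eq_bigr do rewrite exchange_big /=.
  rewrite exchange_big [RHS]big_mkcond; apply: eq_bigr => w _ /=.
  under eq_bigr do rewrite -mulr_sumr.
  by rewrite -mulr_sumr orth; case: ifP; rewrite ?mulr0.
apply: le_trans (Re_le_normc _) _; apply: le_trans (normc_sum_le _ _ _) _.
apply: (@le_trans _ _ (T%:R * M%:R * \sum_v \sum_(w | same_sums v w)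
    (nc (c v.1.1) * nc (c v.1.2) * nc (c v.2)) * (nc (c w.1.1) * nc (c w.1.2) * nc (c w.2)))).
  rewrite mulr_sumr; apply: ler_sum => v _; apply: le_trans (normc_sum_le _ _ _) _.
  rewrite mulr_sumr; apply: ler_sum => w _.
  have nn m : nc m%:R = m%:R.
    by rewrite -(rmorph_nat (real_complex R)) normc_real.
  by rewrite !Normc.normcM normcJE !Normc.normcM !nn mulrC.
rewrite ler_wpM2l ?mulr_ge0//; apply: sum_same_sums_le => // i; exact: normc_ge0.
Qed.

End SixthMoment.

(** * The energy bound dual to the sixth moment *)

Section Duality.
Variable R : realType.
Local Notation nc := (@Normc.normc R).
Local Notation ec := (@ec R).

(** The energy is the scalar product of phi with the function whose Fourier
    coefficients are those of phi at the frequencies (n, n^3). *)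
Lemma grid_energy_duality (N T M : nat) (phi : 'I_T -> 'I_M -> R[i]) :
  grid_energy N phi <= \sum_(j < T) \sum_(i < M) nc (phi j i) *
    nc (\sum_(k < (2 * N).+1) grid_coef N phi k *
      ec ((freq N k)%:~R * (i%:R / M%:R) + (freq N k ^+ 3)%:~R * (j%:R / T%:R))).
Proof.
rewrite /grid_energy; under eq_bigr do rewrite normc_sqr.
rewrite -Re_sum.
have -> : \sum_(k < (2 * N).+1) grid_coef N phi k * (grid_coef N phi k)^*%C =
   \sum_(j < T) \sum_(i < M) phi j i * (\sum_(k < (2 * N).+1) grid_coef N phi k *
      ec ((freq N k)%:~R * (i%:R / M%:R) + (freq N k ^+ 3)%:~R * (j%:R / T%:R)))^*%C.
  under [RHS]eq_bigr do under eq_bigr do rewrite conjc_sum mulr_sumr.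
  under [RHS]eq_bigr do rewrite exchange_big.
  rewrite [RHS]exchange_big; apply: eq_bigr => k _.
  rewrite {1}/grid_coef mulr_suml; apply: eq_bigr => j _.
  rewrite mulr_suml; apply: eq_bigr => i _.
  by rewrite conjcM -ecN -!mulrA; congr (_ * _); rewrite mulrC.
apply: le_trans (Re_le_normc _) _; apply: le_trans (normc_sum_le _ _ _) _.
apply: ler_sum => j _; apply: le_trans (normc_sum_le _ _ _) _.
by apply: ler_sum => i _; rewrite Normc.normcM normcJE.
Qed.

(** The L^6 estimate for the function F dual to phi, combined with |phi| <= 1_e.
    Instead of Hoelder's inequality, F <= mu + F^6 / mu^5 is summed over the
    support, with mu adapted to the energy. *)
Lemma grid_energy_pow3_le (N T M : nat) (phi : 'I_T -> 'I_M -> R[i]) (e : 'I_T -> 'I_M -> bool) (om : R) :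
  (6 * N < M)%N -> (6 * N ^ 3 < T)%N -> 0 <= om ->
  (forall m, (0 < m <= 8 * N ^ 3)%N -> (size (divisors m))%:R <= om) ->
  (forall j i, nc (phi j i) <= (e j i)%:R) ->
  (grid_energy N phi / (T%:R * M%:R) ^+ 2) ^+ 3 <=
  64 * (4 * om ^+ 2 + 9) * ((\sum_j \sum_i (e j i)%:R) / (T%:R * M%:R)) ^+ 5.
Proof.
move=> NM NT om0 dom he; set S := grid_energy N phi; set A := \sum_j _.
set F := fun (j : 'I_T) (i : 'I_M) => nc (\sum_(k < (2 * N).+1) grid_coef N phi k *
      ec ((freq N k)%:~R * (i%:R / M%:R) + (freq N k ^+ 3)%:~R * (j%:R / T%:R))).
have h6 : \sum_j \sum_i F j i ^+ 6 <= T%:R * M%:R * ((4 * om ^+ 2 + 9) * S ^+ 3).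
  exact: grid_sixth_moment.
have hS : S <= \sum_j \sum_i nc (phi j i) * F j i by exact: grid_energy_duality.
have F0 j i : 0 <= F j i by exact: normc_ge0.
have S0 : 0 <= S by apply: sumr_ge0 => k _; rewrite sqr_ge0.
have A0 : 0 <= A by apply: sumr_ge0 => j _; apply: sumr_ge0.
have m0 : 0 < T%:R * M%:R :> R by rewrite mulr_gt0// ltr0n; lia.
set m := T%:R * M%:R in m0 h6 *; set C := 4 * om ^+ 2 + 9 in h6 *.
have C0 : 0 <= C by rewrite addr_ge0// mulr_ge0// sqr_ge0.
have key mu : 0 < mu -> S <= mu * A + m * (C * S ^+ 3) / mu ^+ 5.
  move=> mu0; apply: le_trans hS _.
  apply: (@le_trans _ _ (\sum_j \sum_i (mu * (e j i)%:R + F j i ^+ 6 / mu ^+ 5))).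
    apply: ler_sum => j _; apply: ler_sum => i _.
    have y x : 0 <= x -> x <= mu + x ^+ 6 / mu ^+ 5.
      move=> x0; have [xm|xm] := leP x mu.
        by rewrite (le_trans xm)// lerDl divr_ge0 ?exprn_ge0// ltW.
      rewrite -[leLHS]add0r lerD ?(ltW mu0)// ler_pdivlMr ?exprn_gt0//.
      have mx := ltW xm; have mu1 := ltW mu0.
      by rewrite [leRHS]exprS ler_wpM2l// lerXn2r// nnegrE.
    have := he j i; case: (e j i) => h.
      by rewrite mulr1 (le_trans _ (y _ (F0 j i)))// -[leRHS]mul1r ler_wpM2r.
    rewrite mulr0 add0r (le_trans _ (_ : 0 <= _))//.
      have -> : nc (phi j i) = 0 by apply/eqP; rewrite eq_le h normc_ge0.
      by rewrite mul0r.
    by rewrite divr_ge0 ?exprn_ge0// ltW.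
  under eq_bigr do rewrite big_split/= -mulr_sumr -mulr_suml.
  rewrite big_split/= -mulr_sumr -mulr_suml lerD//.
  by rewrite ler_wpM2r// invr_ge0 exprn_ge0// ltW.
have [S1|S1] := eqVneq S 0.
  rewrite S1 mul0r expr0n; apply: mulr_ge0; first by rewrite mulr_ge0.
  by rewrite exprn_ge0// divr_ge0// ltW.
have Sp : 0 < S by rewrite lt_neqAle eq_sym S1.
(* if the support were empty, a large mu would make the energy less than any eps *)
have Ap : 0 < A.
  rewrite lt_neqAle A0 andbT eq_sym; apply: contraTneq Sp => A1; rewrite -leNgt.
  apply/ler_addgt0Pr => eps eps0.
  have := key ((m * (C * S ^+ 3) / eps + 1) ); rewrite A1 mulr0 add0r.
  set X := m * (C * S ^+ 3).
  have X0 : 0 <= X by rewrite mulr_ge0 ?(ltW m0)// mulr_ge0// ?exprn_ge0.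
  have Y1 : 1 <= X / eps + 1 by rewrite lerDr divr_ge0// ltW.
  have Y0 : 0 < X / eps + 1 by exact: lt_le_trans Y1.
  move=> /(_ Y0) /le_trans; apply; rewrite add0r ler_pdivrMr ?exprn_gt0//.
  apply: (@le_trans _ _ (eps * (X / eps + 1))).
    by rewrite mulrDr mulrCA divff ?gt_eqF// !mulr1 lerDl ltW.
  by rewrite ler_wpM2l ?(ltW eps0)// exprS ler_peMr ?(ltW Y0)// exprn_ege1.
(* with this mu the term mu A is half of the energy S *)
have := key (S / (2 * A)); rewrite divr_gt0 ?mulr_gt0// => /(_ isT).
have -> : S / (2 * A) * A = S / 2 by field; rewrite gt_eqF.
have -> : m * (C * S ^+ 3) / (S / (2 * A)) ^+ 5 = 32 * m * C * A ^+ 5 / S ^+ 2.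
  by field; rewrite !gt_eqF.
move=> h; have h2 : S ^+ 3 <= 64 * m * C * A ^+ 5.
  have : S / 2 <= 32 * m * C * A ^+ 5 / S ^+ 2 by lra.
  rewrite ler_pdivlMr ?exprn_gt0// => h'.
  rewrite exprS; lra.
rewrite !expr_div_n -exprM ler_pdivrMr ?exprn_gt0//.
apply: le_trans h2 _; apply: eqW.
by field; rewrite gt_eqF.
Qed.

End Duality.

(** * The mixed inequality with explicit constants *)

Section Kernel.
Variable R : realType.
Local Notation nc := (@Normc.normc R).
Local Notation ec := (@ec R).

(** Weyl's inequality for the kernel.  With N^2 <= Q <= q om the number of blocks is
    O(om), and the fourth power of the sum is O(om^4 N Q).  The parameter om
    dominates simultaneously the logarithms and the divisor functions, and y is
    the fourth root of N Q. *)
Lemma kernel_le_near_prime_fraction (N Q q a : nat) (om be y x : R) :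
  (0 < N)%N -> (N ^ 2 <= Q)%N -> prime q -> (q <= Q)%N -> Q%:R <= q%:R * om -> 1 <= om ->
  8 * (trunc_log 2 q).+1%:R <= om ->
  (forall m, (0 < m <= 54 * N ^ 2)%N -> (size (divisors m))%:R <= om) ->
  (0 < a < q)%N -> `|be| <= (q%:R ^+ 2)^-1 -> 0 <= a%:R / q%:R + be ->
  0 <= y -> y ^+ 4 = N%:R * Q%:R ->
  nc (\sum_(k < (2 * N).+1) ec ((freq N k)%:~R * x +
     (freq N k ^+ 3)%:~R * (a%:R / q%:R + be))) <= 18 * om * y.
Proof.
move=> N0 NQ pq qQ Qq om1 lq dom /andP[a0 aq] hbe t0 y0 y4.
have om0 : 0 <= om by exact: le_trans om1.
set t := a%:R / q%:R + be in t0 *; set n := (2 * N).+1.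
have -> : \sum_(k < n) ec ((freq N k)%:~R * x + (freq N k ^+ 3)%:~R * t) =
  \sum_(0 <= k < n) ec (t * k%:R ^+ 3 + (- 3 * N%:R * t) * k%:R ^+ 2 +
    (3 * N%:R ^+ 2 * t + x) * k%:R + (- N%:R ^+ 3 * t - N%:R * x)).
  rewrite big_mkord; apply: eq_bigr => k _; congr ec.
  by rewrite /freq rmorphXn /= !intrB -!pmulrn; ring.
have qa : coprime q a.
  by rewrite prime_coprime// gtnNdvd.
have n3 : (n <= 3 * N)%N by rewrite /n; lia.
have nn : (6 * n * n <= 54 * N ^ 2)%N.
  rewrite (_ : 54 * N ^ 2 = 6 * (3 * N) * (3 * N))%N; last by ring.
  by rewrite !leq_mul.
have dom' m : (0 < m <= 6 * n * n)%N -> (size (divisors m))%:R <= om.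
  by move=> /andP[m0 mn]; apply: dom; rewrite m0 (leq_trans mn).
have h := weyl_inequality (- 3 * N%:R * t) (3 * N%:R ^+ 2 * t + x) (- N%:R ^+ 3 * t - N%:R * x)
  (prime_gt0 pq) qa hbe t0 om0 dom'.
set S := nc _ in h *.
have S0 : 0 <= S by exact: normc_ge0.
rewrite -(@ler_pXn2r _ 4)// ?nnegrE ?mulr_ge0//; apply: le_trans h _.
rewrite !exprMn y4.
have NR : 1 <= N%:R :> R by rewrite ler1n.
have QR : N%:R ^+ 2 <= Q%:R :> R by rewrite -natrX ler_nat.
have nR : n%:R <= 3 * N%:R :> R by rewrite -natrM ler_nat.
have qR : 0 < q%:R :> R by rewrite ltr0n prime_gt0.
have qQR : q%:R <= Q%:R :> R by rewrite ler_nat.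
have k1 : ((6 * n * n) %/ q).+1%:R <= 55 * om.
  have : ((6 * n * n) %/ q)%:R <= 54 * om.
    rewrite -(ler_pM2r qR) -natrM; apply: (@le_trans _ _ (54 * N ^ 2)%:R).
      by rewrite ler_nat (leq_trans (leq_trunc_div _ _)).
    rewrite natrM natrX -mulrA ler_wpM2l// (le_trans QR)// mulrC//.
  by rewrite -natr1; lra.
have k2 : 12 * n%:R + 3 * q%:R * (trunc_log 2 q).+1%:R <= 37 * Q%:R * om.
  have NQR : N%:R <= Q%:R :> R by apply: le_trans QR; rewrite expr2 ler_peMl//; lra.
  have : q%:R * (8 * (trunc_log 2 q).+1%:R) <= Q%:R * om by rewrite ler_pM.
  have : Q%:R <= Q%:R * om by rewrite ler_peMr.
  lra.
have k3 : 16 * n%:R * om <= 48 * N%:R * om by rewrite ler_wpM2r//; lra.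
have k4 : 16 * n%:R * om * ((6 * n * n) %/ q).+1%:R <= 48 * N%:R * om * (55 * om).
  by rewrite ler_pM// !mulr_ge0.
have k5 : 16 * n%:R * om * ((6 * n * n) %/ q).+1%:R * (12 * n%:R + 3 * q%:R * (trunc_log 2 q).+1%:R)
    <= 48 * N%:R * om * (55 * om) * (37 * Q%:R * om).
  by rewrite ler_pM ?addr_ge0 ?mulr_ge0.
have n2 : 2 * n%:R ^+ 2 + 8 * n%:R ^+ 3 <= 234 * (N%:R * Q%:R) :> R.
  have e2 : n%:R ^+ 2 <= 9 * N%:R ^+ 2 :> R.
    rewrite (_ : 9 * N%:R ^+ 2 = (3 * N%:R) ^+ 2); last by ring.
    by rewrite lerXn2r ?nnegrE ?mulr_ge0.
  have e3 : n%:R ^+ 3 <= 27 * N%:R ^+ 3 :> R.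
    rewrite (_ : 27 * N%:R ^+ 3 = (3 * N%:R) ^+ 3); last by ring.
    by rewrite lerXn2r ?nnegrE ?mulr_ge0.
  have e4 : N%:R ^+ 2 <= N%:R ^+ 3 :> R by rewrite [leRHS]exprS ler_peMl// exprn_ge0.
  have e5 : N%:R ^+ 3 <= N%:R * Q%:R :> R by rewrite exprS ler_wpM2l.
  lra.
have w : 0 <= N%:R * Q%:R :> R by rewrite mulr_ge0.
have o3 : 1 <= om ^+ 3 by rewrite exprn_ege1.
have o4 : om ^+ 3 <= om ^+ 4 by rewrite [leRHS]exprS ler_peMl// exprn_ge0.
have f1 : N%:R * Q%:R <= om ^+ 4 * (N%:R * Q%:R) by rewrite ler_peMl// (le_trans o3).
have f2 : om ^+ 3 * (N%:R * Q%:R) <= om ^+ 4 * (N%:R * Q%:R) by rewrite ler_wpM2r.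
(* 18^4 exceeds 234 + 48 * 55 * 37, the sum of the constants in n2 and k5 *)
have c1 : 18 ^+ 4 * om ^+ 4 * (N%:R * Q%:R) = 324 * (324 * (om ^+ 4 * (N%:R * Q%:R))) by ring.
have c2 : 48 * N%:R * om * (55 * om) * (37 * Q%:R * om) = 48 * (55 * (37 * (om ^+ 3 * (N%:R * Q%:R)))) by ring.
apply: le_trans (lerD n2 k5) _; rewrite c1 c2.
move: f1 f2 w; set U := om ^+ 4 * _; set V := om ^+ 3 * _; set W := N%:R * Q%:R.
move: U V W => U V W f1 f2 w.
have g1 : 37 * V <= 37 * U by lra.
have g2 : 55 * (37 * V) <= 55 * (37 * U) by rewrite ler_wpM2l.
have g3 : 48 * (55 * (37 * V)) <= 48 * (55 * (37 * U)) by rewrite ler_wpM2l.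
apply: le_trans (lerD (lexx _) g3) _; lra.
Qed.

(** [grid_mixed_inequality] for the primes of the window below Q, divided by their
    sum Z: the number of primes divided by Z is O(om / Q), and 1 / Z is
    O(om^2 / Q^2). *)
Lemma grid_mixed_bound (N T M Q : nat) (om y : R) (phi : 'I_T -> 'I_M -> R[i]) :
  (0 < N)%N -> (1 < Q)%N -> (N ^ 2 <= Q)%N -> ((2 * N).+1 <= M)%N -> (0 < T)%N ->
  (4 * Q ^ 2 %| T)%N -> (forall q, (0 < q <= Q)%N -> (q %| T)%N) ->
  1 <= om -> (window_log Q)%:R <= om ->
  (forall m, (0 < m <= 54 * N ^ 2)%N -> (size (divisors m))%:R <= om) ->
  0 <= y -> y ^+ 4 = N%:R * Q%:R ->
  grid_energy N phi / (T%:R * M%:R) ^+ 2 <=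
  om / Q%:R * ((\sum_j \sum_i nc (phi j i) ^+ 2) / (T%:R * M%:R)) +
  72 * om ^+ 3 * y * ((\sum_j \sum_i nc (phi j i)) / (T%:R * M%:R)) ^+ 2.
Proof.
move=> N0 Q1 NQ NM T0 QT qT om1 wom dom y0 y4.
case: T T0 phi QT qT => // T' _ phi QT qT; set T := T'.+1.
have Q0 : (0 < Q)%N by exact: ltnW.
pose L := (T %/ (4 * Q ^ 2))%N.
have QL : (4 * Q ^ 2 * L = T)%N by rewrite mulnC divnK.
have L0 : (0 < L)%N by rewrite divn_gt0 ?muln_gt0 ?expn_gt0 ?Q0// dvdn_leq.
pose P := window_primes Q.
have uP : uniq P by rewrite filter_uniq ?iota_uniq.
have Pin q : q \in P -> [/\ prime q, (q <= Q)%N & (Q < q * window_log Q)%N].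
  by rewrite mem_filter mem_iota /= add0n ltnS => /andP[/andP[-> ->] ->].
have hP q : q \in P -> [/\ prime q, (q <= Q)%N & (q %| T)%N].
  by move=> /Pin[pq qQ _]; split => //; apply: qT; rewrite prime_gt0.
have om0 : 0 <= om by exact: le_trans om1.
have M00 : 0 <= 18 * om * y by rewrite !mulr_ge0.
have TR : 0 < T%:R :> R by rewrite ltr0n.
have QR : 0 < Q%:R :> R by rewrite ltr0n.
have LR : 0 < L%:R :> R by rewrite ltr0n.
have TE : T%:R = 4 * Q%:R ^+ 2 * L%:R :> R by rewrite -natrX -!natrM QL.
have MR : 0 < M%:R :> R by rewrite ltr0n (leq_trans _ NM).
(* the points of the arcs are within L / T <= 1 / q^2 of a / q *)
have hK (q a u u' : nat) (x : R) : q \in P -> (0 < a < q)%N -> (u < L)%N -> (u' < L)%N ->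
     nc (\sum_(k < (2 * N).+1) ec ((freq N k)%:~R * x +
       (freq N k ^+ 3)%:~R * (((a * (T %/ q) + u)%:R - u'%:R) / T%:R))) <= 18 * om * y.
  move=> qP aq uL uL'; have [pq qQ qwin] := Pin _ qP.
  have qR : 0 < q%:R :> R by rewrite ltr0n prime_gt0.
  have qD : T%:R = q%:R * (T %/ q)%:R :> R.
    by rewrite -natrM mulnC divnK//; have [] := hP _ qP.
  set D := (T %/ q)%N in qD *.
  have DR : 0 < D%:R :> R by rewrite -(pmulr_rgt0 _ qR) -qD.
  set be : R := (u%:R - u'%:R) / T%:R.
  have -> : ((a * D + u)%:R - u'%:R) / T%:R = a%:R / q%:R + be.
    by rewrite /be natrD natrM qD; field; rewrite !gt_eqF.
  have uu : `|u%:R - u'%:R| <= L%:R :> R.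
    have := uL; have := uL'; rewrite -!(ltr_nat R) ler_norml.
    have := ler0n R u; have := ler0n R u'.
    by move=> *; apply/andP; split; lra.
  have qQR : q%:R <= Q%:R :> R by rewrite ler_nat.
  have qq : q%:R ^+ 2 <= Q%:R ^+ 2 :> R by rewrite lerXn2r ?nnegrE.
  have LT : L%:R / T%:R <= (q%:R ^+ 2)^-1 :> R.
    rewrite ler_pdivrMr// TE -[leLHS]mul1r mulrA ler_wpM2r//.
    rewrite mulrC ler_pdivlMr ?exprn_gt0// mul1r.
    by rewrite (le_trans qq)// ler_peMl ?exprn_ge0//; lra.
  have hbe : `|be| <= (q%:R ^+ 2)^-1.
    by rewrite /be normrM (gtr0_norm (_ : 0 < T%:R^-1)) ?invr_gt0// (le_trans _ LT)// ler_wpM2r ?invr_ge0.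
  apply: (@kernel_le_near_prime_fraction N Q) => //.
  - by apply: le_trans (_ : (q * window_log Q)%:R <= _); rewrite ?ler_nat 1?ltnW// natrM ler_wpM2l.
  - by rewrite -natrM (le_trans _ wom)// ler_nat leq_mul2l/= ltnS leq_trunc_log.
  - have a1 : 1 <= a%:R :> R by rewrite ler1n; case/andP: aq.
    have qi : (q%:R ^+ 2)^-1 <= q%:R^-1 :> R.
      rewrite lef_pV2 ?posrE ?exprn_gt0// expr2 ler_peMr//.
      by rewrite ler1n prime_gt0.
    have : q%:R^-1 <= a%:R / q%:R :> R by rewrite ler_peMl// invr_ge0.
    by move: hbe; rewrite ler_norml => /andP[+ _]; lra.
have := grid_mixed_inequality phi NM L0 QL uP M00 hP hK.
rewrite -/T; set E := grid_energy N phi; set F2 := \sum_(j < T) \sum_i nc (phi j i) ^+ 2.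
set F1 := \sum_(j < T) \sum_i nc (phi j i); set Z := \sum_(q <- P) q%:R => mix.
have F20 : 0 <= F2 by apply: sumr_ge0 => j _; apply: sumr_ge0 => i _; rewrite sqr_ge0.
have pP : Q%:R <= om * (size P)%:R.
  apply: (@le_trans _ _ (window_log Q * size P)%:R); first by rewrite ler_nat size_window_primes.
  by rewrite natrM ler_wpM2r.
have omp : 0 < om by exact: lt_le_trans om1.
have Zp : (size P)%:R * (Q%:R / om) <= Z.
  have -> : (size P)%:R * (Q%:R / om) = \sum_(q <- P) Q%:R / om.
    by rewrite big_const_seq count_predT iter_addr_0 mulr_natl.
  rewrite /Z !big_seq; apply: ler_sum => q qP; rewrite ler_pdivrMr//.
  have [_ _ qw] := Pin _ qP.
  apply: (@le_trans _ _ (q * window_log Q)%:R); first by rewrite ler_nat ltnW.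
  by rewrite natrM ler_wpM2l.
have p0 : 0 < (size P)%:R :> R.
  by rewrite -(pmulr_rgt0 _ omp) (lt_le_trans QR).
have Z0 : 0 < Z by rewrite (lt_le_trans _ Zp)// mulr_gt0// divr_gt0.
have mix2 : Z * (E / (T%:R * M%:R) ^+ 2) <= (size P)%:R * (F2 / (T%:R * M%:R)) +
    18 * om * y * (4 * Q%:R ^+ 2) * (F1 / (T%:R * M%:R)) ^+ 2.
  have c0 : 0 < L%:R ^+ 2 * T%:R * M%:R ^+ 2 :> R by rewrite !mulr_gt0 ?exprn_gt0.
  rewrite -(ler_pM2r c0).
  have -> : Z * (E / (T%:R * M%:R) ^+ 2) * (L%:R ^+ 2 * T%:R * M%:R ^+ 2) =
     Z * L%:R ^+ 2 / T%:R * E by field; rewrite !gt_eqF.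
  apply: le_trans mix _; apply: eqW.
  by rewrite TE; field; rewrite !gt_eqF.
have Zi : (size P)%:R / Z <= om / Q%:R.
  rewrite ler_pdivrMr// mulrAC ler_pdivlMr// mulrC.
  by move: Zp; rewrite mulrA ler_pdivrMr// (mulrC Z) (mulrC (size P)%:R).
have Zi2 : Q%:R ^+ 2 / Z <= om ^+ 2.
  rewrite ler_pdivrMr//.
  have : (size P)%:R * Q%:R <= om * Z by move: Zp; rewrite mulrA ler_pdivrMr// (mulrC Z).
  move=> /(ler_wpM2l om0); rewrite mulrA [X in _ <= X]mulrA -expr2; apply: le_trans.
  by rewrite expr2 ler_wpM2r.
have -> : E / (T%:R * M%:R) ^+ 2 = Z * (E / (T%:R * M%:R) ^+ 2) / Z.
  by rewrite [RHS]mulrAC mulfV ?mul1r// gt_eqF.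
have Zv : 0 <= Z^-1 by rewrite invr_ge0 ltW.
apply: le_trans (ler_wpM2r Zv mix2) _; rewrite mulrDl lerD//.
  by rewrite mulrAC ler_wpM2r// divr_ge0// mulr_ge0// ltW.
rewrite (_ : _ / Z = (Q%:R ^+ 2 / Z) * (72 * om * y * (F1 / (T%:R * M%:R)) ^+ 2)); last by ring.
rewrite (_ : 72 * om ^+ 3 * y * (F1 / (T%:R * M%:R)) ^+ 2 =
   om ^+ 2 * (72 * om * y * (F1 / (T%:R * M%:R)) ^+ 2)); last by ring.
by rewrite ler_wpM2r// mulr_ge0 ?sqr_ge0// !mulr_ge0.
Qed.
End Kernel.

(** * The restricted bound on the grid *)

Section RestrictedType.
Variable R : realType.
Local Notation nc := (@Normc.normc R).

(** The first two conditions make the frequencies occurring in a sixth moment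
    distinct on the grid; the last one places the fractions of
    denominator at most Q on the grid, with an integral window length
    T / (4 Q^2). *)
Definition good_grid (N T M : nat) : Prop :=
  [/\ (6 * N < M)%N, (6 * N ^ 3 < T)%N &
      forall Q, (0 < Q <= N ^ 3)%N -> (4 * Q ^ 2 %| T)%N].

(** A single number om stands for all factors N^o(1). *)
Definition good_gauge (N : nat) (om : R) : Prop :=
  [/\ 1 <= om, forall m, (0 < m <= 54 * N ^ 3)%N -> (size (divisors m))%:R <= om &
      forall Q, (0 < Q <= N ^ 3)%N -> (window_log Q)%:R <= om].

Lemma good_grid_exists N : (0 < N)%N -> good_grid N (8 * N ^ 6)`! (6 * N).+1.
Proof.
move=> N0; have N3 : (N ^ 3 <= N ^ 6)%N by rewrite leq_pexp2l.
split => //.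
- apply: leq_trans (fact_geq _).
  apply: (@leq_trans (8 * N ^ 3)); last by rewrite leq_mul2l N3.
  by have : (0 < N ^ 3)%N; [rewrite expn_gt0 N0|lia].
- move=> Q /andP[Q0 QN]; apply: dvdn_fact; rewrite muln_gt0 expn_gt0 Q0/=.
  apply: (@leq_trans (4 * (N ^ 3) ^ 2)); first by rewrite leq_mul2l leq_exp2r.
  by rewrite -expnM leq_mul.
Qed.

(** The arguments of the divisor function and of the logarithm have size O(N^3),
    whence the exponent eps / 3 in the bounds invoked. *)
Lemma good_gauge_exists (eps : R) : 0 < eps ->
  exists2 C : R, 1 <= C & forall N, (0 < N)%N -> good_gauge N (C * N%:R `^ eps).
Proof.
move=> e0; have e3 : 0 < eps / 3 by rewrite divr_gt0.
have [C1 h1] := size_divisors_le_powR e3.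
have [C2 h2] := trunc_log_le_powR e3.
have C20 : 0 <= C2 by have := h2 1%N isT; rewrite powR1 mulr1; apply: le_trans.
have C10 : 0 <= C1 by have := h1 1%N isT; rewrite powR1 mulr1; apply: le_trans.
pose C := 1 + C1 * 54 `^ (eps / 3) + 8 * C2.
have p54 : 0 <= C1 * 54 `^ (eps / 3) by rewrite mulr_ge0// powR_ge0.
have N3 N : (N ^ 3)%:R `^ (eps / 3) = N%:R `^ eps :> R.
  by rewrite natrX -powR_mulrn// -powRrM; congr (_ `^ _); field.
have mono (x y : R) : 0 <= x -> x <= y -> x `^ (eps / 3) <= y `^ (eps / 3).
  move=> x0 xy; have y0 := le_trans x0 xy; have e3' := ltW e3.
  by apply: ge0_ler_powR.
have C1' : 1 <= C by rewrite /C; lra.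
exists C; first exact: C1'.
move=> N N0; have Ne : 1 <= N%:R `^ eps :> R.
  have N1 : 1 <= N%:R :> R by rewrite ler1n.
  by have := ler_powR N1 (ltW e0); rewrite powRr0.
split.
- by rewrite -[leLHS]mulr1 ler_pM.
- move=> m /andP[m0 mN]; apply: le_trans (h1 m m0) _.
  apply: (@le_trans _ _ (C1 * 54 `^ (eps / 3) * N%:R `^ eps)); last first.
    by rewrite ler_wpM2r ?powR_ge0// /C; lra.
  rewrite -mulrA ler_wpM2l// -N3 -powRM// mono// -natrM ler_nat//.
- move=> Q /andP[Q0 QN]; rewrite /window_log natrM.
  apply: (@le_trans _ _ (8 * (C2 * N%:R `^ eps))); last first.
    by rewrite mulrA ler_wpM2r ?powR_ge0// /C; lra.
  rewrite ler_wpM2l//; apply: le_trans (h2 Q Q0) _; rewrite ler_wpM2l// -N3.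
  by rewrite mono// ler_nat.
Qed.

Lemma grid_energy_le_L1 (N T M : nat) (phi : 'I_T -> 'I_M -> R[i]) : (0 < N)%N ->
  grid_energy N phi <= 3 * N%:R * (\sum_j \sum_i nc (phi j i)) ^+ 2.
Proof.
move=> N0; set F1 := \sum_j _.
have F10 : 0 <= F1 by apply: sumr_ge0 => j _; apply: sumr_ge0 => i _; exact: normc_ge0.
apply: (@le_trans _ _ (\sum_(k < (2 * N).+1) F1 ^+ 2)).
  apply: ler_sum => k _; rewrite lerXn2r ?nnegrE ?normc_ge0//.
  apply: le_trans (normc_sum_le _ _ _) _; apply: ler_sum => j _.
  apply: le_trans (normc_sum_le _ _ _) _; apply: ler_sum => i _.
  by rewrite Normc.normcM normc_ec mulr1.
rewrite sumr_const card_ord -[leLHS]mulr_natl ler_wpM2r ?sqr_ge0//.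
by rewrite -natrM ler_nat; lia.
Qed.

Lemma grid_coef_scale (N T M k : nat) (phi : 'I_T -> 'I_M -> R[i]) (z : R[i]) :
  grid_coef N (fun j i => z * phi j i) k = z * grid_coef N phi k.
Proof.
rewrite /grid_coef mulr_sumr; apply: eq_bigr => j _; rewrite mulr_sumr.
by apply: eq_bigr => i _; rewrite mulrA.
Qed.

(** Put N = exp nu and alpha = exp (- a), where alpha is the density of e.  For
    a >= 4 nu the trivial bound suffices.  Below that, the inequality
    (1/7 - 2/p)(4 nu - a) >= 0 reduces the claim to p = 14, that is to the
    exponent 3/7 nu - 13/7 a.  The sixth moment gives - 5/3 a, which is enough
    for a <= 9/4 nu; beyond, the mixed bound applies with
    Q = exp (5/7 nu + 4/7 a), which lies between N^2 and N^3 exactly when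
    9/4 nu <= a <= 4 nu. *)
Lemma grid_restricted_bound (p : R) (N T M : nat) (om H : R) (phi : 'I_T -> 'I_M -> R[i])
    (e : 'I_T -> 'I_M -> bool) :
  14 <= p -> (0 < N)%N -> good_grid N T M -> good_gauge N om -> 0 < H ->
  (forall j i, nc (phi j i) <= H * (e j i)%:R) ->
  grid_energy N phi / (T%:R * M%:R) ^+ 2 <= H ^+ 2 * (74 * om ^+ 3 * (N%:R `^ (1 - 8 / p) *
    ((\sum_j \sum_i (e j i)%:R) / (T%:R * M%:R)) `^ (2 - 2 / p))).
Proof.
move=> p14 N0 [NM NT T4] [om1 omd omw] H0.
wlog H1 : H H0 phi / H = 1.
  move=> wl he; pose psi j i := (H^-1)%:C%C * phi j i.
  have Hi : 0 <= H^-1 by rewrite invr_ge0 ltW.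
  have hpsi j i : nc (psi j i) <= 1 * (e j i)%:R.
    by rewrite mul1r /psi Normc.normcM normc_real// ler_pdivrMl.
  have := wl 1 ltr01 psi erefl hpsi; rewrite expr1n mul1r => h.
  have -> : grid_energy N phi = H ^+ 2 * grid_energy N psi.
    rewrite /grid_energy mulr_sumr; apply: eq_bigr => k _.
    rewrite /psi grid_coef_scale Normc.normcM normc_real// exprMn mulrA -exprMn.
    by rewrite divff ?gt_eqF// expr1n mul1r.
  by rewrite -mulrA ler_wpM2l// sqr_ge0.
rewrite {}H1 expr1n mul1r => he; have {}he j i : nc (phi j i) <= (e j i)%:R.
  by have := he j i; rewrite mul1r.
have om0 : 0 <= om by exact: le_trans om1.
have NR : 0 < N%:R :> R by rewrite ltr0n.
have T0 : (0 < T)%N by exact: leq_ltn_trans NT.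
set m : R := T%:R * M%:R.
have TM : 0 < m by rewrite mulr_gt0// ltr0n// (leq_ltn_trans _ NM).
set A := \sum_j _; set al := A / _.
have A0 : 0 <= A by apply: sumr_ge0 => j _; apply: sumr_ge0.
have al0 : 0 <= al by rewrite divr_ge0// ltW.
set E := _ / _ ^+ 2.
have F1 : (\sum_j \sum_i nc (phi j i)) / m <= al.
  rewrite ler_wpM2r ?invr_ge0 ?(ltW TM)//; apply: ler_sum => j _.
  by apply: ler_sum => i _; exact: he.
have F10 : 0 <= (\sum_j \sum_i nc (phi j i)) / m.
  by rewrite divr_ge0 ?(ltW TM)//; apply: sumr_ge0 => j _; apply: sumr_ge0 => i _; exact: normc_ge0.
have E1 : E <= 3 * N%:R * al ^+ 2.
  apply: (@le_trans _ _ (3 * N%:R * ((\sum_j \sum_i nc (phi j i)) / m) ^+ 2)).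
    by rewrite expr_div_n mulrA ler_wpM2r ?invr_ge0 ?sqr_ge0// grid_energy_le_L1.
  by rewrite ler_wpM2l ?mulr_ge0// lerXn2r ?nnegrE.
have p0 : 0 < p by lra.
have o3 : 1 <= om ^+ 3 by rewrite exprn_ege1.
have o13 : om <= om ^+ 3 by rewrite -[leLHS]expr1 ler_weXn2l.
have [al1|alN] := eqVneq al 0.
  by rewrite al1 in E1 *; apply: le_trans E1 _; rewrite expr0n mulr0 !mulr_ge0 ?powR_ge0// exprn_ge0.
have alp : 0 < al by rewrite lt_neqAle eq_sym alN.
pose nu := ln (N%:R : R); pose a := - ln al.
have NE : N%:R = expR nu by rewrite lnK.
have alE : al = expR (- a) by rewrite opprK lnK.
have nu0 : 0 <= nu by rewrite ln_ge0// ler1n.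
have -> : N%:R `^ (1 - 8 / p) * al `^ (2 - 2 / p) = expR (nu * (1 - 8 / p) - a * (2 - 2 / p)).
  by rewrite NE alE -!expRM -expRD mulNr.
have q0 : 0 < p^-1 by rewrite invr_gt0.
have q14 : p^-1 <= 14^-1 by rewrite lef_pV2 ?posrE.
have [a4|a4] := leP (4 * nu) a.
  apply: le_trans E1 _; have -> : 3 * N%:R * al ^+ 2 = 3 * expR (nu + 2%:R * - a).
    by rewrite expRD expRM_natl -NE -alE mulrA.
  rewrite ler_pM ?expR_ge0// ?ler_expR; first by lra.
  by have := ler_wpM2r (ltW q0) a4; lra.
suff E2 : E <= 74 * om ^+ 3 * expR (3 / 7 * nu - 13 / 7 * a).
  apply: le_trans E2 _; rewrite ler_wpM2l ?mulr_ge0 ?exprn_ge0// ler_expR.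
  have h1 : 0 <= 1 / 7 - 2 * p^-1 by lra.
  have h2 : 0 <= 4 * nu - a by lra.
  by have := mulr_ge0 h1 h2; lra.
have [a94|a94] := leP a (9 / 4 * nu).
  have dom8 m' : (0 < m' <= 8 * N ^ 3)%N -> (size (divisors m'))%:R <= om.
    by move=> /andP[m0 mN]; apply: omd; rewrite m0 (leq_trans mN)// leq_mul2r orbT.
  have E3 : E ^+ 3 <= 64 * (4 * om ^+ 2 + 9) * al ^+ 5 by exact: grid_energy_pow3_le.
  have E0 : 0 <= E by rewrite divr_ge0 ?sqr_ge0//; apply: sumr_ge0 => k _; rewrite sqr_ge0.
  have E4 : E <= 10 * om * expR (- (5 / 3 * a)).
    rewrite -(@ler_pXn2r _ 3)// ?nnegrE ?mulr_ge0 ?expR_ge0//; apply: le_trans E3 _.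
    have -> : (10 * om * expR (- (5 / 3 * a))) ^+ 3 = 10 ^+ 3 * om ^+ 3 * al ^+ 5.
      by rewrite alE !exprMn -!expRM_natl; congr (_ * expR _); lra.
    rewrite ler_wpM2r ?exprn_ge0//.
    have o2 : 1 <= om ^+ 2 by rewrite exprn_ege1.
    have o23 : om ^+ 2 <= om ^+ 3 by rewrite ler_weXn2l.
    by lra.
  apply: le_trans E4 _; rewrite ler_pM ?expR_ge0 ?mulr_ge0// ?ler_expR; last by lra.
  by lra.
have nup : 0 < nu by lra.
have N1 : (1 < N)%N.
  rewrite ltn_neqAle N0 andbT eq_sym; apply: contraTneq nup => N1.
  by rewrite /nu N1 ln1 ltxx.
(* the value of Q that balances the two terms of the mixed bound *)
pose x0 := expR (5 / 7 * nu + 4 / 7 * a).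
have N2x : (N ^ 2)%:R <= x0.
  by rewrite natrX NE -expRM_natl ler_expR; lra.
have xN3 : x0 <= (N ^ 3)%:R.
  by rewrite natrX NE -expRM_natl ler_expR; lra.
pose Q := Num.truncn x0.
have /andP[Qx xQ] : Q%:R <= x0 < Q.+1%:R by rewrite truncn_itv// expR_ge0.
have NQ : (N ^ 2 <= Q)%N by rewrite -ltnS -(ltr_nat R) (le_lt_trans N2x).
have QN : (Q <= N ^ 3)%N by rewrite -(ler_nat R) (le_trans Qx).
have Q1 : (1 < Q)%N by rewrite (leq_trans _ NQ)// (leq_trans N1)// expnS expn1 leq_pmulr.
have Q0 : (0 < Q)%N by exact: ltnW.
have QR : 0 < Q%:R :> R by rewrite ltr0n.
pose y : R := (N%:R * Q%:R) `^ (4^-1).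
have y0 : 0 <= y by exact: powR_ge0.
have y4 : y ^+ 4 = N%:R * Q%:R.
  by rewrite /y -powR_mulrn ?powR_ge0// -powRrM mulVf// powRr1// mulr_ge0.
have yle : y <= expR (3 / 7 * nu + a / 7).
  rewrite -(@ler_pXn2r _ 4)// ?nnegrE ?expR_ge0// y4 -expRM_natl.
  apply: (@le_trans _ _ (N%:R * x0)); first by rewrite ler_wpM2l.
  by rewrite NE -expRD ler_expR; lra.
have NM2 : ((2 * N).+1 <= M)%N by rewrite (leq_ltn_trans _ NM)// leq_mul2r orbT.
have T4Q : (4 * Q ^ 2 %| T)%N by apply: T4; rewrite Q0.
have Tq' q : (0 < q <= Q)%N -> (q %| T)%N.
  move=> /andP[q1 q3]; apply: (@dvdn_trans (4 * q ^ 2)).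
    by rewrite dvdn_mull// dvdn_exp.
  by apply: T4; rewrite q1 (leq_trans q3).
have womQ : (window_log Q)%:R <= om by apply: omw; rewrite Q0.
have dom54 m' : (0 < m' <= 54 * N ^ 2)%N -> (size (divisors m'))%:R <= om.
  move=> /andP[m0 mN]; apply: omd; rewrite m0 (leq_trans mN)// leq_mul2l/=.
  by rewrite leq_pexp2l.
have := grid_mixed_bound phi N0 Q1 NQ NM2 T0 T4Q Tq' om1 womQ dom54 y0 y4.
rewrite -/m -/E => mix; apply: le_trans mix _.
have F2 : (\sum_j \sum_i nc (phi j i) ^+ 2) / m <= al.
  rewrite ler_wpM2r ?invr_ge0 ?(ltW TM)//; apply: ler_sum => j _.
  apply: ler_sum => i _; apply: (@le_trans _ _ ((e j i)%:R ^+ 2)).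
    by rewrite lerXn2r ?nnegrE ?normc_ge0// .
  by case: (e j i); rewrite ?expr1n ?expr0n.
have t1 : om / Q%:R * ((\sum_j \sum_i nc (phi j i) ^+ 2) / m) <= 2 * om ^+ 3 * expR (3 / 7 * nu - 13 / 7 * a).
  apply: (@le_trans _ _ (om * (2 / x0) * al)).
    apply: ler_pM => //.
    - by rewrite divr_ge0// ltW.
    - rewrite divr_ge0 ?(ltW TM)//; apply: sumr_ge0 => j _; apply: sumr_ge0 => i _; exact: sqr_ge0.
    - rewrite ler_wpM2l// ler_pdivlMr ?expR_gt0// mulrC ler_pdivrMr//.
      have : (1 : R) <= Q%:R by rewrite ler1n.
      by rewrite -natr1 in xQ; lra.
  have -> : om * (2 / x0) * al = 2 * om * expR (- (5 / 7 * nu + 4 / 7 * a) - a).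
    by rewrite (expRD _ (- a)) -alE expRN -/x0; ring.
  rewrite ler_pM ?mulr_ge0 ?expR_ge0// ?ler_wpM2l// ler_expR; lra.
have t2 : 72 * om ^+ 3 * y * ((\sum_j \sum_i nc (phi j i)) / m) ^+ 2 <=
    72 * om ^+ 3 * expR (3 / 7 * nu - 13 / 7 * a).
  rewrite -mulrA ler_wpM2l ?mulr_ge0 ?exprn_ge0//.
  apply: (@le_trans _ _ (expR (3 / 7 * nu + a / 7) * al ^+ 2)).
    by rewrite ler_pM ?sqr_ge0// lerXn2r ?nnegrE.
  by rewrite alE -expRM_natl -expRD ler_expR; lra.
lra.
Qed.

End RestrictedType.

(** * From level sets to the strong bound on the grid *)

Section StrongType.
Variable R : realType.
Local Notation nc := (@Normc.normc R).

Lemma grid_energy_split (N T M J : nat) (phi : 'I_T -> 'I_M -> R[i]) (lev : 'I_T -> 'I_M -> nat) :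
  (forall j i, (lev j i < J)%N) ->
  grid_energy N phi <= J%:R * \sum_(0 <= l < J)
    grid_energy N (fun j i => (lev j i == l)%:R * phi j i).
Proof.
move=> hlev; pose f l j i := (lev j i == l)%:R * phi j i.
have sc k : grid_coef N phi k = \sum_(0 <= l < J) grid_coef N (f l) k.
  rewrite /grid_coef [RHS]exchange_big; apply: eq_bigr => j _.
  rewrite [RHS]exchange_big; apply: eq_bigr => i _.
  rewrite -mulr_suml /f -mulr_suml big_mkord (bigD1 (Ordinal (hlev j i)))//= eqxx.
  rewrite big1 ?addr0 ?mul1r// => l; rewrite -val_eqE /= eq_sym => /negPf->.
  by [].
rewrite /grid_energy exchange_big /= mulr_sumr; apply: ler_sum => k _.
rewrite sc; apply: le_trans (sqr_sum_le J (fun l => nc (grid_coef N (f l) k))).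
rewrite lerXn2r ?nnegrE ?normc_ge0 ?normc_sum_le//.
by apply: sumr_ge0 => l _; exact: normc_ge0.
Qed.

(** Let Lambda be the L^r average of phi.  The levels are Lambda N^(d k), k <= J.
    Where |phi| <= Lambda the bound for sets of density 1 is used.  On the
    set between the levels k - 1 and k, of density at most N^(- d (k - 1) r) by
    Chebyshev's inequality, the restricted bound loses a factor N^(2 d)
    because the exponent 2 - 2/p equals 2 / r.  Above the last level, which is at
    least Lambda N^(p - 1), the L^1 norm is at most Lambda / N and the trivial
    bound is enough. *)
Lemma grid_strong_bound (p r d : R) (N T M J : nat) (om : R) (phi : 'I_T -> 'I_M -> R[i]) :
  14 <= p -> (0 < N)%N -> good_grid N T M -> good_gauge N om -> 0 < d -> p - 1 <= d * J%:R ->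
  r = p / (p - 1) ->
  grid_energy N phi / (T%:R * M%:R) ^+ 2 <=
  J.+2%:R ^+ 2 * (N%:R `^ (2 * d) * (74 * om ^+ 3 * N%:R `^ (1 - 8 / p))) *
  (((\sum_j \sum_i nc (phi j i) `^ r) / (T%:R * M%:R)) `^ r^-1) ^+ 2.
Proof.
move=> p14 N0 gg gw d0 dJ rdef; have [NM NT _] := gg; have [om1 _ _] := gw.
have p0 : 0 < p by lra.
have p1 : 0 < p - 1 by lra.
have r0 : 0 < r by rewrite rdef divr_gt0.
have rE : r = 1 + (p - 1)^-1 by rewrite rdef; field; rewrite gt_eqF.
have rV : r^-1 = 1 - p^-1 by rewrite rdef; field; rewrite !gt_eqF.
have om0 : 0 <= om by exact: le_trans om1.
have NR : 0 < N%:R :> R by rewrite ltr0n.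
have T0 : (0 < T)%N by exact: leq_ltn_trans NT.
set m : R := T%:R * M%:R.
have TM : 0 < m by rewrite mulr_gt0// ltr0n// (leq_ltn_trans _ NM).
set Y := \sum_j _; set X := Y / m.
have Y0 : 0 <= Y by apply: sumr_ge0 => j _; apply: sumr_ge0 => i _; exact: powR_ge0.
have X0 : 0 <= X by rewrite divr_ge0// ltW.
have [X1|X1] := eqVneq X 0.
  have Y1 : Y = 0.
    by move/eqP: X1; rewrite mulf_eq0 invr_eq0 (gt_eqF TM) orbF => /eqP.
  have phi0 j i : nc (phi j i) = 0.
    move/eqP: Y1; rewrite psumr_eq0; last by move=> j' _; apply: sumr_ge0 => i' _; exact: powR_ge0.
    move=> /allP /(_ j (mem_index_enum _)) /=; rewrite psumr_eq0; last by move=> i' _; exact: powR_ge0.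
    move=> /allP /(_ i (mem_index_enum _)) /= /eqP /powR_eq0_eq0//.
  rewrite (_ : grid_energy N phi = 0) ?mul0r.
    by rewrite !mulr_ge0 ?exprn_ge0 ?powR_ge0.
  apply/eqP; rewrite eq_le; apply/andP; split; last by apply: sumr_ge0 => k _; exact: sqr_ge0.
  apply: le_trans (grid_energy_le_L1 phi N0) _.
  by rewrite big1 ?expr0n ?mulr0// => j _; rewrite big1.
have Xp : 0 < X by rewrite lt_neqAle eq_sym X1.
pose nu := ln (N%:R : R); pose xi := ln X.
have NE : N%:R = expR nu by rewrite lnK.
have XE : X = expR xi by rewrite lnK.
have nu0 : 0 <= nu by rewrite ln_ge0// ler1n.
pose t (k : nat) : R := expR (xi / r + d * k%:R * nu).
have t0 k : 0 < t k by exact: expR_gt0.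
(* the first level that dominates |phi|, and J + 1 if there is none *)
pose lev j i := find (fun k => nc (phi j i) <= t k) (iota 0 J.+1).
have levJ j i : (lev j i < J.+2)%N by rewrite ltnS -[X in (_ <= X)%N](size_iota 0) find_size.
have lev_le j i : (lev j i <= J)%N -> nc (phi j i) <= t (lev j i).
  move=> lJ; have : has (fun k => nc (phi j i) <= t k) (iota 0 J.+1) by rewrite has_find size_iota ltnS.
  by move/(nth_find 0%N); rewrite -/(lev j i) nth_iota.
have lev_gt j i k : (k < lev j i)%N -> t k < nc (phi j i).
  move=> kl; rewrite ltNge; have := before_find 0%N kl.
  by rewrite nth_iota ?add0n; [move=> ->|rewrite (leq_trans kl)// -ltnS].
apply: (@le_trans _ _ ((J.+2%:R * \sum_(0 <= l < J.+2)
    grid_energy N (fun j i => (lev j i == l)%:R * phi j i)) / m ^+ 2)).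
  by rewrite ler_wpM2r ?invr_ge0 ?sqr_ge0// grid_energy_split.
set B := N%:R `^ (2 * d) * _; set Lam2 := (X `^ r^-1) ^+ 2.
have Lam2E : Lam2 = expR (2 * (xi / r)).
  by rewrite /Lam2 XE -expRM expRM_natl.
rewrite -[leLHS]mulrA expr2 -[X in _ <= X * _]mulrA -[leRHS]mulrA ler_wpM2l//.
rewrite mulr_suml; apply: (@le_trans _ _ (\sum_(0 <= l < J.+2) (B * Lam2))); last first.
  by rewrite sumr_const_nat subn0 -[leLHS]mulr_natl mulrA.
rewrite !big_seq; apply: ler_sum => l; rewrite mem_index_iota /= => lJ.
set psi := fun j i => _.
have npsi j i : nc (psi j i) = (lev j i == l)%:R * nc (phi j i).
  by rewrite Normc.normcM; case: eqP; rewrite ?Normc.normc1 ?Normc.normc0.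
have om3 : 1 <= om ^+ 3 by rewrite exprn_ege1.
have BE : B = 74 * om ^+ 3 * expR (2 * d * nu + nu * (1 - 8 / p)).
  by rewrite /B NE -!expRM expRD; rewrite (mulrC nu (2 * d)); ring.
have pV : 0 < p^-1 by rewrite invr_gt0.
have pV14 : p^-1 <= 14^-1 by rewrite lef_pV2 ?posrE.
have [lJ1|lJ1] := leqP l J; last first.
  have lE : l = J.+1 by apply/eqP; rewrite eqn_leq -ltnS lJ lJ1.
  apply: (@le_trans _ _ (3 * N%:R * ((\sum_j \sum_i nc (psi j i)) / m) ^+ 2)).
    by rewrite [X in _ <= _ * X]expr_div_n [leRHS]mulrA ler_wpM2r ?invr_ge0 ?sqr_ge0// grid_energy_le_L1.
  have L1 : (\sum_j \sum_i nc (psi j i)) / m <= X * t J `^ (1 - r).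
    rewrite /X mulrAC ler_wpM2r ?invr_ge0 ?(ltW TM)// mulr_suml; apply: ler_sum => j _.
    rewrite mulr_suml; apply: ler_sum => i _; rewrite npsi; case: eqP => [le|_]; last first.
      by rewrite mul0r mulr_ge0 ?powR_ge0.
    have tx : t J < nc (phi j i) by apply: lev_gt; rewrite le lE.
    have x0 : 0 < nc (phi j i) by exact: lt_trans tx.
    have xE : nc (phi j i) = nc (phi j i) `^ r * nc (phi j i) `^ (1 - r).
      rewrite -powRD; first by rewrite addrC subrK powRr1 ?(ltW x0).
      by rewrite (gt_eqF x0) implybT.
    rewrite mul1r {1}xE ler_wpM2l ?powR_ge0//.
    rewrite -(opprB r 1) !powRN lef_pV2 ?posrE ?powR_gt0// ?t0//.
    have r1 : 0 <= r - 1 by rewrite rE addrAC subrr add0r invr_ge0 ltW.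
    have x1 := ltW x0; have t1 := ltW (t0 J); have tx1 := ltW tx.
    by apply: ge0_ler_powR.
  have L2 : X * t J `^ (1 - r) <= expR (xi / r - nu).
    rewrite XE /t -expRM -expRD ler_expR.
    have -> : xi + (xi / r + d * J%:R * nu) * (1 - r) = xi / r - (d * J%:R) * (r - 1) * nu.
      by field; rewrite gt_eqF.
    rewrite lerD2l lerN2 ler_peMl// rE (addrC 1) addrK ler_pdivlMr// mul1r//.
  have L3 : 0 <= (\sum_j \sum_i nc (psi j i)) / m.
    by rewrite divr_ge0 ?(ltW TM)//; apply: sumr_ge0 => j _; apply: sumr_ge0 => i _; exact: normc_ge0.
  apply: (@le_trans _ _ (3 * N%:R * (expR (xi / r - nu)) ^+ 2)).
    by rewrite ler_wpM2l ?mulr_ge0// lerXn2r ?nnegrE ?expR_ge0// (le_trans L1).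
  have -> : 3 * N%:R * (expR (xi / r - nu)) ^+ 2 = 3 * expR (nu + 2%:R * (xi / r - nu)).
    by rewrite expRD expRM_natl NE mulrA.
  have -> : B * Lam2 = 74 * om ^+ 3 * expR (2 * d * nu + nu * (1 - 8 / p) + 2 * (xi / r)).
    by rewrite BE Lam2E [in RHS]expRD [RHS]mulrA.
  have h1 : 0 <= d * nu by rewrite mulr_ge0// ltW.
  have h2 : 0 <= nu * (1 - 8 / p) by rewrite mulr_ge0//; lra.
  by rewrite ler_pM ?expR_ge0// ?ler_expR; lra.
pose e j i := lev j i == l.
have he j i : nc (psi j i) <= t l * (e j i)%:R.
  rewrite npsi mulrC /e; case: eqP => [le|_]; last by rewrite !mulr0.
  by rewrite !mulr1 -le lev_le// le.
pose al0 : R := (\sum_j \sum_i (e j i)%:R) / m; pose al := al0 `^ (2 - 2 / p).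
apply: le_trans (grid_restricted_bound p14 N0 gg gw (t0 l) he) _; rewrite -/m -/al0 -/al.
have al00 : 0 <= al0.
  by rewrite divr_ge0 ?(ltW TM)//; apply: sumr_ge0 => j _; apply: sumr_ge0.
have pr : 2 - 2 / p = 2 / r by rewrite rV; ring.
have pr0 : 0 <= 2 - 2 / p by lra.
have alb : t l ^+ 2 * al <= Lam2 * expR (2 * d * nu).
  have [l0|l0] := posnP l.
    have al1 : al0 <= 1.
      rewrite /al0 ler_pdivrMr// mul1r; apply: (@le_trans _ _ (\sum_(j < T) \sum_(i < M) 1)).
        by apply: ler_sum => j _; apply: ler_sum => i _; case: (e j i).
      by rewrite !sumr_const !card_ord /m -natrM -mulrnA mulnC.
    have : al <= 1 by have := ge0_ler_powR pr0 al00 ler01 al1; rewrite powR1; apply.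
    move=> al1'; rewrite Lam2E /t l0 mulr0 mul0r addr0 -expRM_natl.
    have : 1 <= expR (2 * d * nu) by rewrite -expR0 ler_expR !mulr_ge0// ltW.
      by move=> e1; rewrite ler_pM ?expR_ge0 ?powR_ge0// (le_trans al1').
  have al1 : al0 <= expR (- (d * l.-1%:R * nu * r)).
    have -> : expR (- (d * l.-1%:R * nu * r)) = X / t l.-1 `^ r.
      by rewrite XE /t -expRM -expRN -expRD; congr expR; field; rewrite gt_eqF.
    rewrite /al0 /X mulrAC ler_wpM2r ?invr_ge0 ?(ltW TM)// ler_pdivlMr ?powR_gt0//.
    rewrite mulr_suml; apply: ler_sum => j _; rewrite mulr_suml; apply: ler_sum => i _.
    rewrite /e; case: eqP => [le|_]; last by rewrite mul0r powR_ge0.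
    have tl : t l.-1 < nc (phi j i) by apply: lev_gt; rewrite le prednK.
    by rewrite mul1r ge0_ler_powR ?nnegrE ?normc_ge0// ltW.
  have al2 : al <= expR (- (2 * d * l.-1%:R * nu)).
    have := ge0_ler_powR pr0 al00 (expR_ge0 _) al1; rewrite -/al -expRM pr.
    rewrite (_ : - (d * l.-1%:R * nu * r) * (2 / r) = - (2 * d * l.-1%:R * nu)) //.
    by field; rewrite gt_eqF.
  apply: (@le_trans _ _ (t l ^+ 2 * expR (- (2 * d * l.-1%:R * nu)))).
    by rewrite ler_wpM2l// sqr_ge0.
  rewrite Lam2E /t -expRM_natl -!expRD ler_expR.
  have -> : l%:R = l.-1%:R + 1 :> R by rewrite natr1 prednK.
  lra.
have -> : t l ^+ 2 * (74 * om ^+ 3 * (N%:R `^ (1 - 8 / p) * al)) =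
   (t l ^+ 2 * al) * (74 * om ^+ 3 * N%:R `^ (1 - 8 / p)) by ring.
rewrite /B (_ : N%:R `^ (2 * d) = expR (2 * d * nu)); last by rewrite NE -expRM mulrC.
have -> : expR (2 * d * nu) * (74 * om ^+ 3 * N%:R `^ (1 - 8 / p)) * Lam2 =
   (Lam2 * expR (2 * d * nu)) * (74 * om ^+ 3 * N%:R `^ (1 - 8 / p)) by ring.
by rewrite ler_wpM2r// !mulr_ge0 ?powR_ge0// exprn_ge0.
Qed.

End StrongType.

(** * Translation of integrals over the torus *)

Section ShiftInvariance.
Variable R : realType.
Local Open Scope classical_set_scope.
Local Open Scope ereal_scope.
Local Notation leb := (@lebesgue_measure R).
Local Notation leb2 := (leb \x leb)%E.

Lemma measurable_shift (c : R) :
  measurable_fun setT ((fun x : R => (x + c)%R) : measurableTypeR R -> measurableTypeR R).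
Proof. exact: measurable_funD. Qed.

Lemma lebesgue_measure_shift (c : R) (A : set R) : measurable A ->
  pushforward leb ((fun x : R => (x + c)%R) : _ -> measurableTypeR R) A = leb A.
Proof.
move=> mA.
pose mix := isMeasurableFun.Build _ _ _ _ _ (measurable_shift c).
pose f : {mfun measurableTypeR R >-> measurableTypeR R} := HB.pack (fun x : R => (x + c)%R) mix.
apply/esym/(@lebesgue_measure_unique _ (pushforward leb f)) => //= _ [[a b]] _ <-.
rewrite /pushforward (_ : _ @^-1` _ = `](a - c)%R, (b - c)%R]%classic).
  rewrite !lebesgue_measure_itv/= !lte_fin ltrD2r; case: ifP => // _.
  by rewrite -!EFinB; congr EFin; ring.
by apply/seteqP; split => x /=; rewrite !in_itv/= ltrBlDr lerBrDr.
Qed.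

Lemma measurable_comp_shift (c : R) (h : R -> \bar R) : measurable_fun setT h ->
  measurable_fun setT (fun x : R => h (x + c)%R).
Proof. by move=> mh; apply: (measurableT_comp mh); exact: measurable_shift. Qed.

Lemma ge0_integral_shift (c : R) (D : set R) (h : R -> \bar R) : measurable D ->
  measurable_fun setT h -> (forall x, 0 <= h x) ->
  \int[leb]_(x in (fun y : R => (y + c)%R) @^-1` D) h ((x : R) + c)%R = \int[leb]_(x in D) h x.
Proof.
move=> mD mh h0; rewrite -(ge0_integral_pushforward (measurable_shift c))//=; last first.
  exact: measurable_funTS.
apply: eq_measure_integral => [|mphi A mA _]; first exact: measurable_shift.
exact: lebesgue_measure_shift.
Qed.

(** The part of the interval pushed beyond 1 is brought back by the period. *)
Lemma integral_periodic_shift (c : R) (h : R -> \bar R) : (0 <= c <= 1)%R ->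
  measurable_fun setT h -> (forall x, 0 <= h x) -> (forall x, h (x + 1)%R = h x) ->
  \int[leb]_(x in `[0%R, 1%R]%classic) h ((x : R) + c)%R = \int[leb]_(x in `[0%R, 1%R]%classic) h x.
Proof.
move=> /andP[c0 c1] mh h0 hp.
have mhc := measurable_comp_shift c mh.
rewrite -!integral_itv_bndo_bndc; [|exact: measurable_funTS|exact: (measurable_funTS mhc)].
have e1 : `[0%R, 1%R[%classic = (fun x => (x + c)%R) @^-1` `[c, (1 + c)%R[%classic.
  by apply/seteqP; split => x /=; rewrite !in_itv/= lerDr ltrD2r.
rewrite [in LHS]e1 ge0_integral_shift//.
have e2 : `[c, (1 + c)%R[%classic = `[c, 1%R[%classic `|` `[1%R, (1 + c)%R[%classic.
  apply/seteqP; split => x /=; rewrite !in_itv/=.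
    by move=> /andP[h1 h2]; case: (ltP x 1%R) => h3; [left|right]; apply/andP; split; lra.
  by move=> [|] /andP[h1 h2]; apply/andP; split; lra.
have e3 : `[0%R, 1%R[%classic = `[0%R, c[%classic `|` `[c, 1%R[%classic :> set R.
  apply/seteqP; split => x /=; rewrite !in_itv/=.
    by move=> /andP[h1 h2]; case: (ltP x c) => h3; [left|right]; apply/andP; split; lra.
  by move=> [|] /andP[h1 h2]; apply/andP; split; lra.
have dj (a b d : R) : [disjoint `[a, b[ & `[b, d[].
  by apply/disj_setPS => x /=; rewrite !in_itv/= => -[/andP[_ h1] /andP[h2 _]]; lra.
rewrite e2 e3 !ge0_integral_setU//; [|exact: measurable_funTS|exact: measurable_funTS].
rewrite addeC; congr (_ + _).
have e4 : `[0%R, c[%classic = (fun x => (x + 1)%R) @^-1` `[1%R, (1 + c)%R[%classic.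
  by apply/seteqP; split => x /=; rewrite !in_itv/= lerDr (addrC x) ltrD2l.
rewrite [in RHS]e4 -[LHS](ge0_integral_shift 1)//.
by apply: eq_integral => x _; rewrite hp.
Qed.

Local Notation sq := (@unit_square R).

Lemma measurable_unit_square : measurable sq.
Proof. by apply: measurableX. Qed.

Lemma ge0_integral_square (g : R * R -> \bar R) : measurable_fun setT g -> (forall z, 0 <= g z) ->
  \int[leb2]_(z in sq) g z =
  \int[leb]_(x in `[0%R, 1%R]%classic) \int[leb]_(y in `[0%R, 1%R]%classic) g (x, y).
Proof.
move=> mg g0; rewrite integral_mkcond fubini_tonelli1//; last 2 first.
- apply/(measurable_restrictT _ _).1; [exact: measurable_unit_square|exact: measurable_funTS].
- by move=> z; rewrite patchE; case: ifP.
rewrite [RHS]integral_mkcond; apply: eq_integral => x _; rewrite /fubini_F !patchE.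
case: ifPn => [|] xI.
  rewrite [RHS]integral_mkcond; apply: eq_integral => y _; rewrite !patchE.
  have -> : ((x, y) \in sq) = (y \in `[0%R, 1%R]%classic).
    apply/idP/idP; rewrite !inE /unit_square /=; first by case.
    by move=> ?; split => //; move: xI; rewrite inE.
  by [].
rewrite integral0_eq// => y _; rewrite patchE ifF//; apply/negbTE; apply: contra xI.
by rewrite !inE /unit_square => -[].
Qed.

(** One variable at a time, by Tonelli's theorem. *)
Lemma ge0_integral_square_shift (c : R * R) (g : R * R -> \bar R) :
  (0 <= c.1 <= 1)%R -> (0 <= c.2 <= 1)%R ->
  measurable_fun setT g -> (forall z, 0 <= g z) ->
  (forall z, g (z + (1, 0))%R = g z) -> (forall z, g (z + (0, 1))%R = g z) ->
  \int[leb2]_(z in sq) g (z + c)%R = \int[leb2]_(z in sq) g z.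
Proof.
move=> c1 c2 mg g0 g1 g2; rewrite !ge0_integral_square//; last first.
  apply: measurableT_comp => //; apply/measurable_fun_pairP; split => /=.
    by apply: measurable_funD.
  by apply: measurable_funD.
pose F x := \int[leb]_(y in `[0%R, 1%R]%classic) g (x, y).
have eF x : \int[leb]_(y in `[0%R, 1%R]%classic) g ((x, y) + c)%R = F (x + c.1)%R.
  rewrite /F -[RHS](integral_periodic_shift c2)//.
  - exact: measurable_fun_pair2.
  - by move=> y; have := g2 (x + c.1, y)%R; rewrite /GRing.add/= /add_pair/= addr0.
under [LHS]eq_integral do rewrite eF.
rewrite (@integral_periodic_shift _ F)//.
- pose D2 : set (R * R) := setT `*` `[0%R, 1%R]%classic.
  have mD2 : measurable D2 by apply: measurableX.
  have mgD : measurable_fun setT (g \_ D2).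
    by apply/(measurable_restrictT _ _).1; [exact: mD2|exact: measurable_funTS].
  (* measurability of the partial integral is available for integrals over the
     whole line; restrict g to a strip *)
  rewrite (_ : F = fubini_F leb (g \_ D2)).
    apply: measurable_fun_fubini_tonelli_F => // z; rewrite patchE; case: ifP => // _.
  apply/funext => x; rewrite /F /fubini_F [LHS]integral_mkcond; apply: eq_integral => y _.
  rewrite !patchE; have -> // : ((x, y) \in D2) = (y \in `[0%R, 1%R]%classic).
  by apply/idP/idP; rewrite !inE /D2 /=; [case|].
- by move=> x; apply: integral_ge0.
- move=> x; apply: eq_integral => y _.
  by have := g1 (x, y)%R; rewrite /GRing.add/= /add_pair/= addr0.
Qed.

End ShiftInvariance.

(** * From the grid to the torus *)

Section Transference.
Variable R : realType.
Local Open Scope classical_set_scope.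
Local Notation leb := (@lebesgue_measure R).
Local Notation leb2 := (leb \x leb)%E.
Local Notation sq := (@unit_square R).
Local Notation nc := (@Normc.normc R).
Local Notation cRe := (@complex.Re R).
Local Notation cIm := (@complex.Im R).
Local Notation ec := (@ec R).

Definition doubly_periodic (V : Type) (g : R * R -> V) :=
  (forall z, g (z + (1, 0)) = g z) /\ (forall z, g (z + (0, 1)) = g z).

Lemma measurable_translation (c : R * R) : measurable_fun setT (fun z : R * R => z + c).
Proof. by apply/measurable_fun_pairP; split => /=; apply: measurable_funD. Qed.

Lemma integral_square_shift (c : R * R) (g : R * R -> R) :
  0 <= c.1 <= 1 -> 0 <= c.2 <= 1 -> measurable_fun setT g -> doubly_periodic g ->
  (\int[leb2]_(z in sq) (g (z + c))%:E = \int[leb2]_(z in sq) (g z)%:E)%E.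
Proof.
move=> c1 c2 mg [g1 g2]; rewrite integralE [RHS]integralE.
have mE : measurable_fun setT (EFin \o g) by exact/measurable_EFinP.
have h1 := @ge0_integral_square_shift R c (EFin \o g)^\+%E c1 c2.
have h2 := @ge0_integral_square_shift R c (EFin \o g)^\-%E c1 c2.
congr (_ - _)%E.
  rewrite -[RHS]h1 //.
  - by apply: eq_integral => z _; rewrite !funeposE.
  - exact: measurable_funepos.
  - by move=> z; rewrite !funeposE /= g1.
  - by move=> z; rewrite !funeposE /= g2.
rewrite -[RHS]h2 //.
- by apply: eq_integral => z _; rewrite !funenegE.
- exact: measurable_funeneg.
- by move=> z; rewrite !funenegE /= g1.
- by move=> z; rewrite !funenegE /= g2.
Qed.

Lemma integrable_square_shift (c : R * R) (g : R * R -> R) :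
  0 <= c.1 <= 1 -> 0 <= c.2 <= 1 -> measurable_fun setT g -> doubly_periodic g ->
  leb2.-integrable sq (EFin \o g) -> leb2.-integrable sq (fun z => (g (z + c))%:E).
Proof.
move=> c1 c2 mg [g1 g2] /integrableP[_ ig]; apply/integrableP; split.
  apply/measurable_EFinP/measurable_funTS.
  by apply: (measurableT_comp mg); exact: measurable_translation.
rewrite (ge0_integral_square_shift (g := fun z => `|(g z)%:E|%E) c1 c2)//.
- by apply: measurableT_comp => //; exact/measurable_EFinP.
- by move=> z; rewrite g1.
- by move=> z; rewrite g2.
Qed.

Lemma measurable_normc (f : R * R -> R[i]) :
  measurable_fun setT (fun z => cRe (f z)) -> measurable_fun setT (fun z => cIm (f z)) ->
  measurable_fun setT (fun z => nc (f z)).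
Proof.
move=> m1 m2; rewrite (_ : (fun z => _) = Num.sqrt \o (fun z => cRe (f z) ^+ 2 + cIm (f z) ^+ 2)).
  apply: measurableT_comp; first by apply: continuous_measurable_fun; exact: sqrt_continuous.
  by apply: measurable_funD; exact: measurable_funX.
by apply/funext => z /=; case: (f z).
Qed.

(** A linear bound for the concave function y^th: it replaces Jensen's inequality
    for the average of y^th, and costs a factor 2 at y = eta. *)
Lemma powR_le_tangent (th eta y : R) : 0 < th <= 1 -> 0 < eta -> 0 <= y ->
  y `^ th <= eta `^ th + eta `^ (th - 1) * y.
Proof.
move=> /andP[t0 t1] e0 y0; have [ye|ey] := leP y eta.
  have h := ge0_ler_powR (ltW t0) y0 (ltW e0) ye.
  by rewrite (le_trans h)// lerDl mulr_ge0// powR_ge0.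
have yp : 0 < y by exact: lt_trans ey.
rewrite -[leLHS]add0r lerD ?powR_ge0//.
have -> : y `^ th = y `^ (th - 1) * y.
  rewrite -{3}(powRr1 y0) -powRD ?subrK//.
  by rewrite (gt_eqF yp) implybT.
rewrite ler_wpM2r// -(opprB 1 th) !powRN lef_pV2 ?posrE ?powR_gt0//.
have th1 : 0 <= 1 - th by lra.
exact: (ge0_ler_powR th1 (ltW e0) y0 (ltW ey)).
Qed.

Lemma leb2_square : leb2 sq = 1%E.
Proof.
have l1 : leb `[0%R, 1%R]%classic = 1%E.
  by rewrite lebesgue_measure_itv/= lte_fin ltr01 -EFinB subr0.
rewrite /unit_square product_measure1E//.
have -> : 1%E = (leb `[0%R, 1%R]%classic * leb `[0%R, 1%R]%classic)%E :> \bar R.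
  by rewrite l1 mule1.
by [].
Qed.

Lemma Re_conj_mul (w u : R[i]) : cRe (w^*%C * u) = cRe w * cRe u + cIm w * cIm u.
Proof. by case: w => a b; case: u => x y /=; rewrite mulNr opprK. Qed.

Lemma normc_sqrE (w : R[i]) : nc w ^+ 2 = cRe w * cRe w + cIm w * cIm w.
Proof. by case: w => a b; rewrite /= sqr_sqrtr ?addr_ge0 ?sqr_ge0. Qed.

Lemma abs_Re_le (w : R[i]) : `|cRe w| <= nc w.
Proof. by case: w => a b /=; rewrite -sqrtr_sqr ler_wsqrtr// lerDl sqr_ge0. Qed.

Lemma abs_Im_le (w : R[i]) : `|cIm w| <= nc w.
Proof. by case: w => a b /=; rewrite -sqrtr_sqr ler_wsqrtr// lerDr sqr_ge0. Qed.

(** W = S(f) is the integral of g = Re of the sum of conj(w_k) f(z) e(-n x - n^3 t),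
    where w_k are the Fourier coefficients of f.  Average g over the translates
    by the grid: at each z the result is a scalar product of w with the grid
    coefficients of the sample phi of f at z plus the grid points.  The
    Cauchy-Schwarz inequality and the grid estimate bound it by
    (W A)^(1/2) X(z)^(1/r), where X(z) is the average of |f|^r over the translated
    grid, and the tangent bound makes this linear in X(z), whose integral is I.
    Arguing with the linear functional g, and not with squares of Fourier
    coefficients, brings in the power 1/r <= 1 of X(z), on the side where
    concavity helps. *)
Lemma transference (r A : R) (N T M : nat) (f : R * R -> R[i]) :
  1 <= r -> 0 <= A -> (0 < T)%N -> (0 < M)%N ->
  (forall phi : 'I_T -> 'I_M -> R[i],
     grid_energy N phi / (T%:R * M%:R) ^+ 2 <=
     A * (((\sum_j \sum_i nc (phi j i) `^ r) / (T%:R * M%:R)) `^ r^-1) ^+ 2) ->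
  doubly_periodic f ->
  measurable_fun setT (fun z => cRe (f z)) -> measurable_fun setT (fun z => cIm (f z)) ->
  forall I : R, (\int[leb2]_(z in sq) (nc (f z) `^ r)%:E = I%:E)%E ->
  forall eta : R, 0 < eta ->
  cubic_energy N f <= Num.sqrt (cubic_energy N f * A) *
    (eta `^ r^-1 + eta `^ (r^-1 - 1) * I).
Proof.
move=> r1 A0 T0 M0 hgrid [fp1 fp2] mRe mIm I hI eta e0.
have msq : measurable sq := @measurable_unit_square R.
have r0 : 0 < r by exact: lt_le_trans r1.
have mn := measurable_normc mRe mIm.
pose F z := nc (f z) `^ r.
have F0 z : 0 <= F z by exact: powR_ge0.
have mF : measurable_fun setT F by apply: (@measurableT_comp _ _ _ _ _ _ (fun x => x `^ r)); [exact: measurable_powR|exact: mn].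
have Fper : doubly_periodic F by split => z; rewrite /F ?fp1 ?fp2.
have iF : leb2.-integrable sq (EFin \o F).
  apply/integrableP; split; first exact/measurable_EFinP/measurable_funTS.
  under eq_integral do rewrite /= ger0_norm//.
  by rewrite hI ltry.
have icst (k : R) : leb2.-integrable sq (fun=> k%:E).
  apply/integrableP; split; first exact: measurable_cst.
  have -> : (\int[leb2]_(z in sq) `|k%:E| = `|k|%:E * leb2 sq)%E by rewrite -integral_cst.
  by rewrite leb2_square mule1 ltry.
(* f is integrable since |f| <= 1 + |f|^r *)
have inf : leb2.-integrable sq (fun z => (nc (f z))%:E).
  refine (@le_integrable _ _ _ leb2 sq msq (fun z => (nc (f z))%:E) (fun z => (1%:E + (F z)%:E)%E) _ _ _).
  - exact/measurable_EFinP/measurable_funTS.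
  - move=> z _; rewrite -EFinD !abse_EFin lee_fin !ger0_norm ?addr_ge0 ?normc_ge0//.
    have [x1|x1] := leP (nc (f z)) 1; first by rewrite (le_trans x1)// lerDl.
    rewrite -[leLHS]add0r lerD//.
    have := ler_powR (ltW x1) r1; rewrite powRr1 ?normc_ge0//.
  - exact: integrableD.
pose n (k : nat) : R := (freq N k)%:~R.
pose m (k : nat) : R := (freq N k ^+ 3)%:~R.
pose ex (k : nat) (z : R * R) : R[i] := expi (- (2 * pi * (n k * z.1 + m k * z.2))).
have nex k z : nc (ex k z) = 1.
  by rewrite /ex /expi /= sinN cosN sqrrN cos2Dsin2 sqrtr1.
pose u k z := f z * ex k z.
have nu k z : nc (u k z) = nc (f z) by rewrite Normc.normcM nex mulr1.
pose w (k : nat) := fourier f (freq N k) (freq N k ^+ 3).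
have marg k : measurable_fun setT (fun z : R * R => - (2 * pi * (n k * z.1 + m k * z.2))).
  apply: measurableT_comp => //; apply: measurable_funM => //.
  by apply: measurable_funD; apply: measurable_funM.
have mexR k : measurable_fun setT (fun z => cRe (ex k z)).
  apply: (measurableT_comp _ (marg k)).
  by apply: continuous_measurable_fun; exact: continuous_cos.
have mexI k : measurable_fun setT (fun z => cIm (ex k z)).
  apply: (measurableT_comp _ (marg k)).
  by apply: continuous_measurable_fun; exact: continuous_sin.
have muR k : measurable_fun setT (fun z => cRe (u k z)).
  rewrite (_ : (fun z => _) = (fun z => cRe (f z) * cRe (ex k z) - cIm (f z) * cIm (ex k z))).
    by apply: measurable_funB; apply: measurable_funM.
  by apply/funext => z; rewrite /u; case: (f z); case: (ex k z).
have muI k : measurable_fun setT (fun z => cIm (u k z)).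
  rewrite (_ : (fun z => _) = (fun z => cRe (f z) * cIm (ex k z) + cIm (f z) * cRe (ex k z))).
    by apply: measurable_funD; apply: measurable_funM.
  by apply/funext => z; rewrite /u; case: (f z); case: (ex k z).
have dom (h : R * R -> R) : measurable_fun setT h -> (forall z, `|h z| <= nc (f z)) ->
    leb2.-integrable sq (fun z => (h z)%:E).
  move=> mh hf.
  refine (@le_integrable _ _ _ leb2 sq msq _ (fun z => (nc (f z))%:E) _ _ inf).
    exact/measurable_EFinP/measurable_funTS.
  by move=> z _; rewrite !abse_EFin lee_fin [leRHS]ger0_norm ?normc_ge0.
have iR k : leb2.-integrable sq (fun z => (cRe (u k z))%:E).
  by apply: (dom (fun z => cRe (u k z))) => // z; rewrite -(nu k); exact: abs_Re_le.
have iI k : leb2.-integrable sq (fun z => (cIm (u k z))%:E).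
  by apply: (dom (fun z => cIm (u k z))) => // z; rewrite -(nu k); exact: abs_Im_le.
(* real part of conj(w_k) u_k *)
pose G k z := cRe (w k) * cRe (u k z) + cIm (w k) * cIm (u k z).
have iG k : leb2.-integrable sq (fun z => (G k z)%:E).
  under eq_fun do rewrite EFinD !EFinM.
  by apply: integrableD => //; exact: integrableZl.
have intG k : (\int[leb2]_(z in sq) (G k z)%:E = (nc (w k) ^+ 2)%:E)%E.
  under eq_integral do rewrite EFinD !EFinM.
  rewrite integralD//; try exact: integrableZl.
  rewrite !integralZl// normc_sqrE EFinD !EFinM; congr (_ * _ + _ * _)%E.
    by rewrite -[LHS](fineK (@integrable_fin_num _ _ _ leb2 sq msq _ (iR k))).
  by rewrite -[LHS](fineK (@integrable_fin_num _ _ _ leb2 sq msq _ (iI k))).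
pose g z := \sum_(k < (2 * N).+1) G k z.
set W2 := cubic_energy N f.
have W2E : W2 = \sum_(k < (2 * N).+1) nc (w k) ^+ 2.
  by rewrite /W2 /cubic_energy big_mkord.
clearbody w.
have ig : leb2.-integrable sq (fun z => (g z)%:E).
  by under eq_fun do rewrite /g -sumEFin; exact: integrable_sum.
have intg : (\int[leb2]_(z in sq) (g z)%:E = W2%:E)%E.
  under eq_integral do rewrite /g -sumEFin.
  rewrite integral_sum//= W2E -sumEFin; apply: eq_bigr => k _; exact: intG.
have mg : measurable_fun setT g.
  apply: measurable_sum => k; apply: measurable_funD; exact: measurable_funM.
have exD k (z c : R * R) : ex k (z + c) = ex k z * ec (- (n k * c.1 + m k * c.2)).
  have -> : ex k z = ec (- (n k * z.1 + m k * z.2)) by rewrite /ex /ec; congr expi; ring.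
  by rewrite -ecD /ex /ec; congr expi; rewrite /=; ring.
have ex1 k z : ex k (z + (1, 0)) = ex k z.
  by rewrite exD /= mulr1 mulr0 addr0 -mulrNz ec_int mulr1.
have ex2 k z : ex k (z + (0, 1)) = ex k z.
  by rewrite exD /= mulr1 mulr0 add0r -mulrNz ec_int mulr1.
have gper : doubly_periodic g.
  by split => z; apply: eq_bigr => k _; rewrite /G /u ?fp1 ?fp2 ?ex1 ?ex2.
pose cc (j : 'I_T) (i : 'I_M) : R * R := (i%:R / M%:R, j%:R / T%:R).
have TR : 0 < T%:R :> R by rewrite ltr0n.
have MR : 0 < M%:R :> R by rewrite ltr0n.
have cc1 j i : 0 <= (cc j i).1 <= 1.
  by rewrite /cc /= divr_ge0//= ler_pdivrMr// mul1r ler_nat ltnW.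
have cc2 j i : 0 <= (cc j i).2 <= 1.
  by rewrite /cc /= divr_ge0//= ler_pdivrMr// mul1r ler_nat ltnW.
pose S := Num.sqrt (W2 * A).
have W20 : 0 <= W2 by rewrite W2E; apply: sumr_ge0 => k _; exact: sqr_ge0.
have S0 : 0 <= S by exact: sqrtr_ge0.
set c1 := eta `^ r^-1; set c2 := eta `^ (r^-1 - 1).
have c20 : 0 <= c2 by exact: powR_ge0.
set tm : R := T%:R * M%:R.
have tm0 : 0 < tm by rewrite mulr_gt0.
(* the estimate at a single z, from the grid inequality for the samples of f *)
have ptw z : \sum_j \sum_i g (z + cc j i) <= tm * S * c1 + S * c2 * \sum_j \sum_i F (z + cc j i).
  pose phi j i := f (z + cc j i).
  have -> : \sum_j \sum_i g (z + cc j i) = \sum_(k < (2 * N).+1)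
      cRe ((w k)^*%C * (ex k z * grid_coef N phi k)).
    rewrite /g; under eq_bigr do rewrite exchange_big /=.
    rewrite exchange_big /=; apply: eq_bigr => k _.
    rewrite /grid_coef !mulr_sumr Re_sum; apply: eq_bigr => j _.
    rewrite !mulr_sumr Re_sum; apply: eq_bigr => i _.
    rewrite Re_conj_mul /G /u exD /phi -/(n k) -/(m k).
    by rewrite [f _ * (ex k z * _)]mulrCA.
  set X := (\sum_j \sum_i F (z + cc j i)) / tm.
  have X0 : 0 <= X.
    by rewrite divr_ge0 ?(ltW tm0)//; apply: sumr_ge0 => j _; apply: sumr_ge0.
  have hX := hgrid phi; rewrite -/tm in hX.
  have E0 : 0 <= grid_energy N phi by apply: sumr_ge0 => k _; exact: sqr_ge0.
  apply: (@le_trans _ _ (Num.sqrt (W2 * grid_energy N phi))).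
    apply: (@le_trans _ _ (\sum_(k < (2 * N).+1) nc (w k) * nc (grid_coef N phi k))).
      apply: ler_sum => k _; apply: le_trans (Re_le_normc _) _.
      by rewrite !Normc.normcM normcJE nex mul1r.
    rewrite -[leLHS]ger0_norm; last first.
      by apply: sumr_ge0 => k _; rewrite mulr_ge0 ?normc_ge0.
    rewrite -sqrtr_sqr ler_wsqrtr// W2E.
    exact: cauchy_schwarz_sum.
  have h1 : grid_energy N phi <= A * (X `^ r^-1) ^+ 2 * tm ^+ 2.
    by rewrite -ler_pdivrMr ?exprn_gt0//; exact: hX.
  apply: (@le_trans _ _ (tm * S * X `^ r^-1)).
    rewrite -[leRHS]ger0_norm; last by rewrite !mulr_ge0 ?powR_ge0 ?(ltW tm0).
    rewrite -[leRHS]sqrtr_sqr ler_wsqrtr//.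
    have S2 : S ^+ 2 = W2 * A by rewrite sqr_sqrtr// mulr_ge0.
    apply: le_trans (ler_wpM2l W20 h1) _; apply: eqW.
    have -> : (tm * S * X `^ r^-1) ^+ 2 = S ^+ 2 * (tm ^+ 2 * (X `^ r^-1) ^+ 2) by ring.
    by rewrite S2; ring.
  have th : 0 < r^-1 <= 1 by rewrite invr_gt0 r0 invf_le1.
  have h2 := powR_le_tangent th e0 X0.
  apply: le_trans (ler_wpM2l (mulr_ge0 (ltW tm0) S0) h2) _.
  rewrite mulrDr lerD//; apply: eqW.
  by rewrite /X -/c2; field; rewrite gt_eqF.
have igs j i : leb2.-integrable sq (fun z => (g (z + cc j i))%:E) by exact: integrable_square_shift.
have iFs j i : leb2.-integrable sq (fun z => (F (z + cc j i))%:E) by exact: integrable_square_shift.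
have igS : leb2.-integrable sq (fun z => (\sum_j \sum_i g (z + cc j i))%:E).
  under eq_fun do rewrite -sumEFin; apply: integrable_sum => // j _.
  by under eq_fun do rewrite -sumEFin; apply: integrable_sum.
have iFS : leb2.-integrable sq (fun z => (\sum_j \sum_i F (z + cc j i))%:E).
  under eq_fun do rewrite -sumEFin; apply: integrable_sum => // j _.
  by under eq_fun do rewrite -sumEFin; apply: integrable_sum.
have intS (h : R * R -> R) (J : R) : (forall j i, leb2.-integrable sq (fun z => (h (z + cc j i))%:E)) ->
    (forall j i, \int[leb2]_(z in sq) (h (z + cc j i))%:E = J%:E)%E ->
    (\int[leb2]_(z in sq) (\sum_j \sum_i h (z + cc j i))%:E = (tm * J)%:E)%E.
  move=> ih hJ; under eq_integral do rewrite -sumEFin.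
  rewrite integral_sum//=; last first.
    by move=> j; under eq_fun do rewrite -sumEFin; apply: integrable_sum.
  rewrite (eq_bigr (fun=> (M%:R * J)%:E)); last first.
    move=> j _; under eq_integral do rewrite -sumEFin.
    rewrite integral_sum//= (eq_bigr (fun=> J%:E))// sumEFin.
    by rewrite sumr_const card_ord mulr_natl.
  by rewrite sumEFin sumr_const card_ord -[(M%:R * J) *+ T]mulr_natl mulrA.
have e1 : (\int[leb2]_(z in sq) (\sum_j \sum_i g (z + cc j i))%:E = (tm * W2)%:E)%E.
  by apply: intS => // j i; rewrite integral_square_shift.
have e2 : (\int[leb2]_(z in sq) (\sum_j \sum_i F (z + cc j i))%:E = (tm * I)%:E)%E.
  by apply: intS => // j i; rewrite integral_square_shift.
have e3 : (\int[leb2]_(z in sq) (tm * S * c1 + S * c2 * \sum_j \sum_i F (z + cc j i))%:E =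
    (tm * S * c1 + S * c2 * (tm * I))%:E)%E.
  under eq_integral do rewrite EFinD (EFinM (S * c2)).
  rewrite integralD//; last exact: integrableZl.
  rewrite integralZl// e2 integral_cst// EFinD EFinM; congr (_ + _)%E.
  by rewrite -[RHS]mule1; congr (_ * _)%E; exact: leb2_square.
have : ((tm * W2)%:E <= (tm * S * c1 + S * c2 * (tm * I))%:E)%E.
  rewrite -e1 -e3; apply: le_integral => //.
    under eq_fun do rewrite EFinD (EFinM (S * c2)).
    by apply: integrableD => //; exact: integrableZl.
  by move=> z _; rewrite lee_fin.
rewrite lee_fin => h; rewrite -(ler_pM2l tm0); apply: le_trans h _.
by apply: eqW; rewrite /S; ring.
Qed.

End Transference.

(** * The restriction estimate *)

Section Assembly.
Variable R : realType.

(** Take eta = I, or let eta tend to 0 when I = 0. *)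
Lemma le_of_tangent_bounds (th W A I : R) : 0 < th <= 1 -> 0 <= W -> 0 <= A -> 0 <= I ->
  (forall eta : R, 0 < eta -> W <= Num.sqrt (W * A) * (eta `^ th + eta `^ (th - 1) * I)) ->
  W <= 4 * A * (I `^ th) ^+ 2.
Proof.
move=> /andP[t0 t1] W0 A0 I0 h.
have WA : 0 <= W * A by rewrite mulr_ge0.
have [W1|W1] := eqVneq W 0; first by rewrite W1 mulr_ge0 ?sqr_ge0// mulr_ge0.
have Wp : 0 < W by rewrite lt_neqAle eq_sym W1.
have sq x : 0 <= x -> W <= Num.sqrt (W * A) * x -> W <= A * x ^+ 2.
  move=> x0 hx; have : W ^+ 2 <= W * A * x ^+ 2.
    rewrite -(sqr_sqrtr WA) -exprMn lerXn2r ?nnegrE ?mulr_ge0// sqrtr_ge0.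
  by rewrite expr2 -mulrA ler_pM2l.
have [I1|I1] := eqVneq I 0.
  rewrite I1 powR0 ?gt_eqF// expr0n mulr0; apply/ler_addgt0Pr => eps eps0; rewrite add0r.
  have e0 : 0 < eps / (A + 1) by rewrite divr_gt0// ltr_wpDl.
  (* chosen so that eta^(2 th) A is at most eps *)
  pose eta := (eps / (A + 1)) `^ (2 * th)^-1.
  have eta0 : 0 < eta by exact: powR_gt0.
  have := h eta eta0; rewrite I1 mulr0 addr0 => /(sq _ (powR_ge0 _ _)) /le_trans; apply.
  rewrite -powR_mulrn ?powR_ge0// /eta -!powRrM.
  have -> : (2 * th)^-1 * (th * 2) = 1 by field; rewrite gt_eqF.
  rewrite powRr1 ?(ltW e0)// mulrA ler_pdivrMr; last by rewrite ltr_wpDl.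
  by rewrite mulrC ler_wpM2l ?(ltW eps0)// lerDl.
have Ip : 0 < I by rewrite lt_neqAle eq_sym I1.
have := h I Ip.
have -> : I `^ (th - 1) * I = I `^ th.
  rewrite -{2}(powRr1 I0) -powRD ?subrK//.
  by rewrite (gt_eqF Ip) implybT.
move=> /sq; rewrite addr_ge0 ?powR_ge0// => /(_ isT) /le_trans; apply.
by apply: eqW; ring.
Qed.

Lemma restriction_bound_of_grid (p A : R) (N T M : nat) :
  1 < p -> 0 <= A -> (0 < T)%N -> (0 < M)%N ->
  (forall phi : 'I_T -> 'I_M -> R[i],
     grid_energy N phi / (T%:R * M%:R) ^+ 2 <=
     A * (((\sum_j \sum_i Normc.normc (phi j i) `^ (p / (p - 1))) / (T%:R * M%:R))
       `^ (p / (p - 1))^-1) ^+ 2) ->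
  restriction_bound p N (4 * A).
Proof.
move=> p1 A0 T0 M0 hgrid f [fp1 fp2 mRe mIm fin].
set r := p / (p - 1) in hgrid fin *.
have r1 : 1 <= r by rewrite ler_pdivlMr; lra.
have r0 : 0 < r by exact: lt_le_trans r1.
move: fin; rewrite /torus_norm; set Int := integral _ _ _ => fin.
have Int0 : (0 <= Int)%E by apply: integral_ge0 => z _; rewrite lee_fin powR_ge0.
have Intfin : Int \is a fin_num.
  rewrite ge0_fin_numE// ltey; apply: contraTneq fin => ->.
  by rewrite poweRyr ?invr_eq0 ?gt_eqF.
pose I := fine Int; have IE : Int = I%:E by rewrite /I fineK.
have I0 : 0 <= I by rewrite fine_ge0.
rewrite IE poweR_EFin -EFin_expe -EFinM lee_fin.
apply: le_of_tangent_bounds => //.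
- by rewrite invr_gt0 r0 invf_le1.
- by apply: sumr_ge0 => k _; exact: sqr_ge0.
- move=> eta eta0.
  exact: (@transference R r A N T M f r1 A0 T0 M0 hgrid (conj fp1 fp2) mRe mIm I IE eta eta0).
Qed.

End Assembly.

Theorem theorem1p1 (R : realType) (p : R) (hp : 14 <= p)
    (eps : R) (heps : 0 < eps) :
  exists C : R, forall N : nat, (0 < N)%N ->
    (best_constant p N <= (C * N%:R `^ (1 - 8 / p + eps))%:E)%E.
Proof.
have d0 : 0 < eps / 8 by rewrite divr_gt0.
have e0 : 0 < eps / 4 by rewrite divr_gt0.
have [C C1 hC] := good_gauge_exists e0.
(* J steps of size eps / 8 reach p - 1, after which the top level is trivial *)
pose J := (Num.truncn ((p - 1) / (eps / 8))).+1.
have hJ : p - 1 <= eps / 8 * J%:R.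
  by rewrite mulrC -ler_pdivrMr// ltW// truncnS_gt.
(* 4 comes from the tangent bound, J + 2 is the number of levels, and 74 C^3 and the
   powers of N beyond N^(1 - 8/p) come from the restricted bound and the levels *)
exists (4 * (J.+2%:R ^+ 2 * (74 * C ^+ 3))) => N N0.
have gg := good_grid_exists N0; set T := (_ `!)%N in gg; set M := (6 * N).+1 in gg.
have T0 : (0 < T)%N by exact: fact_gt0.
have C0 : 0 <= C by lra.
pose A := J.+2%:R ^+ 2 * (N%:R `^ (2 * (eps / 8)) *
  (74 * (C * N%:R `^ (eps / 4)) ^+ 3 * N%:R `^ (1 - 8 / p))).
have A0 : 0 <= A by rewrite !mulr_ge0 ?powR_ge0 ?exprn_ge0 ?mulr_ge0 ?powR_ge0.
have AE : 4 * A = 4 * (J.+2%:R ^+ 2 * (74 * C ^+ 3)) * N%:R `^ (1 - 8 / p + eps).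
  have Nn0 : N%:R != 0 :> R by rewrite pnatr_eq0 -lt0n.
  have powND a b : N%:R `^ (a + b) = N%:R `^ a * N%:R `^ b :> R.
    by rewrite powRD// Nn0 implybT.
  have powN3 : N%:R `^ (eps / 4 * 3) = (N%:R `^ (eps / 4)) ^+ 3 :> R.
    by rewrite (powRrM _ _ 3) powR_mulrn// powR_ge0.
  rewrite /A; move: (1 - 8 / p) => b.
  have -> : b + eps = 2 * (eps / 8) + (eps / 4 * 3 + b) by field.
  by rewrite !powND powN3 (exprMn 3 C) !mulrA; ring.
apply: ereal_inf_lbound; exists (4 * A); last by rewrite AE.
apply: (@restriction_bound_of_grid R p A N T M) => //; first by lra.
move=> phi; exact: (grid_strong_bound phi hp N0 gg (hC N N0) d0 hJ erefl).
Qed.
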